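(* Let $\mathbb{H}^n(-1)$ be the $n$-dimensional hyperbolic space in the upper half space model $\left(\mathbb{R}^n_+,\frac{dx_1^2+dx_2^2+\cdots+dx_n^2}{x_n^2}\right)$, where $\mathbb{R}^n_+=\{x\in\mathbb{R}^n: x_n>0\}$, and let $\Omega$ be a bounded connected domain in $\mathbb{H}^n(-1)$. Put $\rho_{max}=\max_{\overline\Omega}\frac1{x_n^2}$ and $\rho_{min}=\min_{\overline\Omega}\frac1{x_n^2}$. Then the eigenvalues $0<\lambda_1<\lambda_2\le\lambda_3\le\cdots$ of the Dirichlet problem $\Delta u=-\lambda u$ in $\Omega$, $u|_{\partial\Omega}=0$, satisfy, for every integer $k\ge1$, $$\sum_{i=1}^k(\lambda_{k+1}-\lambda_i)^2\le\frac{\rho_{max}}{\rho_{min}}\,\frac4n\sum_{i=1}^k(\lambda_{k+1}-\lambda_i)\left(\lambda_i-\frac{n^2-2n-4}{4}\right).$$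
   Context: $\Delta$ is the Laplacian (Laplace--Beltrami operator, the divergence of the gradient) of the hyperbolic metric. Eigenvalues are repeated according to multiplicity; the Dirichlet condition is understood in the usual sense ($u\in H^1_0(\Omega)$). $\overline\Omega$ is the closure of $\Omega$ in $\mathbb{H}^n(-1)$, which is compact. *)

(* Defs.v *)
From HB Require Import structures.
From mathcomp Require Import all_boot all_order all_algebra.
From mathcomp Require Import all_classical all_reals all_analysis.

Set Implicit Arguments.
Unset Strict Implicit.
Unset Printing Implicit Defensive.

Import Order.TTheory GRing.Theory Num.Theory.
Import numFieldNormedType.Exports.

Local Open Scope classical_set_scope.
Local Open Scope ring_scope.

Section measurable_rV.
Context {R : realType} (n : nat).

Let coord : 'I_n -> 'rV[R]_n -> measurableTypeR R := fun i v => v ord0 i.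

Let rV_set0 : g_sigma_preimage coord set0.
Proof. exact: sigma_algebra0. Qed.

Let rV_setC A : g_sigma_preimage coord A -> g_sigma_preimage coord (~` A).
Proof. exact: sigma_algebraC. Qed.

Let rV_bigcup (F : _^nat) : (forall i, g_sigma_preimage coord (F i)) ->
  g_sigma_preimage coord (\bigcup_i (F i)).
Proof. exact: sigma_algebra_bigcup. Qed.

Definition measure_rV_display : measure_display. Proof. exact. Qed.

HB.instance Definition _ := @isMeasurable.Build measure_rV_display
  'rV[R]_n (g_sigma_preimage coord) rV_set0 rV_setC rV_bigcup.

Lemma measurable_coord (i : 'I_n) :
  measurable_fun [set: 'rV[R]_n] (fun v => v ord0 i : measurableTypeR R).
Proof.
move=> _ Y mY; rewrite setTI; apply: sub_sigma_algebra => /=.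
rewrite -bigcup_seq/=; exists i => /=; first by rewrite mem_index_enum.
by exists Y => //; rewrite setTI.
Qed.

Lemma measurable_fun_coordP d (T : measurableType d) (f : T -> 'rV[R]_n) :
  (forall i, measurable_fun [set: T] (fun t => f t ord0 i : measurableTypeR R)) ->
  measurable_fun [set: T] f.
Proof.
move=> mf _ A mA; rewrite setTI.
have : (image_set_system setT f measurable) A.
  move: A mA; apply: smallest_sub.
    exact/sigma_algebra_image/sigma_algebra_measurable.
  move=> A; rewrite -bigcup_seq/= => -[i _ [B mB <-]].
  by rewrite /image_set_system/= setTI; exact: mf.
by rewrite /image_set_system/= setTI.
Qed.

End measurable_rV.

Section lebesgue_rV.
Context {R : realType}.

Definition rV_cons n (p : measurableTypeR R * 'rV[R]_n) : 'rV[R]_n.+1 :=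
  row_mx (p.1 : R)%:M p.2.

Lemma rV_cons0 n p : @rV_cons n p ord0 ord0 = p.1.
Proof.
have := row_mxEl ((p.1 : R)%:M : 'rV[R]_1) p.2 ord0 ord0.
rewrite [_%:M _ _]mxE eqxx mulr1n => <-; rewrite /rV_cons; congr (row_mx _ _ _ _).
exact/val_inj.
Qed.

Lemma rV_consS n p (i : 'I_n) : rV_cons p ord0 (lift ord0 i) = p.2 ord0 i.
Proof.
have <- := row_mxEr ((p.1 : R)%:M : 'rV[R]_1) p.2 ord0 i.
by rewrite /rV_cons; congr (row_mx _ _ _ _); exact/val_inj.
Qed.

Lemma measurable_rV_cons n : measurable_fun setT (@rV_cons n).
Proof.
apply: measurable_fun_coordP => i.
case: (unliftP ord0 i) => [j ->|->].
  under eq_fun do rewrite rV_consS.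
  apply: (measurableT_comp (measurable_coord j)); exact: measurable_snd.
under eq_fun do rewrite rV_cons0.
exact: measurable_fst.
Qed.

Section step.
Variables (n : nat) (mu : {sigma_finite_measure set 'rV[R]_n -> \bar R}).

Definition lebesgue_step : set 'rV[R]_n.+1 -> \bar R :=
  pushforward (lebesgue_measure \x mu)%E (@rV_cons n).

Let step0 : lebesgue_step set0 = 0%E.
Proof. by rewrite /lebesgue_step /pushforward preimage_set0 measure0. Qed.

Let step_ge0 A : (0 <= lebesgue_step A)%E.
Proof. by rewrite /lebesgue_step /pushforward measure_ge0. Qed.

Let step_sigma_additive : semi_sigma_additive lebesgue_step.
Proof.
move=> F mF tF mUF; rewrite /lebesgue_step /pushforward preimage_bigcup.
apply: measure_semi_sigma_additive.
- by move=> k; rewrite -[X in measurable X]setTI; exact: measurable_rV_cons.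
- apply/trivIsetP => /= i j _ _ ij; rewrite -preimage_setI.
  by move/trivIsetP : tF => /(_ _ _ _ _ ij) ->//; rewrite preimage_set0.
- rewrite -preimage_bigcup -[X in measurable X]setTI.
  exact: measurable_rV_cons.
Qed.

HB.instance Definition _ := isMeasure.Build _ _ _ lebesgue_step
  step0 step_ge0 step_sigma_additive.

Let step_sigma_finite : sigma_finite setT lebesgue_step.
Proof.
have /sigma_finiteP[F [FT ndF mF]] := sigma_finiteT (@lebesgue_measure R).
have /sigma_finiteP[G [GT ndG mG]] := sigma_finiteT mu.
pose split (v : 'rV[R]_n.+1) : measurableTypeR R * 'rV[R]_n :=
  (v ord0 ord0, \row_i v ord0 (lift ord0 i)).
have splitK : cancel (@rV_cons n) split.
  move=> [x v]; rewrite /split rV_cons0; congr pair.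
  by apply/rowP => i; rewrite mxE rV_consS.
have msplit : measurable_fun setT split.
  apply/measurable_fun_pairP; split; first exact: measurable_coord.
  apply: measurable_fun_coordP => i.
  rewrite (_ : (fun t => _) = (fun v : 'rV[R]_n.+1 => v ord0 (lift ord0 i))).
    exact: measurable_coord.
  by apply/funext => v; rewrite mxE.
exists (fun k => split @^-1` (F k `*` G k)).
  apply/seteqP; split=> // v _.
  have [i _ Fi] : (\bigcup_k F k) (split v).1 by rewrite -FT.
  have [j _ Gj] : (\bigcup_k G k) (split v).2 by rewrite -GT.
  exists (maxn i j) => //; split.
    by move: Fi; exact/subsetPset/ndF/leq_maxl.
  by move: Gj; exact/subsetPset/ndG/leq_maxr.
move=> k; have [mFk Fk] := mF k; have [mGk Gk] := mG k; split.
  by rewrite -[X in measurable X]setTI; apply: msplit => //; exact: measurableX.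
rewrite /lebesgue_step /pushforward -comp_preimage.
rewrite (_ : split \o _ = id); last exact/funext.
by rewrite preimage_id product_measure1E// lte_mul_pinfty// ge0_fin_numE.
Qed.

HB.instance Definition _ := @Measure_isSigmaFinite.Build _ _ _ lebesgue_step
  step_sigma_finite.

End step.

Fixpoint lebesgue_rV n : {sigma_finite_measure set 'rV[R]_n -> \bar R} :=
  match n with
  | 0 => \d_ (0 : 'rV[R]_0)
  | n'.+1 => lebesgue_step (lebesgue_rV n')
  end.

Lemma lebesgue_rV_box n (A : 'I_n -> set (measurableTypeR R)) :
  (forall i, measurable (A i)) ->
  lebesgue_rV n [set v | forall i, A i (v ord0 i)] =
  (\prod_(i < n) lebesgue_measure (A i))%E.
Proof.
elim: n A => [|n IHn] A mA /=.
  rewrite big_ord0 diracE mem_set//= => -[].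
  by [].
pose B := [set v : 'rV[R]_n | forall i, A (lift ord0 i) (v ord0 i)].
have mB : measurable B.
  rewrite (_ : B = \bigcap_(i in [set: 'I_n])
      ((fun v : 'rV[R]_n => v ord0 i : measurableTypeR R) @^-1` A (lift ord0 i))).
    apply: fin_bigcap_measurable => //= i _.
    by rewrite -[X in measurable X]setTI; exact: measurable_coord.
  by apply/seteqP; split => v /= h i; [move=> _|]; exact: h.
rewrite big_ord_recl -IHn// -/B -product_measure1E// /lebesgue_step /pushforward.
congr (_ _); apply/seteqP; split => -[x v] /=.
  move=> h; split=> /= [|i]; first by have := h ord0; rewrite rV_cons0.
  by have := h (lift ord0 i); rewrite rV_consS.
move=> [/= hx hv] i; case: (unliftP ord0 i) => [j ->|->].
  by rewrite rV_consS.
by rewrite rV_cons0.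
Qed.

End lebesgue_rV.

(* The hyperbolic space has dimension [n.+1], so that the last coordinate
   [height] exists; its metric is [height ^- 2] times the Euclidean one, and its
   volume is [height ^- n.+1 dx]. *)

Section hyperbolic.
Context {R : realType} {n : nat}.
Local Notation pt := 'rV[R]_n.+1.
Implicit Types (x y v w : pt) (f g u phi : pt -> R) (X : pt -> pt).
Implicit Types (Omega : set pt) (t : R).

Definition height x : R := x ord0 ord_max.

Definition upper_half_space : set pt := [set x | 0 < height x].

Definition hyp_dot x v w : R :=
  height x ^- 2 * \sum_(j < n.+1) v ord0 j * w ord0 j.

Definition acosh (r : R) : R := ln (r + Num.sqrt (r ^+ 2 - 1)).

Definition hyp_dist x y : R :=
  acosh (1 + (\sum_(j < n.+1) (x ord0 j - y ord0 j) ^+ 2)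
             / (2 * height x * height y)).

Definition hyp_bounded Omega :=
  exists2 p, upper_half_space p &
  exists r : R, forall x, Omega x -> hyp_dist p x <= r.

Definition hyp_bounded_domain Omega :=
  [/\ Omega `<=` upper_half_space, open Omega, connected Omega, Omega !=set0
    & hyp_bounded Omega].

Definition hyp_closure Omega : set pt := closure Omega `&` upper_half_space.

Definition rho x : R := height x ^- 2.

(* For a bounded domain the closure is compact in the half space, so that this
   supremum and this infimum are attained. *)
Definition rho_max Omega : R := sup (rho @` hyp_closure Omega).
Definition rho_min Omega : R := inf (rho @` hyp_closure Omega).

Definition partial (j : 'I_n.+1) f : pt -> R := 'D_(delta_mx ord0 j) f.

Definition smooth f := forall s : seq 'I_n.+1,
  continuous (foldr partial f s) /\
  forall x j, derivable (foldr partial f s) x (delta_mx ord0 j).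

Definition tsupport f : set pt := closure [set x | f x != 0].

Definition test_function Omega phi :=
  [/\ smooth phi, compact (tsupport phi) & tsupport phi `<=` Omega].

Definition hyp_grad f : pt -> pt :=
  fun x => \row_j (height x ^+ 2 * partial j f x).

(* [(1 / sqrt(det g)) * \sum_j d_j (sqrt(det g) X_j)], with
   [sqrt(det g) = height ^- n.+1] *)
Definition hyp_div X : pt -> R := fun x =>
  height x ^+ n.+1 *
  \sum_(j < n.+1) partial j (fun y => height y ^- n.+1 * X y ord0 j) x.

Definition hyp_laplacian f : pt -> R := hyp_div (hyp_grad f).

Definition hyp_int Omega f : R :=
  \int[lebesgue_rV n.+1]_(x in Omega) (f x * height x ^- n.+1).

Definition sqnorm Omega f : \bar R :=
  (\int[lebesgue_rV n.+1]_(x in Omega) (f x ^+ 2 * height x ^- n.+1)%:E)%E.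

Definition sqnorm_grad Omega f : \bar R :=
  (\int[lebesgue_rV n.+1]_(x in Omega)
    (hyp_dot x (hyp_grad f x) (hyp_grad f x) * height x ^- n.+1)%:E)%E.

(* The completion of the test functions for the H^1 norm, realised inside
   L^2(Omega). *)
Definition H10 Omega u :=
  [/\ measurable_fun Omega (u : pt -> measurableTypeR R),
      (sqnorm Omega u < +oo)%E &
      exists phi : nat -> pt -> R,
        [/\ forall m, test_function Omega (phi m),
            sqnorm Omega (phi m \- u)%R @[m --> \oo] --> 0%E &
            forall e : R, 0 < e -> exists N : nat, forall m l : nat,
              (N <= m)%N -> (N <= l)%N ->
              (sqnorm_grad Omega (phi m \- phi l)%R < e%:E)%E]].

(* [Delta u = - t u] in the sense of distributions on [Omega], with the
   Dirichlet condition; [u = 0] is included. *)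
Definition dirichlet_solution Omega t u :=
  H10 Omega u /\
  forall phi, test_function Omega phi ->
    hyp_int Omega (u \* hyp_laplacian phi) = - t * hyp_int Omega (u \* phi).

(* The space of solutions, modulo almost everywhere equality, has dimension
   [m]; this says that [t] is not an eigenvalue when [m = 0]. *)
Definition dirichlet_multiplicity Omega t (m : nat) :=
  exists e : 'I_m -> pt -> R,
    [/\ forall i, dirichlet_solution Omega t (e i),
        forall c : 'I_m -> R,
          (fun x => \sum_(i < m) c i * e i x) = cst 0
            %[ae lebesgue_rV n.+1 in Omega] ->
          forall i, c i = 0 &
        forall u, dirichlet_solution Omega t u ->
          exists c : 'I_m -> R,
            u = (fun x => \sum_(i < m) c i * e i x)
              %[ae lebesgue_rV n.+1 in Omega]].

(* [lam 1 <= lam 2 <= ...] lists the eigenvalues, each as many times as its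
   multiplicity; [lam 0] is not used. *)
Definition dirichlet_eigenvalues Omega (lam : nat -> R) :=
  (forall i j : nat, (0 < i <= j)%N -> lam i <= lam j) /\
  forall t, exists2 m, dirichlet_multiplicity Omega t m &
    ([set i | (0 < i)%N /\ lam i = t] #= `I_m)%card.

End hyperbolic.

(* Main.v *)
From HB Require Import structures.
Require Import Defs.
From mathcomp Require Import all_boot all_order all_algebra.
From mathcomp Require Import all_classical all_reals all_analysis.
From mathcomp Require Import measurable_realfun.
From mathcomp Require Import ring lra.
Import Order.TTheory GRing.Theory Num.Theory.
Import numFieldNormedType.Exports.
Local Open Scope classical_set_scope.
Local Open Scope ring_scope.
Set Implicit Arguments.
Unset Strict Implicit.
Unset Printing Implicit Defensive.

(** Write [N] for the dimension, [h] for the height, and [b] and [E] for the two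
    forms [b f g = \int f g] and [E f g = \int <grad f, grad g>] on test
    functions, the integrals being taken for the hyperbolic volume.  Integration
    by parts gives [E f g = b (L f) g], where [L] is minus the Laplacian
    ([energy_lap]).

    The proof compares the eigenfunctions with their products by the coordinates
    of the half space.  Multiplication by the [j]-th coordinate is an operator
    [X_j], symmetric for [b], and its commutator with [L] is of first order:
      [C_j f = X_j (L f) - L (X_j f)
             = h (2 h d_j f + (2 - N) f)]  if [j] is the height direction,
      [C_j f = 2 h^2 d_j f]  otherwise.
    Let [u_1, .., u_k] be orthonormal eigenfunctions for [lam_1, .., lam_k], put
    [L' = lam_(k+1)], and subtract from [X_j u_i] its components along
    [u_1, .., u_k].  The resulting trial function has a Rayleigh quotient at
    least [L'], its energy is computed by the commutator, and Cauchy-Schwarz,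
    followed by a cancellation of the antisymmetric terms, gives for each [j]
      [\sum_i (L' - lam_i)^2 (- b (C_j u_i) (X_j u_i))
          <= \sum_i (L' - lam_i) b (C_j u_i) (C_j u_i)]
    ([yang_commutator_bound]).  Two integrations by parts evaluate both sides:
    [- b (C_j f) (X_j f)] is the integral of [h^2 f^2]
    ([comm_coord_mul_coord]), and the sum over [j] of [b (C_j f) (C_j f)] is, up
    to a factor [h^2] under the integral, equal to
    [4 E f f - N (N - 2) b f f] ([sum_comm_coord_le]).  Since [h^2 = 1 / rho], the two sides are controlled
    by [1 / rho_max] and [1 / rho_min], and summing over the [N] coordinates
    yields the theorem, with [N^2 - 2 N] where it has [N^2 - 2 N - 4].

    The eigenfunctions are not test functions.  The argument therefore takes
    place in the completion of the test functions for [b + E], to which forms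
    and bounded operators extend by continuity ([yang_inequality]).  That
    [lam_(k+1)] bounds the Rayleigh quotient on the complement of
    [u_1, .., u_k] is where compactness enters: if it failed, the infimum of the
    quotient would be attained at an eigenvector that the list [lam] omits
    ([exists_minimizer], [eigenvalue_gap]).  The compactness used is an
    inequality of Friedrichs: for each [e > 0],
      [b f f <= \sum_q (l_q f)^2 + e E f f]
    for finitely many linear functionals [l_q], namely multiples of the means of
    [f] over the cells of a fine grid ([grid_friedrichs], [test_friedrichs]).

    By Riesz-Fischer ([riesz_fischer]) each vector of the completion is the
    class of a square integrable function.  These functions are the elements of
    [H10], and the weak solutions of the Dirichlet problem are the eigenvectors
    of [E] relative to [b] ([eigenvector_solution]), so that the Dirichlet
    eigenvalues enumerate the eigenvalues in the completion
    ([enumerates_dirichlet]). *)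

(** * Bilinear forms and the commutator inequality *)

Section forms.
Context {R : realType} {V : lmodType R}.
Implicit Types (F b E : V -> V -> R) (u v w : V) (a : R).

Definition bilinear_form F :=
  (forall a u v w, F (a *: u + v) w = a * F u w + F v w) /\
  (forall a u v w, F w (a *: u + v) = a * F w u + F w v).

Definition semi_inner F :=
  [/\ bilinear_form F, forall u v, F u v = F v u & forall u, 0 <= F u u].

Section bilinear.
Variable F : V -> V -> R.
Hypothesis bF : bilinear_form F.

Lemma bformDl u v w : F (u + v) w = F u w + F v w.
Proof. by have := bF.1 1 u v w; rewrite scale1r mul1r. Qed.

Lemma bformDr u v w : F w (u + v) = F w u + F w v.
Proof. by have := bF.2 1 u v w; rewrite scale1r mul1r. Qed.

Lemma bform0l w : F 0 w = 0.
Proof. by apply: (addIr (F 0 w)); rewrite -bformDl !add0r. Qed.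

Lemma bform0r w : F w 0 = 0.
Proof. by apply: (addIr (F w 0)); rewrite -bformDr !add0r. Qed.

Lemma bformZl a u w : F (a *: u) w = a * F u w.
Proof. by have := bF.1 a u 0 w; rewrite !(addr0, bform0l). Qed.

Lemma bformZr a u w : F w (a *: u) = a * F w u.
Proof. by have := bF.2 a u 0 w; rewrite !(addr0, bform0r). Qed.

Lemma bformNl u w : F (- u) w = - F u w.
Proof. by rewrite -scaleN1r bformZl mulN1r. Qed.

Lemma bformNr u w : F w (- u) = - F w u.
Proof. by rewrite -scaleN1r bformZr mulN1r. Qed.

Lemma bformBl u v w : F (u - v) w = F u w - F v w.
Proof. by rewrite bformDl bformNl. Qed.

Lemma bformBr u v w : F w (u - v) = F w u - F w v.
Proof. by rewrite bformDr bformNr. Qed.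

Lemma bform_suml (I : Type) (s : seq I) (P : pred I) (c : I -> V) w :
  F (\sum_(i <- s | P i) c i) w = \sum_(i <- s | P i) F (c i) w.
Proof.
by apply: (big_morph (F^~ w)) => [u v|]; [exact: bformDl|exact: bform0l].
Qed.

Lemma bform_sumr (I : Type) (s : seq I) (P : pred I) (c : I -> V) w :
  F w (\sum_(i <- s | P i) c i) = \sum_(i <- s | P i) F w (c i).
Proof.
by apply: (big_morph (F w)) => [u v|]; [exact: bformDr|exact: bform0r].
Qed.

End bilinear.

Lemma semi_inner_CS F u v : semi_inner F -> F u v ^+ 2 <= F u u * F v v.
Proof.
move=> [bF sF pF].
have q t : 0 <= t ^+ 2 * F u u + 2 * t * F u v + F v v.
  have := pF (t *: u + v).
  by rewrite !(bformDl bF, bformDr bF, bformZl bF, bformZr bF) (sF v u); lra.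
have [u0|u0] := eqVneq (F u u) 0.
  rewrite u0 mul0r; have [->|uv0] := eqVneq (F u v) 0; first by rewrite expr0n.
  (* at this point the polynomial [q] would take the value [- 1] *)
  have := q (- (F v v + 1) / (2 * F u v)).
  rewrite u0 mulr0 add0r.
  have -> : 2 * (- (F v v + 1) / (2 * F u v)) * F u v = - (F v v + 1) by field.
  by lra.
have u1 : 0 < F u u by rewrite lt_def u0 pF.
(* the minimum of the quadratic polynomial [q] *)
have := q (- F u v / F u u).
have -> : (- F u v / F u u) ^+ 2 * F u u + 2 * (- F u v / F u u) * F u v + F v v
  = (F u u * F v v - F u v ^+ 2) / F u u by field.
by rewrite pmulr_lge0 ?invr_gt0// subr_ge0.
Qed.

Lemma semi_inner_null F u v : semi_inner F -> F u u = 0 -> F u v = 0.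
Proof.
move=> hF u0; have := semi_inner_CS u v hF.
rewrite u0 mul0r => h; apply/eqP; rewrite -sqrf_eq0 eq_le h.
exact: sqr_ge0.
Qed.

(* The commutator takes values outside the completed space, so only the numbers
   [c v w = b (C v) w] and [q v = b (C v) (C v)] are given; [CS_c] is then the
   Cauchy-Schwarz inequality for [C v - z] and [w]. *)
Section yang.
Variables (b E c : V -> V -> R) (q : V -> R) (X : V -> V).
Variables (I : finType) (u : I -> V) (lam : I -> R) (Lam : R).
Hypotheses (hb : semi_inner b) (hE : semi_inner E) (hc : bilinear_form c).
Hypothesis orthonormal_u : forall i j, b (u i) (u j) = (i == j)%:R.
Hypothesis eigen_u : forall i w, E (u i) w = lam i * b (u i) w.
Hypothesis gap : forall w, (forall i, b w (u i) = 0) -> Lam * b w w <= E w w.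
Hypothesis lam_le : forall i, lam i <= Lam.
Hypothesis symX : forall v w, b (X v) w = b v (X w).
Hypothesis commX : forall v w, E (X v) w = E v (X w) - c v w.
Hypothesis CS_c : forall v w z,
  (c v w - b z w) ^+ 2 <= (q v - 2 * c v z + b z z) * b w w.

Let a i l := b (X (u i)) (u l).
Let W i := X (u i) - \sum_l a i l *: u l.
Let g i l := c (u i) (u l).
Let p i := - c (u i) (W i).

Let bb : bilinear_form b. Proof. by case: hb. Qed.
Let bE : bilinear_form E. Proof. by case: hE. Qed.
Let bS v w : b v w = b w v. Proof. by case: hb. Qed.
Let ES v w : E v w = E w v. Proof. by case: hE. Qed.

Let aS i l : a i l = a l i. Proof. by rewrite /a symX bS. Qed.

Let sum_delta (z : I -> R) i : \sum_l z l * (l == i)%:R = z i.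
Proof.
rewrite (bigD1 i)//= eqxx mulr1 big1 ?addr0// => l /negPf ->.
by rewrite mulr0.
Qed.

Let bsum (z : I -> R) i : b (\sum_l z l *: u l) (u i) = z i.
Proof.
rewrite (bform_suml bb) -[RHS]sum_delta; apply: eq_bigr => l _.
by rewrite (bformZl bb) orthonormal_u.
Qed.

Let W_orth i l : b (W i) (u l) = 0.
Proof. by rewrite (bformBl bb) bsum subrr. Qed.

Let g_a i l : g i l = (lam i - lam l) * a i l.
Proof.
have := commX (u i) (u l).
rewrite ES !eigen_u -!symX -/(a l i) -/(a i l) (aS l i) -/(g i l) => h.
have -> : g i l = lam i * a i l - (lam i * a i l - g i l) by ring.
by rewrite -h; ring.
Qed.

(** Since [W i] is orthogonal to the [u l], the energy of the trial vector
    exceeds [lam i] times its square norm by a commutator term only. *)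
Let E_W i : E (W i) (W i) = lam i * b (W i) (W i) + p i.
Proof.
have E1 : E (\sum_l a i l *: u l) (W i) = 0.
  rewrite (bform_suml bE) big1// => l _.
  by rewrite (bformZl bE) eigen_u bS W_orth !mulr0.
have b1 : b (\sum_l a i l *: u l) (W i) = 0.
  rewrite (bform_suml bb) big1// => l _.
  by rewrite (bformZl bb) bS W_orth mulr0.
have -> : E (W i) (W i) = E (X (u i)) (W i).
  by rewrite {1}/W (bformBl bE) E1 subr0.
have -> : b (W i) (W i) = b (X (u i)) (W i).
  by rewrite {1}/W (bformBl bb) b1 subr0.
by rewrite commX eigen_u symX.
Qed.

Let p_E i : p i = - c (u i) (X (u i)) + \sum_l (lam i - lam l) * a i l ^+ 2.
Proof.
rewrite /p /W (bformBr hc) opprB addrC (bform_sumr hc); congr (_ + _).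
by apply: eq_bigr => l _; rewrite (bformZr hc) -/(g i l) g_a; ring.
Qed.

(** Cauchy-Schwarz is applied to the part of the commutator orthogonal to the
    eigenvectors: subtracting [\sum_l g i l *: u l] costs nothing, because the
    trial vector [W i] is orthogonal to each [u l]. *)
Let p_CS i : p i ^+ 2 <= (q (u i) - \sum_l g i l ^+ 2) * b (W i) (W i).
Proof.
have := CS_c (u i) (W i) (\sum_l g i l *: u l).
have -> : b (\sum_l g i l *: u l) (W i) = 0.
  rewrite (bform_suml bb) big1// => l _.
  by rewrite (bformZl bb) bS W_orth mulr0.
have -> : c (u i) (\sum_l g i l *: u l) = \sum_l g i l ^+ 2.
  by rewrite (bform_sumr hc); apply: eq_bigr => l _; rewrite (bformZr hc).
have -> : b (\sum_l g i l *: u l) (\sum_l g i l *: u l) = \sum_l g i l ^+ 2.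
  rewrite (bform_sumr bb); apply: eq_bigr => l _.
  by rewrite (bformZr bb) bsum.
rewrite subr0 /p sqrrN => h; apply: (le_trans h); lra.
Qed.

Let p_le i : (Lam - lam i) * p i <= q (u i) - \sum_l g i l ^+ 2.
Proof.
have [_ _ pos] := hb.
have gapi : (Lam - lam i) * b (W i) (W i) <= p i.
  by have := gap (W_orth i); rewrite E_W; lra.
have L0 : 0 <= Lam - lam i by rewrite subr_ge0.
have p0 : 0 <= p i by apply: le_trans gapi; rewrite mulr_ge0.
have Q0 : 0 <= q (u i) - \sum_l g i l ^+ 2.
  have := CS_c (u i) (u i) (\sum_l g i l *: u l).
  have -> : c (u i) (\sum_l g i l *: u l) = \sum_l g i l ^+ 2.
    by rewrite (bform_sumr hc); apply: eq_bigr => l _; rewrite (bformZr hc).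
  have -> : b (\sum_l g i l *: u l) (\sum_l g i l *: u l) = \sum_l g i l ^+ 2.
    rewrite (bform_sumr bb); apply: eq_bigr => l _.
    by rewrite (bformZr bb) bsum.
  rewrite orthonormal_u eqxx mulr1 => /(le_trans (sqr_ge0 _)).
  by lra.
have [p1|/negbTE p1] := eqVneq (p i) 0; first by rewrite p1 mulr0.
have {p1} p1 : 0 < p i by rewrite lt_def p1 p0.
rewrite -(ler_pM2r p1) -mulrA -expr2.
apply: (le_trans (ler_wpM2l L0 (p_CS i))).
by rewrite mulrCA ler_wpM2l.
Qed.

(** The trial vectors [W i] bound each term up to quantities in the numbers
    [a i l]; these cancel in the sum over [i] because [a] is symmetric. *)
Lemma yang_commutator_bound :
  \sum_i (Lam - lam i) ^+ 2 * - c (u i) (X (u i)) <=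
  \sum_i (Lam - lam i) * q (u i).
Proof.
pose G i := \sum_l (lam i - lam l) * a i l ^+ 2.
pose K i := \sum_l (lam i - lam l) ^+ 2 * a i l ^+ 2.
have step i : (Lam - lam i) ^+ 2 * - c (u i) (X (u i)) <=
    (Lam - lam i) * q (u i) - ((Lam - lam i) ^+ 2 * G i + (Lam - lam i) * K i).
  have L0 : 0 <= Lam - lam i by rewrite subr_ge0.
  have := ler_wpM2l L0 (p_le i).
  have -> : \sum_l g i l ^+ 2 = K i.
    by apply: eq_bigr => l _; rewrite g_a exprMn.
  by rewrite p_E -/(G i); lra.
(* the terms of the double sum are antisymmetric in [i] and [l] *)
have cancel : \sum_i ((Lam - lam i) ^+ 2 * G i + (Lam - lam i) * K i) = 0.
  pose T i l := ((Lam - lam i) ^+ 2 * (lam i - lam l) +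
                 (Lam - lam i) * (lam i - lam l) ^+ 2) * a i l ^+ 2.
  have -> : \sum_i ((Lam - lam i) ^+ 2 * G i + (Lam - lam i) * K i) =
            \sum_i \sum_l T i l.
    apply: eq_bigr => i _; rewrite !mulr_sumr -big_split/=.
    by apply: eq_bigr => l _; rewrite /T; ring.
  have T0 : \sum_i \sum_l T i l = - \sum_i \sum_l T i l.
    rewrite {1}exchange_big/= -sumrN; apply: eq_bigr => i _.
    rewrite -sumrN; apply: eq_bigr => l _.
    by rewrite /T (aS l i); ring.
  by lra.
apply: (le_trans (ler_sum _ (fun i _ => step i))).
by rewrite sumrB cancel subr0.
Qed.

End yang.

Section seminorm.
Variable s : V -> V -> R.
Hypothesis hs : semi_inner s.

Definition nrm u := Num.sqrt (s u u).

Lemma nrm_ge0 u : 0 <= nrm u. Proof. exact: sqrtr_ge0. Qed.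

Lemma nrm_sqr u : nrm u ^+ 2 = s u u.
Proof. by rewrite sqr_sqrtr//; case: hs. Qed.

Lemma nrm_CS u v : `|s u v| <= nrm u * nrm v.
Proof.
rewrite -[leLHS]sqrtr_sqr /nrm -sqrtrM; last by case: hs.
by apply: ler_wsqrtr; exact: semi_inner_CS.
Qed.

Lemma nrm0 : nrm 0 = 0.
Proof. by rewrite /nrm bform0l ?sqrtr0//; case: hs. Qed.

Lemma nrmZ a u : nrm (a *: u) = `|a| * nrm u.
Proof.
have [bs _ _] := hs.
rewrite /nrm (bformZl bs) (bformZr bs) mulrA -expr2 sqrtrM ?sqr_ge0//.
by rewrite sqrtr_sqr.
Qed.

Lemma nrmN u : nrm (- u) = nrm u.
Proof. by rewrite -scaleN1r nrmZ normrN1 mul1r. Qed.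

Lemma nrm_distC u v : nrm (u - v) = nrm (v - u).
Proof. by rewrite -nrmN opprB. Qed.

Lemma nrmD u v : nrm (u + v) <= nrm u + nrm v.
Proof.
have [bs ss _] := hs.
have h0 : 0 <= nrm u + nrm v by rewrite addr_ge0 ?nrm_ge0.
rewrite -ler_sqr ?nnegrE ?nrm_ge0// nrm_sqr sqrrD !nrm_sqr.
rewrite !(bformDl bs, bformDr bs) (ss v u).
have := nrm_CS u v; have := ler_norm (s u v); lra.
Qed.

Lemma nrm_dist_trans v u w : nrm (u - w) <= nrm (u - v) + nrm (v - w).
Proof. by apply: le_trans (nrmD _ _); rewrite addrA subrK. Qed.

Definition bounded_form F := bilinear_form F /\
  exists2 K, 0 <= K & forall u v, `|F u v| <= K * nrm u * nrm v.

Lemma bounded_form_cvg F (x y : V^nat) u v : bounded_form F ->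
  nrm (x m - u) @[m --> \oo] --> 0 -> nrm (y m - v) @[m --> \oo] --> 0 ->
  F (x m) (y m) @[m --> \oo] --> F u v.
Proof.
move=> [bF [K K0 hK]] xu yv; apply/subr_cvg0; apply/norm_cvg0P.
pose g m := K * nrm (x m - u) * (nrm (y m - v) + nrm v) +
            K * nrm u * nrm (y m - v).
have g0 : g @ \oo --> 0.
  rewrite -[0](_ : K * 0 * (0 + nrm v) + K * nrm u * 0 = 0); last by ring.
  by apply: cvgD; apply: cvgM => //; [apply: cvgM|apply: cvgD|] => //;
    exact: cvg_cst.
apply: (squeeze_cvgr _ (cvg_cst 0) g0); apply: nearW => m.
rewrite normr_ge0/=.
have -> : F (x m) (y m) - F u v =
  F (x m - u) (y m - v) + F (x m - u) v + F u (y m - v).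
  by rewrite !(bformBl bF, bformBr bF); ring.
rewrite /g mulrDr.
apply: (le_trans (ler_normD _ _)); apply: lerD; last exact: hK.
by apply: (le_trans (ler_normD _ _)); apply: lerD; exact: hK.
Qed.

Definition cauchy_nrm (x : V^nat) := forall e : R, 0 < e ->
  exists M, forall m l, (M <= m)%N -> (M <= l)%N -> nrm (x m - x l) < e.

Lemma cauchy_nrm_bounded (x : V^nat) : cauchy_nrm x ->
  exists2 B, 0 <= B & forall m, nrm (x m) <= B.
Proof.
move=> /(_ 1 ltr01)[M hM].
exists (\sum_(i < M.+1) nrm (x i) + 1).
  by rewrite addr_ge0// sumr_ge0// => i _; exact: nrm_ge0.
move=> m; have [mM|Mm] := ltnP m M.+1.
  rewrite (bigD1 (Ordinal mM))//= -addrA lerDl addr_ge0// sumr_ge0// => i _.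
  exact: nrm_ge0.
have := hM m M (ltnW Mm) (leqnn _).
rewrite big_ord_recr/= => h1.
have := nrmD (x m - x M) (x M); rewrite subrK => h2.
have : 0 <= \sum_(i < M) nrm (x i) by rewrite sumr_ge0// => i _; exact: nrm_ge0.
lra.
Qed.

Lemma cvgn_cauchy (x : R^nat) :
  (forall e : R, 0 < e -> exists M, forall m l, (M <= m)%N -> (M <= l)%N ->
     `|x m - x l| < e) -> cvgn x.
Proof.
move=> h; apply/cauchy_cvgP/cauchyP => e e0.
have [M hM] := h e e0.
exists (x M), M => // m /= Mm.
by rewrite -ball_normE/=; exact: hM.
Qed.

Lemma bounded_form_cauchy F (x y : V^nat) : bounded_form F ->
  cauchy_nrm x -> cauchy_nrm y -> cvgn (fun m => F (x m) (y m)).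
Proof.
move=> [bF [K K0 hK]] cx cy; apply: cvgn_cauchy => e e0.
have [A A0 hA] := cauchy_nrm_bounded cx.
have [B B0 hB] := cauchy_nrm_bounded cy.
pose d := e / (K * (A + B) + 1).
have KAB : 0 <= K * (A + B) by rewrite mulr_ge0// addr_ge0.
have d0 : 0 < d by rewrite divr_gt0// ltr_wpDl.
have [M hM] := cx d d0; have [M' hM'] := cy d d0.
exists (maxn M M') => m l; rewrite !geq_max => /andP[m1 m2] /andP[l1 l2].
have -> : F (x m) (y m) - F (x l) (y l) =
  F (x m - x l) (y m) + F (x l) (y m - y l).
  by rewrite !(bformBl bF, bformBr bF); ring.
apply: (le_lt_trans (ler_normD _ _)).
apply: (@le_lt_trans _ _ (K * (A + B) * d)).
  rewrite mulrDr mulrDl addrC; apply: lerD; apply: (le_trans (hK _ _)).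
    by apply: ler_pM; rewrite ?mulr_ge0 ?nrm_ge0//; [apply: ler_wpM2l|exact/ltW/hM'].
  rewrite mulrAC; apply: ler_pM; rewrite ?mulr_ge0 ?nrm_ge0//; [by apply: ler_wpM2l|exact/ltW/hM].
rewrite /d mulrCA gtr_pMr// ltr_pdivrMr; last by rewrite ltr_wpDl.
by rewrite mul1r ltrDl.
Qed.

End seminorm.

Lemma nrm_le (F s : V -> V -> R) u : F u u <= s u u -> nrm F u <= nrm s u.
Proof. exact: ler_wsqrtr. Qed.

Lemma semi_inner_bounded F (s : V -> V -> R) K : semi_inner F -> semi_inner s ->
  0 <= K -> (forall u, F u u <= K * s u u) -> bounded_form s F.
Proof.
move=> hF hs K0 h; split; first by case: hF.
have le u : nrm F u <= Num.sqrt K * nrm s u.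
  by rewrite /nrm -sqrtrM//; exact: ler_wsqrtr.
exists K => // u v; apply: (le_trans (nrm_CS hF u v)).
apply: (le_trans (ler_pM _ _ (le u) (le v))); rewrite ?nrm_ge0//.
by rewrite mulrACA -expr2 sqr_sqrtr// mulrA.
Qed.

End forms.

(** * Eigenvectors by minimisation of the Rayleigh quotient *)

Lemma increasing_seq_ge (f : nat -> nat) : increasing_seq f ->
  forall m, (m <= f m)%N.
Proof.
move=> /increasing_seqP h; elim=> // m IH.
by apply: leq_ltn_trans IH _; exact: h.
Qed.

Lemma cvgn_subseq {R : realType} (x : R^nat) (f : nat -> nat) (l : R) :
  increasing_seq f -> x @ \oo --> l -> (x \o f) @ \oo --> l.
Proof.
move=> hf /cvgrPdist_lt h; apply/cvgrPdist_lt => e e0.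
have [M _ hM] := h e e0; exists M => // m /= Mm; apply: hM => /=.
by apply: leq_trans Mm _; exact: increasing_seq_ge.
Qed.

Lemma common_subseq {R : realType} F (x : 'I_F -> nat -> R) (K : R) :
  (forall q m, `|x q m| <= K) ->
  exists2 f, increasing_seq f & forall q, cvgn (x q \o f).
Proof.
elim: F x => [|F IH] x hx; first by exists id => // -[].
have [f hf hc] := IH (fun q => x (lift ord0 q)) (fun q => hx _).
have [|g hg gc] := @bolzano_weierstrass R (x ord0 \o f).
  by exists K; split; [exact: num_real|move=> y Ky m _; apply/ltW/(le_lt_trans _ Ky)/hx].
exists (f \o g); first by move=> m l /=; rewrite [LHS]hf; exact: hg.
move=> q; case: (unliftP ord0 q) => [j ->|->]//.
have /cvg_ex[l hl] := hc j; apply/cvg_ex; exists l.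
exact: (cvgn_subseq hg hl).
Qed.

Lemma cvgn_cauchy_le {R : realType} (x : R^nat) : cvgn x -> forall e : R, 0 < e ->
  exists M, forall m l, (M <= m)%N -> (M <= l)%N -> `|x m - x l| < e.
Proof.
move=> /cvg_ex[a /cvgrPdist_lt h] e e0.
have [|M _ hM] := h (e / 2); first by rewrite divr_gt0.
exists M => m l Mm Ml.
have := hM m Mm; have := hM l Ml => /= h1 h2.
have -> : x m - x l = (a - x l) - (a - x m) by ring.
apply: (le_lt_trans (ler_normB _ _)); lra.
Qed.

Lemma limR_unique {R : realType} (x : R^nat) (a c : R) :
  x @ \oo --> a -> x @ \oo --> c -> a = c.
Proof. by move=> xa xc; rewrite -(cvg_lim _ xa)// (cvg_lim _ xc). Qed.

Lemma limR_le {R : realType} (x y : R^nat) (a c : R) M :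
  x @ \oo --> a -> y @ \oo --> c -> (forall m, (M <= m)%N -> x m <= y m) -> a <= c.
Proof. by move=> xa yc h; apply: (ler_cvg_to xa yc); exists M. Qed.

Section spectral.
Context {R : realType} {V : lmodType R}.
Variables b E : V -> V -> R.
Hypotheses (hb : semi_inner b) (hE : semi_inner E).

Definition energy (u v : V) := b u v + E u v.

Let bb : bilinear_form b. Proof. by case: hb. Qed.
Let bE : bilinear_form E. Proof. by case: hE. Qed.
Let bS v w : b v w = b w v. Proof. by case: hb. Qed.
Let ES v w : E v w = E w v. Proof. by case: hE. Qed.
Let bP v : 0 <= b v v. Proof. by case: hb. Qed.
Let EP v : 0 <= E v v. Proof. by case: hE. Qed.

Lemma semi_inner_energy : semi_inner energy.
Proof.
split; first split.
- by move=> a u v w; rewrite /energy bb.1 bE.1; ring.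
- by move=> a u v w; rewrite /energy bb.2 bE.2; ring.
- by move=> u v; rewrite /energy bS ES.
- by move=> u; rewrite addr_ge0.
Qed.

Let hs := semi_inner_energy.

Lemma bounded_form_energy_b : bounded_form energy b.
Proof.
apply: (semi_inner_bounded (K := 1)) => // u.
by rewrite mul1r /energy lerDl.
Qed.

Lemma bounded_form_energy_E : bounded_form energy E.
Proof.
apply: (semi_inner_bounded (K := 1)) => // u.
by rewrite mul1r /energy lerDr.
Qed.

Definition complete_nrm (s : V -> V -> R) := forall x : V^nat,
  cauchy_nrm s x -> exists v, nrm s (x m - v) @[m --> \oo] --> 0.

(** An abstract form of the compactness of the inclusion of the energy space:
    up to a small multiple of the energy, [b] is controlled by finitely many
    continuous functionals. *)
Definition finite_rank_friedrichs := forall e : R, 0 < e ->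
  exists (F : nat) (l : 'I_F -> V -> R) (K : R),
  [/\ forall q a u v, l q (a *: u + v) = a * l q u + l q v,
      forall q u, l q u ^+ 2 <= K * b u u &
      forall u, b u u <= \sum_q l q u ^+ 2 + e * E u u].

Definition is_eigenvector t u := forall v, E u v = t * b u v.

Hypothesis cplt : complete_nrm energy.
Hypothesis fried : finite_rank_friedrichs.

Section minimizer.
Variables (I : Type) (u : I -> V).

Let P w := forall i, b w (u i) = 0.

Let PZD a v w : P v -> P w -> P (a *: v + w).
Proof. by move=> pv pw i; rewrite bb.1 pv pw mulr0 addr0. Qed.

Let PD v w : P v -> P w -> P (v + w).
Proof. by move=> pv pw i; rewrite (bformDl bb) pv pw addr0. Qed.

(** Along a minimising sequence the finitely many functionals of
    [finite_rank_friedrichs] converge for a subsequence.  The parallelogram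
    identity bounds the energy of a difference by [t] times its square norm, up
    to a small error, while the inequality of Friedrichs bounds that square norm
    by [e] times the energy; as [e * t <= 1 / 2] the subsequence is Cauchy. *)
Lemma exists_minimizer w0 : P w0 -> b w0 w0 = 1 ->
  exists w, [/\ P w, b w w = 1, E w w <= E w0 w0 &
                forall v, P v -> E w w * b v v <= E v v].
Proof.
move=> pw0 w01.
pose S := [set x | exists w, [/\ P w, b w w = 1 & E w w = x]].
have lbS : lbound S 0 by move=> x [w [_ _ <-]].
have S0 : S !=set0 by exists (E w0 w0), w0.
have hinf : has_inf S by split => //; exists 0.
have t0 : 0 <= inf S by exact: lb_le_inf.
have tP v : P v -> inf S * b v v <= E v v.
  move=> pv; have [v0|v0] := eqVneq (b v v) 0; first by rewrite v0 mulr0.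
  have v1 : 0 < b v v by rewrite lt_def v0 bP.
  pose a := (Num.sqrt (b v v))^-1.
  have a2 : a ^+ 2 = (b v v)^-1 by rewrite exprVn sqr_sqrtr ?bP.
  have : inf S <= E (a *: v) (a *: v).
    apply: ge_inf; first by exists 0.
    exists (a *: v); split => //.
      by move=> i; rewrite (bformZl bb) pv mulr0.
    by rewrite (bformZl bb) (bformZr bb) mulrA -expr2 a2 mulVf.
  rewrite (bformZl bE) (bformZr bE) mulrA -expr2 a2 mulrC.
  by rewrite ler_pdivlMr.
have [t tE] : exists t, t = inf S by exists (inf S).
move: t0 tP; rewrite -tE => t0 tP.
have /choice[x hx] m : exists w, [/\ P w, b w w = 1 & E w w <= t + m.+1%:R^-1].
  have [|y [w [pw w1 <-] /ltW h]] := @inf_adherent R S m.+1%:R^-1 _ hinf.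
    by rewrite invr_gt0.
  by exists w; split => //; rewrite tE.
have tS : t <= E w0 w0 by rewrite tE; apply: ge_inf; [exists 0|exists w0].
move: S0 hinf tE => _ _ _.
(* this choice of [e] makes [e * t <= 1 / 2] *)
have [|F [l [K [lin lK hF]]]] := fried (e := (2 * (t + 1))^-1).
  by rewrite invr_gt0; lra.
set e := (2 * (t + 1))^-1 in hF.
have et : e * t <= 2^-1.
  by rewrite /e mulrC ler_pdivrMr; lra.
have e0 : 0 <= e by rewrite /e invr_ge0; lra.
have [|f fi fc] := @common_subseq R F (fun q m => l q (x m)) (K + 1).
  move=> q m; have := lK q (x m); have [_ -> _] := hx m; rewrite mulr1 => h.
  have K0 : 0 <= K by apply: le_trans h; exact: sqr_ge0.
  rewrite -ler_sqr ?nnegrE ?normr_ge0//; last by lra.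
  by rewrite real_normK ?num_real//; nra.
pose y m := x (f m).
have hy m : [/\ P (y m), b (y m) (y m) = 1 & E (y m) (y m) <= t + m.+1%:R^-1].
  have [h1 h2 h3] := hx (f m); split => //; apply: (le_trans h3).
  rewrite lerD2l lef_pV2 ?posrE// ler_nat ltnS.
  exact: increasing_seq_ge.
have ED m j : E (y m - y j) (y m - y j) <=
    t * b (y m - y j) (y m - y j) + 2 * (m.+1%:R^-1 + j.+1%:R^-1).
  have [pm bm Em] := hy m; have [pj bj Ej] := hy j.
  have := tP _ (PD pm pj).
  rewrite !(bformBl bE, bformBr bE, bformDl bE, bformDr bE).
  rewrite !(bformBl bb, bformBr bb, bformDl bb, bformDr bb) bm bj.
  rewrite (ES (y j) (y m)) (bS (y j) (y m)).
  move: Em Ej; move: (m.+1%:R^-1) (j.+1%:R^-1) => rm rj; lra.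
have bD m j : b (y m - y j) (y m - y j) <=
    2 * \sum_q l q (y m - y j) ^+ 2 + 4 * e * (m.+1%:R^-1 + j.+1%:R^-1).
  have := hF (y m - y j); have := ler_wpM2l e0 (ED m j).
  have := bP (y m - y j).
  move: (b _ _) (E _ _) (\sum_q _) (m.+1%:R^-1) (j.+1%:R^-1) => B EE SS rm rj.
  by nra.
have lB q v w : l q (v - w) = l q v - l q w.
  by rewrite addrC -scaleN1r lin mulN1r addrC.
have cy : cauchy_nrm energy y.
  move=> d d0.
  pose d1 := d ^+ 2 / (8 * (t + 1 + e)).
  have te : 0 < t + 1 + e by lra.
  have d10 : 0 < d1 by rewrite divr_gt0 ?exprn_gt0//; lra.
  have small : forall q, exists M, forall m j, (M <= m)%N -> (M <= j)%N ->
      l q (y m - y j) ^+ 2 <= d1 / F.+1%:R.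
    move=> q; pose r := d1 / F.+1%:R.
    have r0 : 0 < r by rewrite divr_gt0.
    have sr0 : 0 < Num.sqrt r by rewrite sqrtr_gt0.
    have [M hM] := cvgn_cauchy_le (fc q) sr0.
    exists M => m j Mm Mj; rewrite lB.
    have := ltW (hM m j Mm Mj).
    rewrite -ler_sqr ?nnegrE ?normr_ge0 ?sqrtr_ge0//.
    by rewrite real_normK ?num_real// sqr_sqrtr// ltW.
  have [M hM] := choice small.
  have [M' hM'] : exists M', forall m, (M' <= m)%N -> m.+1%:R^-1 <= d1 / (4 * (e + 1)).
    have dd : 0 < d1 / (4 * (e + 1)) by rewrite divr_gt0//; lra.
    have [M' _ h] := near_infty_natSinv_lt (PosNum dd).
    by exists M' => m hm; apply/ltW/h.
  exists (maxn M' (\max_q M q)) => m j; rewrite !geq_max => /andP[m1 m2] /andP[j1 j2].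
  have B : b (y m - y j) (y m - y j) <= 4 * d1.
    apply: (le_trans (bD m j)).
    have H1 : \sum_q l q (y m - y j) ^+ 2 <= d1.
      apply: (@le_trans _ _ (\sum_(q < F) d1 / F.+1%:R)).
        apply: ler_sum => q _; apply: hM.
          exact: (leq_trans (leq_bigmax q) m2).
        exact: (leq_trans (leq_bigmax q) j2).
      rewrite sumr_const card_ord -[leLHS]mulr_natr -mulrA ler_piMr ?(ltW d10)//.
      by rewrite ler_pdivrMl// mulr1 ler_nat.
    have H2 : m.+1%:R^-1 + j.+1%:R^-1 <= d1 / (2 * (e + 1)).
      apply: (le_trans (lerD (hM' _ m1) (hM' _ j1))).
      rewrite le_eqVlt; apply/orP; left; apply/eqP; field; lra.
    have H3 : 4 * e * (m.+1%:R^-1 + j.+1%:R^-1) <= 2 * d1.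
      apply: (@le_trans _ _ (4 * e * (d1 / (2 * (e + 1))))).
        by apply: ler_wpM2l => //; lra.
      have -> : 4 * e * (d1 / (2 * (e + 1))) = 2 * d1 * (e / (e + 1)) by field; lra.
      by rewrite ler_piMr//; [lra|rewrite ler_pdivrMr; lra].
    apply: le_trans (lerD (ler_wpM2l (ler0n _ 2) H1) H3) _; lra.
  rewrite -ltr_sqr ?nnegrE ?nrm_ge0 ?(ltW d0)// (nrm_sqr hs) /energy.
  have := ED m j.
  have H2 : m.+1%:R^-1 + j.+1%:R^-1 <= d1 / 2.
    apply: (le_trans (lerD (hM' _ m1) (hM' _ j1))).
    have -> : d1 / (4 * (e + 1)) + d1 / (4 * (e + 1)) = d1 / 2 * (e + 1)^-1 by field; lra.
    by rewrite ler_piMr//; [lra|rewrite invf_le1; lra].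
  have d2 : d ^+ 2 = d1 * (8 * (t + 1 + e)) by rewrite /d1 divfK//; lra.
  have tB : t * b (y m - y j) (y m - y j) <= t * (4 * d1) by apply: ler_wpM2l.
  have de : 0 <= d1 * e by rewrite mulr_ge0// ltW.
  have dt : 0 <= d1 * t by rewrite mulr_ge0// ltW.
  move: B H2 tB; move: (b _ _) (E _ _) (m.+1%:R^-1) (j.+1%:R^-1) => BB EE rm rj.
  move=> B H2 tB EB; nra.
have [w yw] := cplt cy.
have bcv : b (y m) (y m) @[m --> \oo] --> b w w.
  exact: (bounded_form_cvg bounded_form_energy_b yw yw).
have Ecv : E (y m) (y m) @[m --> \oo] --> E w w.
  exact: (bounded_form_cvg bounded_form_energy_E yw yw).
have pw : P w.
  move=> i.
  have : b (y m) (u i) @[m --> \oo] --> b w (u i).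
    apply: (bounded_form_cvg bounded_form_energy_b yw).
    by rewrite subrr (nrm0 hs); exact: cvg_cst.
  have -> : (fun m => b (y m) (u i)) = cst 0.
    by apply/funext => m; have [-> //] := hy m.
  move=> h; exact: (limR_unique h (cvg_cst _)).
have w1 : b w w = 1.
  move: bcv; have -> : (fun m => b (y m) (y m)) = cst 1.
    by apply/funext => m; have [_ -> //] := hy m.
  move=> h; exact: (limR_unique h (cvg_cst _)).
have wt : E w w <= t.
  have ht : t + m.+1%:R^-1 @[m --> \oo] --> t.
    rewrite -[X in _ --> X]addr0; apply: cvgD; first exact: cvg_cst.
    exact: cvg_harmonic.
  by apply: (ler_cvg_to Ecv ht); apply: nearW => m; have [] := hy m.
exists w; split => //.
  exact: (le_trans wt).
move=> v pv; apply: le_trans (tP _ pv).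
by apply: ler_wpM2r.
Qed.

(** The first variation of the Rayleigh quotient vanishes at a minimum. *)
Lemma minimizer_eigen w : P w -> b w w = 1 ->
  (forall v, P v -> E w w * b v v <= E v v) ->
  forall v, P v -> E w v = E w w * b w v.
Proof.
move=> pw w1 hmin v pv; set T := E w w.
pose g := E w v - T * b w v; pose d := E v v - T * b v v.
have d0 : 0 <= d by have := hmin v pv; rewrite -/T /d; lra.
have key r : 0 <= r ^+ 2 * d + 2 * r * g.
  have := hmin (r *: v + w) (PZD r pv pw).
  rewrite !(bformDl bb, bformDr bb, bformZl bb, bformZr bb).
  rewrite !(bformDl bE, bformDr bE, bformZl bE, bformZr bE).
  by rewrite (ES v w) (bS v w) w1 -/T /d /g -subr_ge0 => h; apply: le_trans h _; rewrite le_eqVlt; apply/orP; left; apply/eqP; ring.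
(* the minimum of [key], up to the [+ 1] that avoids a case [d = 0] *)
have := key (- g / (d + 1)).
have -> : (- g / (d + 1)) ^+ 2 * d + 2 * (- g / (d + 1)) * g =
          - (g ^+ 2 * ((d + 2) / (d + 1) ^+ 2)) by field; lra.
rewrite oppr_ge0 => h.
have p1 : 0 < (d + 2) / (d + 1) ^+ 2 by rewrite divr_gt0 ?exprn_gt0//; lra.
have : g ^+ 2 = 0.
  by apply/eqP; rewrite eq_le sqr_ge0 andbT -(pmulr_lle0 _ p1).
by move/eqP; rewrite sqrf_eq0 /g subr_eq0 => /eqP.
Qed.

End minimizer.

(** Gram-Schmidt in the form of a dimension count: as long as [p < m], some
    combination of the [m] independent vectors is orthogonal to the [p] vectors
    already found. *)
Lemma orthonormal_eigenfamily t m (e : 'I_m -> V) p :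
  (forall i, is_eigenvector t (e i)) ->
  (forall c : 'I_m -> R,
     b (\sum_i c i *: e i) (\sum_i c i *: e i) = 0 -> forall i, c i = 0) ->
  (p <= m)%N ->
  exists g : nat -> V, (forall i, (i < p)%N -> is_eigenvector t (g i)) /\
    forall i j, (i < p)%N -> (j < p)%N -> b (g i) (g j) = (i == j)%:R.
Proof.
move=> he indep; elim: p => [|p IH] pm; first by exists (fun=> 0).
have [g [g1 g2]] := IH (ltnW pm).
pose A : 'M[R]_(m, p) := \matrix_(i, q) b (e i) (g q).
have /rowV0Pn[c cA c0] : kermx A != 0.
  rewrite -mxrank_eq0 mxrank_ker -lt0n subn_gt0.
  exact: leq_ltn_trans (rank_leq_col _) pm.
move: cA; rewrite sub_kermx => /eqP/rowP cA.
pose w := \sum_i c ord0 i *: e i.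
have we : is_eigenvector t w.
  move=> v; rewrite (bform_suml bE) (bform_suml bb) mulr_sumr.
  by apply: eq_bigr => i _; rewrite (bformZl bE) (bformZl bb) he; ring.
have wg j : (j < p)%N -> b w (g j) = 0.
  move=> jp; have := cA (Ordinal jp); rewrite !mxE => <-.
  rewrite (bform_suml bb); apply: eq_bigr => i _.
  by rewrite (bformZl bb) mxE.
have w0 : b w w != 0.
  apply: contra c0 => /eqP /indep ci; apply/eqP/rowP => i.
  by rewrite ci mxE.
have w1 : 0 < b w w by rewrite lt_def w0 bP.
pose r := (Num.sqrt (b w w))^-1.
exists (fun i => if i == p then r *: w else g i); split.
  move=> i; rewrite ltnS leq_eqVlt; case: eqP => [_ _ v|_ /= ip]; last exact: g1.
  by rewrite (bformZl bE) (bformZl bb) we; ring.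
move=> i j; rewrite !ltnS (leq_eqVlt i) (leq_eqVlt j).
case: (eqVneq i p) => [->|ip] /=; case: (eqVneq j p) => [->|jp] /=.
- move=> _ _; rewrite ?eqxx (bformZl bb) (bformZr bb) mulrA -expr2.
  by rewrite exprVn sqr_sqrtr ?bP// mulVf.
- by move=> _ jlt; rewrite (bformZl bb) wg// mulr0 1?eq_sym ?(negbTE jp).
- by move=> ilt _; rewrite (bformZr bb) bS wg// mulr0 ?(negbTE ip).
- exact: g2.
Qed.

(** Together with [g], a further orthogonal vector of the eigenspace would give
    [m.+1] independent vectors in a span of [m]. *)
Lemma orthonormal_eigenfamily_total t m (e : 'I_m -> V) (g : nat -> V) w :
  (forall z, is_eigenvector t z -> exists c : 'I_m -> R,
     forall v, b z v = \sum_i c i * b (e i) v) ->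
  (forall i, (i < m)%N -> is_eigenvector t (g i)) ->
  (forall i j, (i < m)%N -> (j < m)%N -> b (g i) (g j) = (i == j)%:R) ->
  is_eigenvector t w -> (forall i, (i < m)%N -> b w (g i) = 0) -> b w w = 0.
Proof.
move=> span g1 g2 we wg; apply/eqP; apply: contraT => w0.
pose h (q : 'I_m.+1) := if q == m :> nat then w else g q.
have hee q : is_eigenvector t (h q).
  rewrite /h; case: eqP => // /eqP qm; apply: g1.
  by rewrite ltn_neqAle qm -ltnS ltn_ord.
have [C hC] := choice (fun q => span _ (hee q)).
pose A : 'M[R]_(m.+1, m) := \matrix_(q, i) C q i.
have /rowV0Pn[d dA d0] : kermx A != 0.
  rewrite -mxrank_eq0 mxrank_ker -lt0n subn_gt0 ltnS.
  exact: rank_leq_col.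
move: dA; rewrite sub_kermx => /eqP/rowP dA.
have zero v : \sum_q d ord0 q * b (h q) v = 0.
  transitivity (\sum_(i < m) (\sum_q d ord0 q * C q i) * b (e i) v).
    under eq_bigr do rewrite hC mulr_sumr.
    rewrite exchange_big/=; apply: eq_bigr => i _; rewrite mulr_suml.
    by apply: eq_bigr => q _; rewrite mulrA.
  apply: big1 => i _; have := dA i; rewrite !mxE => H.
  rewrite (_ : \sum_q _ = 0) ?mul0r// -[RHS]H; apply: eq_bigr => q _.
  by rewrite mxE.
have horth q l : q != l -> b (h q) (h l) = 0.
  move=> ql; have {}ql : q != l :> nat by [].
  have lt (x : 'I_m.+1) : x != m :> nat -> (x < m)%N.
    by move=> xm; rewrite ltn_neqAle xm -ltnS ltn_ord.
  rewrite /h; case: eqP => [qm|/eqP/lt qm]; case: eqP => [lm|/eqP/lt lm].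
  - by move: ql; rewrite qm lm eqxx.
  - exact: wg.
  - by rewrite bS; exact: wg.
  - by rewrite g2// (negbTE ql).
have hpos q : b (h q) (h q) != 0.
  rewrite /h; case: (nat_of_ord q =P m) => // /eqP qm.
  have qm' : (q < m)%N by rewrite ltn_neqAle qm -ltnS ltn_ord.
  by rewrite g2// eqxx oner_neq0.
case/eqP: d0; apply/rowP => q; rewrite mxE.
have := zero (h q); rewrite (bigD1 q)//= big1 ?addr0.
  by move/eqP; rewrite mulf_eq0 (negbTE (hpos q)) orbF => /eqP.
by move=> l lq; rewrite horth ?mulr0.
Qed.

(** Vectors are only distinguished up to the kernel of [b]: independence and
    generation of the eigenspaces are expressed through [b]. *)
Definition enumerates_eigenvalues (lam : nat -> R) := forall t, exists m,
  ([set i | (0 < i)%N /\ lam i = t] #= `I_m)%card /\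
  exists e : 'I_m -> V,
    [/\ forall i, is_eigenvector t (e i),
        forall c : 'I_m -> R,
          b (\sum_i c i *: e i) (\sum_i c i *: e i) = 0 -> forall i, c i = 0 &
        forall z, is_eigenvector t z -> exists c : 'I_m -> R,
          forall v, b z v = \sum_i c i * b (e i) v].

(** The counting bijection numbers an orthonormal basis of the eigenspace of [t]
    by the indices [i] with [lam i = t]; different eigenspaces are orthogonal
    because [E] is symmetric. *)
Lemma orthonormal_eigensystem lam : enumerates_eigenvalues lam ->
  exists u : nat -> V,
  [/\ forall i, (0 < i)%N -> is_eigenvector (lam i) (u i),
      forall i j, (0 < i)%N -> (0 < j)%N -> b (u i) (u j) = (i == j)%:R &
      forall t w, is_eigenvector t w ->
        (forall i, (0 < i)%N -> lam i = t -> b w (u i) = 0) -> b w w = 0].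
Proof.
move=> H.
have /choice[G hG] t : exists Gf : (nat -> V) * (nat -> nat),
  [/\ forall i, (0 < i)%N -> lam i = t -> is_eigenvector t (Gf.1 (Gf.2 i)),
      forall i j, (0 < i)%N -> lam i = t -> (0 < j)%N -> lam j = t ->
        b (Gf.1 (Gf.2 i)) (Gf.1 (Gf.2 j)) = (i == j)%:R &
      forall w, is_eigenvector t w -> (forall i, (0 < i)%N -> lam i = t ->
        b w (Gf.1 (Gf.2 i)) = 0) -> b w w = 0].
  have [m [/card_set_bijP[f [f1 f2 f3]] [e [e1 e2 e3]]]] := H t.
  have [g [g1 g2]] := orthonormal_eigenfamily e1 e2 (leqnn m).
  exists (g, f) => /=; split.
  - by move=> i i0 it; apply: g1; exact: f1.
  - move=> i j i0 it j0 jt; rewrite g2; [|exact: f1|exact: f1].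
    have [->|ij] := eqVneq i j; first by rewrite !eqxx.
    case: eqP => // fij; case/eqP: ij; apply: f2 => //; exact: mem_set.
  - move=> w we wg; apply: (orthonormal_eigenfamily_total e3 g1 g2 we) => i im.
    by have [j [j0 jt] <-] := f3 i im; exact: wg.
exists (fun i => (G (lam i)).1 ((G (lam i)).2 i)); split.
- by move=> i i0; have [h _ _] := hG (lam i); exact: h.
- move=> i j i0 j0; have [h1 h2 h3] := hG (lam i).
  have [ij|ij] := eqVneq (lam j) (lam i); first by rewrite ij; exact: h2.
  have [h1' _ _] := hG (lam j).
  have -> : (i == j) = false.
    by apply: contra_neqF ij => /eqP ->.
  have := h1 i i0 erefl ((G (lam j)).1 ((G (lam j)).2 j)).
  rewrite ES h1'// bS => /eqP; rewrite -subr_eq0 -mulrBl mulf_eq0.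
  by rewrite subr_eq0 (negbTE ij) => /eqP.
- move=> t w we h; have [_ _ h3] := hG t; apply: h3 => // i i0 it.
  by have := h i i0 it; rewrite it.
Qed.

(** If the quotient took a value below [lam k.+1] on the orthogonal complement
    of [u 1, .., u k], its minimum there would be attained at an eigenvector
    orthogonal to the whole eigenspace of an eigenvalue below [lam k.+1]. *)
Lemma eigenvalue_gap lam (u : nat -> V) k :
  (forall i j : nat, (0 < i <= j)%N -> lam i <= lam j) ->
  (forall i, (0 < i)%N -> is_eigenvector (lam i) (u i)) ->
  (forall i j, (0 < i)%N -> (0 < j)%N -> b (u i) (u j) = (i == j)%:R) ->
  (forall t w, is_eigenvector t w ->
     (forall i, (0 < i)%N -> lam i = t -> b w (u i) = 0) -> b w w = 0) ->
  forall w, (forall i : 'I_k, b w (u i.+1) = 0) -> lam k.+1 * b w w <= E w w.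
Proof.
move=> mono u1 u2 u3 w0 w0u; rewrite leNgt; apply/negP => lt0.
have w00 : 0 < b w0 w0.
  rewrite lt_def bP andbT; apply: contraTN lt0 => /eqP ->.
  by rewrite mulr0 -leNgt.
pose r := (Num.sqrt (b w0 w0))^-1.
have r2 : r ^+ 2 = (b w0 w0)^-1 by rewrite exprVn sqr_sqrtr ?bP.
have [||w [wu w1 wle wmin]] := @exists_minimizer _ (fun i : 'I_k => u i.+1) (r *: w0).
- by move=> i; rewrite (bformZl bb) w0u mulr0.
- by rewrite (bformZl bb) (bformZr bb) mulrA -expr2 r2 mulVf// gt_eqF.
have wu' (i : 'I_k) : b w (u i.+1) = 0 by exact: wu.
have tk : E w w < lam k.+1.
  apply: (le_lt_trans wle); rewrite (bformZl bE) (bformZr bE) mulrA -expr2 r2.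
  by rewrite mulrC ltr_pdivrMr.
have we : is_eigenvector (E w w) w.
  move=> v; pose v' := v - \sum_(i < k) b v (u i.+1) *: u i.+1.
  have hv' (i : 'I_k) : b v' (u i.+1) = 0.
    rewrite (bformBl bb) (bform_suml bb) (bigD1 i)//= (bformZl bb) u2// eqxx.
    rewrite big1 ?addr0 ?mulr1 ?subrr// => j ji.
    by rewrite (bformZl bb) u2// eqSS (_ : (j == i :> nat) = false) ?mulr0//; exact/negbTE.
  have := minimizer_eigen wu w1 wmin hv'.
  rewrite (bformBr bE) (bformBr bb) (bform_sumr bE) (bform_sumr bb).
  rewrite !big1 ?subr0// => i _.
    by rewrite (bformZr bb) wu' mulr0.
  by rewrite (bformZr bE) ES u1// (bS (u i.+1)) wu' !mulr0.
have : b w w = 0.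
  apply: (u3 _ _ we) => i i0 it.
  have ik : (i.-1 < k)%N.
    rewrite prednK// leqNgt; apply/negP => ki.
    by move: tk; rewrite -it ltNge mono.
  by have := wu (Ordinal ik); rewrite /= prednK.
by rewrite w1 => /eqP; rewrite oner_eq0.
Qed.

End spectral.

(** * Completion for a seminorm *)

(* The completion consists of the Cauchy sequences themselves, without passing to
   a quotient: a semi-inner product need not be definite, so that sequences at
   distance zero may remain distinct. *)
Section completion.
Context {R : realType} {D : lmodType R} {s : D -> D -> R}.

Section space.
Variable hs : semi_inner s.

Definition cauchy_pred of semi_inner s : {pred nat -> D} :=
  fun x => `[< cauchy_nrm s x >].

Lemma cauchy_nrmD (a : R) (x y : nat -> D) : cauchy_nrm s x -> cauchy_nrm s y ->
  cauchy_nrm s (fun m => a *: x m + y m).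
Proof.
move=> cx cy e e0.
have a0 : 0 < `|a| + 1 by rewrite ltr_wpDl.
have [|M hM] := cx (e / 2 / (`|a| + 1)); first by rewrite !divr_gt0.
have [|M' hM'] := cy (e / 2); first by rewrite divr_gt0.
exists (maxn M M') => m l; rewrite !geq_max => /andP[m1 m2] /andP[l1 l2].
have -> : a *: x m + y m - (a *: x l + y l) = a *: (x m - x l) + (y m - y l).
  by rewrite scalerBr opprD addrACA.
apply: (le_lt_trans (nrmD hs _ _)); rewrite (nrmZ hs).
have h1 := hM m l m1 l1; have h2 := hM' m l m2 l2.
have h3 : `|a| * nrm s (x m - x l) <= e / 2.
  apply: (@le_trans _ _ ((`|a| + 1) * (e / 2 / (`|a| + 1)))).
    by apply: ler_pM; rewrite ?nrm_ge0 ?lerDl// ltW.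
  by rewrite mulrC divfK// gt_eqF.
lra.
Qed.

Lemma cauchy_submod : submod_closed (cauchy_pred hs).
Proof.
split.
  apply/asboolP => e e0; exists 0%N => m l _ _.
  by rewrite subrr (nrm0 hs).
by move=> a x y /asboolP cx /asboolP cy; apply/asboolP; exact: cauchy_nrmD.
Qed.

HB.instance Definition _ :=
  GRing.isSubmodClosed.Build R (nat -> D) (cauchy_pred hs) cauchy_submod.

Record completion := Completion {
  approximant : nat -> D;
  approximantP : approximant \in cauchy_pred hs }.

HB.instance Definition _ := [isSub for approximant].
HB.instance Definition _ := [Choice of completion by <:].
HB.instance Definition _ := [SubChoice_isSubLmodule of completion by <:].

Implicit Types x y z : completion.

Lemma approximant_cauchy x : cauchy_nrm s (approximant x).
Proof. exact/asboolP/approximantP. Qed.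

Definition mk_completion (f : nat -> D) (h : cauchy_nrm s f) : completion :=
  Completion (introT (asboolP _) h).

Lemma approximantD x y m : approximant (x + y) m = approximant x m + approximant y m.
Proof. by []. Qed.

Lemma approximantZ a x m : approximant (a *: x) m = a *: approximant x m.
Proof. by []. Qed.

Lemma approximantB x y m : approximant (x - y) m = approximant x m - approximant y m.
Proof. by []. Qed.

Lemma cauchy_cst v : cauchy_nrm s (fun=> v).
Proof. by move=> e e0; exists 0%N => m l _ _; rewrite subrr (nrm0 hs). Qed.

Definition emb v := mk_completion (cauchy_cst v).

Definition ext (F : D -> D -> R) x y : R :=
  lim ((fun m => F (approximant x m) (approximant y m)) @ \oo).

Section ext.
Variable F : D -> D -> R.
Hypothesis bF : bounded_form s F.

Lemma ext_cvg x y : F (approximant x m) (approximant y m) @[m --> \oo] --> ext F x y.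
Proof.
exact: (bounded_form_cauchy hs bF (approximant_cauchy x) (approximant_cauchy y)).
Qed.

Lemma extE x y (l : R) : F (approximant x m) (approximant y m) @[m --> \oo] --> l -> ext F x y = l.
Proof. by move=> h; apply: (limR_unique _ h); exact: ext_cvg. Qed.

Lemma ext_bilinear : bilinear_form (ext F).
Proof.
have [[b1 b2] _] := bF; split=> a x y z; apply: extE.
  under eq_fun do rewrite approximantD approximantZ b1.
  by apply: cvgD; [apply: cvgM; [exact: cvg_cst|]|]; exact: ext_cvg.
under eq_fun do rewrite approximantD approximantZ b2.
by apply: cvgD; [apply: cvgM; [exact: cvg_cst|]|]; exact: ext_cvg.
Qed.

Lemma ext_emb v w : ext F (emb v) (emb w) = F v w.
Proof. by apply: extE => /=; apply: cvg_cst. Qed.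

End ext.

Lemma ext_semi_inner F : bounded_form s F -> semi_inner F -> semi_inner (ext F).
Proof.
move=> bF [_ h1 h2]; split; first exact: ext_bilinear.
- by move=> x y; apply: extE => //; under eq_fun do rewrite h1; exact: ext_cvg.
- by move=> x; apply: (limR_le (cvg_cst _) (ext_cvg (x := x) (y := x) bF) (M := 0%N)).
Qed.

Lemma bounded_form_self : bounded_form s s.
Proof. by apply: (semi_inner_bounded (K := 1)) => // u; rewrite mul1r. Qed.

Let es := ext_semi_inner bounded_form_self hs.

Lemma nrm_ext_cvg x : nrm s (approximant x m) @[m --> \oo] --> nrm (ext s) x.
Proof.
have /(cvg_comp _ _) := ext_cvg (x := x) (y := x) bounded_form_self; apply.
exact: sqrt_continuous.
Qed.

Lemma emb_dense x : nrm (ext s) (emb (approximant x m) - x) @[m --> \oo] --> 0.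
Proof.
apply/cvgrPdist_le => e e0.
have [M hM] := approximant_cauchy x e0.
exists M => // m /= Mm; rewrite sub0r normrN ger0_norm ?nrm_ge0//.
apply: (limR_le (@nrm_ext_cvg _) (cvg_cst _) (M := M)) => l Ml.
by rewrite approximantB; exact/ltW/hM.
Qed.

Lemma nrm_emb v : nrm (ext s) (emb v) = nrm s v.
Proof. by rewrite /nrm ext_emb//; exact: bounded_form_self. Qed.

Lemma embB v w : emb (v - w) = emb v - emb w.
Proof. exact/val_inj. Qed.

(** Diagonal argument: the [i]-th vector of a Cauchy sequence is replaced by a
    vector of the original space at distance at most [1 / i.+1]. *)
Lemma completion_complete : complete_nrm (ext s).
Proof.
move=> x cx.
have /choice[p hp] i : exists m, nrm (ext s) (emb (approximant (x i) m) - x i) <= i.+1%:R^-1.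
  have /cvgrPdist_le/(_ i.+1%:R^-1) := emb_dense (x i).
  rewrite invr_gt0 ltr0Sn => /(_ isT)[M _ /(_ M (leqnn M))] /=.
  by rewrite sub0r normrN ger0_norm ?nrm_ge0// => h; exists M.
pose y i := approximant (x i) (p i).
have cy : cauchy_nrm s y.
  move=> e e0.
  have [|M hM] := cx (e / 3); first by rewrite divr_gt0.
  have e3 : 0 < e / 3 by rewrite divr_gt0.
  have [M' _ hM'] := near_infty_natSinv_lt (PosNum e3).
  exists (maxn M M') => m l; rewrite !geq_max => /andP[m1 m2] /andP[l1 l2].
  rewrite -nrm_emb embB.
  have h1 := nrm_dist_trans es (x m) (emb (y m)) (emb (y l)).
  have h2 := nrm_dist_trans es (x l) (x m) (emb (y l)).
  have h3 := hM m l m1 l1.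
  have h4 := hp m; have h5 := hp l.
  have h6 := hM' m m2; have h7 := hM' l l2.
  rewrite (nrm_distC es (x l)) in h2.
  move: h4 h5 h6 h7; rewrite /= => h4 h5 h6 h7.
  have h8 := le_lt_trans h4 h6; have h9 := le_lt_trans h5 h7.
  rewrite -/(y m) -/(y l) in h8 h9.
  have h10 := le_lt_trans h2 (ltrD h3 h9).
  apply: (le_lt_trans h1); apply: (lt_le_trans (ltrD h8 h10)).
  by rewrite le_eqVlt; apply/orP; left; apply/eqP; field.
exists (mk_completion cy).
have c0 : i.+1%:R^-1 + nrm (ext s) (emb (y i) - mk_completion cy) @[i --> \oo] --> (0 : R).
  rewrite -[X in _ --> X]addr0; apply: cvgD; first exact: cvg_harmonic.
  exact: (@emb_dense (mk_completion cy)).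
apply: (squeeze_cvgr _ (cvg_cst 0) c0); apply: nearW => i.
rewrite nrm_ge0/=; apply: (le_trans (nrm_dist_trans es (emb (y i)) _ _)).
by rewrite lerD2r (nrm_distC es); exact: hp.
Qed.

End space.
End completion.

(** * The commutator inequality in the completion *)

Section lift.
Context {R : realType} {D : lmodType R} {s : D -> D -> R}.
Variable hs : semi_inner s.
Implicit Types x y : completion hs.

Definition linear_op (X : D -> D) :=
  forall (a : R) (u v : D), X (a *: u + v) = a *: X u + X v.

Definition bounded_op (X : D -> D) :=
  linear_op X /\ exists2 K, 0 <= K & forall u, nrm s (X u) <= K * nrm s u.

Lemma bounded_op_cauchy X (f : nat -> D) :
  bounded_op X -> cauchy_nrm s f -> cauchy_nrm s (X \o f).
Proof.
move=> [lX [K K0 hK]] cf e e0.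
have K1 : 0 < K + 1 by lra.
have [|M hM] := cf (e / (K + 1)); first by rewrite divr_gt0.
exists M => m l mM lM /=.
have -> : X (f m) - X (f l) = X (f m - f l).
  by rewrite addrC -scaleN1r -lX scaleN1r addrC.
apply: (le_lt_trans (hK _)).
have := hM m l mM lM; rewrite ltr_pdivlMr//.
have := nrm_ge0 s (f m - f l); nra.
Qed.

Definition lift_op X (hX : bounded_op X) x : completion hs :=
  mk_completion hs (bounded_op_cauchy hX (approximant_cauchy x)).

Lemma ext_lim F x y : bounded_form s F -> forall G : R^nat,
  (forall m, F (approximant x m) (approximant y m) = G m) -> G @ \oo --> ext (hs := hs) F x y.
Proof.
move=> bF G h; have := @ext_cvg _ _ _ hs F bF x y.
by rewrite (_ : (fun m => F _ _) = G)//; apply/funext.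
Qed.

End lift.

Lemma limR_sum {R : realType} (I : Type) (r : seq I) (x : I -> R^nat) (a : I -> R) :
  (forall i, x i @ \oo --> a i) ->
  (fun m => \sum_(i <- r) x i m) @ \oo --> \sum_(i <- r) a i.
Proof.
move=> h; elim: r => [|i r IH].
  rewrite big_nil; under eq_fun do rewrite big_nil; exact: cvg_cst.
rewrite big_cons; under eq_fun do rewrite big_cons.
by apply: cvgD => //; exact: h.
Qed.

Section transfer.
Context {R : realType} {D : lmodType R} {b E : D -> D -> R}.
Hypotheses (hb : semi_inner b) (hE : semi_inner E).

Let hs := semi_inner_energy hb hE.
Let bb := bounded_form_energy_b hb hE.
Let bE := bounded_form_energy_E hb hE.
Local Notation H := (completion hs).
Local Notation b' := (ext (hs := hs) b).
Local Notation E' := (ext (hs := hs) E).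
Implicit Types x y : H.

Lemma ext_b_semi_inner : semi_inner b'.
Proof. exact: ext_semi_inner. Qed.

Lemma ext_E_semi_inner : semi_inner E'.
Proof. exact: ext_semi_inner. Qed.

Lemma ext_energy : energy b' E' = ext (hs := hs) (energy b E).
Proof.
apply/funext => x; apply/funext => y; rewrite /energy; apply/esym/extE.
  exact: bounded_form_self.
by apply: cvgD; apply: ext_lim.
Qed.

Lemma ext_complete : complete_nrm (energy b' E').
Proof. by rewrite ext_energy; exact: completion_complete. Qed.

(** The functionals are continuous for [b], hence extend to the completion, and
    the inequality passes to the limit. *)
Lemma ext_friedrichs : finite_rank_friedrichs b E -> finite_rank_friedrichs b' E'.
Proof.
move=> fr e e0; have [F [l [K [lin lK hF]]]] := fr e e0.
have K0 : 0 <= `|K| by [].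
have lcv q x : cvgn (fun m => l q (approximant x m)).
  apply: cvgn_cauchy => d d0.
  have K1 : 0 < `|K| + 1 by rewrite ltr_wpDl.
  have [|M hM] := @approximant_cauchy _ _ _ hs x (d / (`|K| + 1)); first by rewrite divr_gt0.
  exists M => m j Mm Mj.
  have -> : l q (approximant x m) - l q (approximant x j) =
            l q (approximant x m - approximant x j).
    by rewrite [in RHS]addrC -scaleN1r lin mulN1r addrC.
  set v := approximant x m - approximant x j.
  have := hM m j Mm Mj; rewrite -/v ltr_pdivlMr// => h.
  rewrite -ltr_sqr ?nnegrE ?(ltW d0)// real_normK ?num_real//.
  apply: le_lt_trans (lK q v) _.
  apply: (@le_lt_trans _ _ ((nrm (energy b E) v * (`|K| + 1)) ^+ 2)).
    rewrite exprMn (nrm_sqr hs) /energy.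
    have [_ _ /(_ v) bv] := hb; have [_ _ /(_ v) Ev] := hE.
    have := ler_norm K => hK.
    apply: (@le_trans _ _ (`|K| * b v v)); first exact: ler_wpM2r.
    rewrite mulrC; apply: ler_pM => //; first by rewrite lerDl.
    nra.
  by rewrite ltr_sqr ?nnegrE ?mulr_ge0 ?nrm_ge0 ?(ltW d0)// ltW.
exists F, (fun q x => lim ((fun m => l q (approximant x m)) @ \oo)), K; split.
- move=> q a x y; apply/cvg_lim => //.
  rewrite (_ : (fun m => _) = (fun m => a * l q (approximant x m) + l q (approximant y m))).
    by apply: cvgD; [apply: cvgM; [exact: cvg_cst|]|]; exact: lcv.
  by apply/funext => m; rewrite -lin.
- move=> q x; apply: (@limR_le _ _ _ _ _ 0%N).
  + by rewrite expr2; apply: cvgM; exact: lcv.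
  + by apply: cvgM; [exact: cvg_cst|exact: (ext_lim (x := x) (y := x) bb)].
  + by move=> m _; exact: lK.
- move=> x; apply: (@limR_le _ _ _ _ _ 0%N).
  + exact: (ext_lim (x := x) (y := x) bb).
  + apply: cvgD.
      by apply: limR_sum => q; rewrite expr2; apply: cvgM; exact: lcv.
    by apply: cvgM; [exact: cvg_cst|exact: (ext_lim (x := x) (y := x) bE)].
  + by move=> m _; exact: hF.
Qed.

Section yang_transfer.
Variables (J : finType) (X C : J -> D -> D) (K al be ga : R) (lam : nat -> R) (k : nat).
Hypothesis K0 : 0 <= K.
Hypothesis fr : finite_rank_friedrichs b E.
Hypothesis linX : forall j, linear_op (X j).
Hypothesis linC : forall j, linear_op (C j).
Hypothesis symX : forall j v w, b (X j v) w = b v (X j w).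
Hypothesis commX : forall j v w, E (X j v) w = E v (X j w) - b (C j v) w.
Hypothesis bndX : forall j v, energy b E (X j v) (X j v) <= K * energy b E v v.
Hypothesis bndC : forall j v, b (C j v) (C j v) <= K * energy b E v v.
Hypothesis sumC : forall v,
  \sum_j b (C j v) (C j v) <= al * (4 * E v v - be * b v v).
Hypothesis lowX : forall j v, ga * b v v <= - b (C j v) (X j v).
Hypothesis mono : forall i j : nat, (0 < i <= j)%N -> lam i <= lam j.
Hypothesis enum : enumerates_eigenvalues b' E' lam.

Let c j u w := b (C j u) w.
Let q j u w := b (C j u) (C j w).

Let bfb : bilinear_form b. Proof. by case: hb. Qed.

Let nrmC j v : nrm b (C j v) <= Num.sqrt K * nrm (energy b E) v.
Proof. by rewrite /nrm -sqrtrM//; exact: ler_wsqrtr. Qed.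

Let nrmb v : nrm b v <= nrm (energy b E) v.
Proof. by apply: nrm_le; rewrite /energy lerDl; case: hE. Qed.

Let bc j : bounded_form (energy b E) (c j).
Proof.
split; first by split=> a u v w; rewrite /c ?linC ?bfb.1 ?bfb.2.
exists (Num.sqrt K) => [|u w]; first exact: sqrtr_ge0.
apply: (le_trans (nrm_CS hb _ _)).
by apply: ler_pM; rewrite ?nrm_ge0 ?nrmC ?nrmb.
Qed.

Let bq j : bounded_form (energy b E) (q j).
Proof.
split; first by split=> a u v w; rewrite /q !linC ?bfb.1 ?bfb.2.
exists K => // u w.
apply: (le_trans (nrm_CS hb _ _)).
rewrite -[K]sqr_sqrtr// expr2 -mulrA mulrACA.
by apply: ler_pM; rewrite ?nrm_ge0 ?nrmC.
Qed.

Let opX j : bounded_op (s := energy b E) (X j).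
Proof.
split => //; exists (Num.sqrt K) => [|u]; first exact: sqrtr_ge0.
by rewrite /nrm -sqrtrM//; exact: ler_wsqrtr.
Qed.

(** The operators [X j] extend to the completion, but the commutators [C j] need
    not, since they are only bounded from the energy norm to the norm of [b]:
    the forms [b (C j v) w] and [b (C j v) (C j w)] are extended instead. *)
Lemma yang_inequality :
  \sum_(1 <= i < k.+1) (lam k.+1 - lam i) ^+ 2 * (#|J|%:R * ga) <=
  \sum_(1 <= i < k.+1) (lam k.+1 - lam i) * (al * (4 * lam i - be)).
Proof.
have [u [u1 u2 u3]] := orthonormal_eigensystem ext_b_semi_inner ext_E_semi_inner enum.
have gap := eigenvalue_gap ext_b_semi_inner ext_E_semi_inner ext_complete
  (ext_friedrichs fr) mono u1 u2 u3 (k := k).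
rewrite !big_add1 /= !big_mkord.
set L := lam k.+1.
have Lge (i : 'I_k) : lam i.+1 <= L.
  by apply: mono => /=; rewrite !ltnS ltnW.
have step j : \sum_(i < k) (L - lam i.+1) ^+ 2 * ga <=
  \sum_(i < k) (L - lam i.+1) * ext (hs := hs) (q j) (u i.+1) (u i.+1).
  have := @yang_commutator_bound R H b' E' (ext (hs := hs) (c j))
    (fun v => ext (hs := hs) (q j) v v) (lift_op (opX j)) 'I_k
    (fun i => u i.+1) (fun i => lam i.+1) L ext_b_semi_inner ext_E_semi_inner.
  move=> Y; apply: le_trans (Y _ _ _ _ _ _ _ _).
  - apply: ler_sum => i _; apply: ler_wpM2l; first exact: sqr_ge0.
    have -> : ga = ga * b' (u i.+1) (u i.+1) by rewrite u2// eqxx mulr1.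
    apply: (@limR_le _ _ _ _ _ 0%N).
    + by apply: cvgM; [exact: cvg_cst|exact: (ext_lim (x := u i.+1) (y := u i.+1) bb)].
    + by apply: cvgN; exact: (ext_lim (x := u i.+1) (y := lift_op (opX j) (u i.+1)) (bc j)).
    + by move=> m _; exact: lowX.
  - by apply: ext_bilinear; exact: bc.
  - by move=> i l; rewrite u2.
  - by move=> i w; rewrite u1.
  - exact: gap.
  - exact: Lge.
  - move=> v w; apply: extE => //.
    rewrite (_ : (fun m => _) = (fun m => b (approximant v m) (X j (approximant w m)))).
      exact: (ext_lim (x := v) (y := lift_op (opX j) w) bb).
    by apply/funext => m; exact: symX.
  - move=> v w; apply: extE => //.
    rewrite (_ : (fun m => _) = (fun m => E (approximant v m) (X j (approximant w m))
       - c j (approximant v m) (approximant w m))).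
      apply: cvgB; first exact: (ext_lim (x := v) (y := lift_op (opX j) w) bE).
      exact: (ext_lim (x := v) (y := w) (bc j)).
    by apply/funext => m; exact: commX.
  - move=> v w z; apply: (@limR_le _ _ _ _ _ 0%N).
    + rewrite expr2; apply: cvgM; apply: cvgB;
        [exact: (ext_lim (x := v) (y := w) (bc j))|
         exact: (ext_lim (x := z) (y := w) bb)|
         exact: (ext_lim (x := v) (y := w) (bc j))|
         exact: (ext_lim (x := z) (y := w) bb)].
    + apply: cvgM; last exact: (ext_lim (x := w) (y := w) bb).
      apply: cvgD; last exact: (ext_lim (x := z) (y := z) bb).
      apply: cvgB; first exact: (ext_lim (x := v) (y := v) (bq j)).
      by apply: cvgM; [exact: cvg_cst|exact: (ext_lim (x := v) (y := z) (bc j))].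
    + move=> m _ /=.
      have := semi_inner_CS (C j (approximant v m) - approximant z m) (approximant w m) hb.
      rewrite !(bformBl bfb, bformBr bfb) /c /q expr2 => h; apply: (le_trans h).
      rewrite le_eqVlt; apply/orP; left; apply/eqP.
      have [_ bS _] := hb; rewrite (bS (approximant z m) (C j _)).
      set A := C j _; set Z := approximant z m; set W := approximant w m.
      by transitivity ((b A A - 2 * b A Z + b Z Z) * b W W); first ring.
have sumq (i : 'I_k) : \sum_j ext (hs := hs) (q j) (u i.+1) (u i.+1) <=
    al * (4 * lam i.+1 - be).
  have -> : al * (4 * lam i.+1 - be) =
      al * (4 * E' (u i.+1) (u i.+1) - be * b' (u i.+1) (u i.+1)).
    by rewrite u1// u2// eqxx !mulr1.
  apply: (@limR_le _ _ _ _ _ 0%N).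
  + by apply: limR_sum => j; exact: (ext_lim (x := u i.+1) (y := u i.+1) (bq j)).
  + apply: cvgM; first exact: cvg_cst.
    apply: cvgB; (apply: cvgM; first exact: cvg_cst).
      exact: (ext_lim (x := u i.+1) (y := u i.+1) bE).
    exact: (ext_lim (x := u i.+1) (y := u i.+1) bb).
  + by move=> m _; exact: sumC.
apply: (@le_trans _ _ (\sum_j \sum_(i < k) (L - lam i.+1) ^+ 2 * ga)).
  rewrite exchange_big/=; apply: ler_sum => i _.
  by rewrite sumr_const -[leRHS]mulr_natl mulrCA.
apply: (le_trans (ler_sum _ (fun j _ => step j))).
rewrite exchange_big/=; apply: ler_sum => i _.
by rewrite -mulr_sumr; apply: ler_wpM2l; rewrite ?subr_ge0.
Qed.

End yang_transfer.
End transfer.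

(** * Lebesgue measure on row vectors *)

Section measure_rV.
Context {R : realType} {n : nat}.
Local Notation T := 'rV[R]_n.
Local Notation mu := (lebesgue_rV (R := R) n).
Implicit Types (A : set T) (v a : T).

Lemma measurable_box (B : 'I_n -> set (measurableTypeR R)) :
  (forall i, measurable (B i)) ->
  measurable [set v : T | forall i, B i (v ord0 i)].
Proof.
move=> mB; rewrite (_ : [set _ | _] = \bigcap_(i in [set: 'I_n])
    ((fun v : T => v ord0 i : measurableTypeR R) @^-1` B i)).
  apply: fin_bigcap_measurable => //= i _.
  by rewrite -[X in measurable X]setTI; exact: measurable_coord.
by apply/seteqP; split => v /= h i; [move=> _|]; exact: h.
Qed.

(** An open set is the union of the countably many cubes with rational centre and
    side [2 / k.+1] that it contains, and cubes are measurable by definition of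
    the product sigma-algebra. *)
Lemma open_measurable_rV A : open A -> measurable A.
Proof.
move=> oA.
pose cube (p : 'rV[rat]_n * nat) : set T :=
  [set v | forall i, ball (ratr (p.1 ord0 i) : R) p.2.+1%:R^-1 (v ord0 i)].
have -> : A = \bigcup_p (if `[< cube p `<=` A >] then cube p else set0).
  apply/seteqP; split => [v Av|v [p _]]; last first.
    by case: asboolP => // h; exact: h.
  move: oA; rewrite openE => /(_ _ Av)/nbhs_ballP[e /= e0 he].
  have [k _ hk] := near_infty_natSinv_lt (PosNum (divr_gt0 e0 (ltr0Sn R 1))).
  have {}hk := hk k (leqnn k).
  have k0 : 0 < k.+1%:R^-1 :> R by rewrite invr_gt0.
  have /choice[q hq] (i : 'I_n) : exists q : rat, ball (ratr q : R) k.+1%:R^-1 (v ord0 i).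
    have [|q] := @rat_in_itvoo R (v ord0 i - k.+1%:R^-1) (v ord0 i + k.+1%:R^-1).
      by rewrite ltrD2l; rewrite gtrN.
    rewrite in_itv/= => /andP[h1 h2]; exists q; rewrite /ball/= ltr_norml.
    by move: h1 h2; move: (k.+1%:R^-1) => r h1 h2; apply/andP; split; lra.
  exists (\row_i q i, k) => //.
  case: asboolP => [_ i /=|]; first by rewrite mxE; exact: hq.
  case; move=> w hw; apply: he; split => // i j.
  rewrite (ord1 i) /ball/=; have := hq j; have := hw j; rewrite /= mxE /ball/=.
  move=> h1 h2; move: hk => /= hk.
  have -> : v ord0 j - w ord0 j = (ratr (q j) - w ord0 j) - (ratr (q j) - v ord0 j) by ring.
  apply: (le_lt_trans (ler_normB _ _)).
  by move: hk h1 h2; move: (k.+1%:R^-1) => r; lra.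
apply: countable_bigcupT_measurable => [|p]; first exact: countableP.
case: asboolP => // _; apply: (@measurable_box (fun i => ball (ratr (p.1 ord0 i) : R) p.2.+1%:R^-1)) => i.
by rewrite ball_itv; exact: measurable_itv.
Qed.

Lemma continuous_measurable_rV (f : T -> R) : continuous f ->
  measurable_fun setT (f : T -> measurableTypeR R).
Proof.
move=> /continuousP cf; apply: (measurability _ (RGenOpens.measurableE R)).
move=> _ [_ [a [b ->] <-]]; rewrite setTI; apply: open_measurable_rV.
exact/cf/interval_open.
Qed.

Lemma measurable_translate a : measurable_fun [set: T] (fun v : T => v + a).
Proof.
apply: measurable_fun_coordP => i.
rewrite (_ : (fun t => _) = (fun v : T => (v ord0 i : R) + a ord0 i)).
  apply: measurable_funD; [exact: measurable_coord|exact: measurable_cst].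
by apply/funext => v; rewrite mxE.
Qed.

End measure_rV.

Lemma preimage_translate_itvoc {R : realType} (c a b : R) :
  (fun x => x + c) @^-1` `]a, b]%classic = `](a - c), (b - c)]%classic.
Proof.
by apply/seteqP; split=> x /=; rewrite !in_itv/= ltrBlDr lerBrDr.
Qed.

Lemma lebesgue_measure_translate {R : realType} (c : R) (A : set (measurableTypeR R)) :
  measurable A ->
  pushforward lebesgue_measure (fun x : measurableTypeR R => x + c : measurableTypeR R) A
  = lebesgue_measure A.
Proof.
have mf : measurable_fun setT (fun x : measurableTypeR R => x + c : measurableTypeR R).
  by apply: measurable_funD.
pose phi : {mfun measurableTypeR R >-> measurableTypeR R} :=
  HB.pack (fun x : measurableTypeR R => x + c : measurableTypeR R)
    (isMeasurableFun.Build _ _ _ _ _ mf).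
move=> mA.
have := @lebesgue_measure_unique R (pushforward lebesgue_measure phi).
move=> h; apply/esym/h => // _ [[a b]] _ <-.
rewrite /=.
have -> : pushforward lebesgue_measure phi `]a, b]%classic =
    lebesgue_measure (`](a - c), (b - c)]%classic : set (measurableTypeR R)).
  by congr (lebesgue_measure _); exact: preimage_translate_itvoc.
rewrite /= !lebesgue_measure_itv/= !lte_fin ltrD2r; case: ifP => // _.
by rewrite -!EFinB opprB addrA subrK.
Qed.

Section translate_rV.
Context {R : realType}.
Local Notation mu n := (lebesgue_rV (R := R) n).

(** By induction on the dimension: a translation acts separately on the two
    factors of the product measure, and product measures are determined by their
    values on rectangles. *)
Lemma lebesgue_rV_translate n (a : 'rV[R]_n) (A : set 'rV[R]_n) :
  measurable A -> mu n ((fun v => v + a) @^-1` A) = mu n A.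
Proof.
elim: n a A => [|n IHn] a A mA.
  congr (mu 0 _); apply/seteqP; split=> v /=.
    by have -> : v + a = v by apply/rowP => -[].
  by have -> : v + a = v by apply/rowP => -[].
pose a' : 'rV[R]_n := \row_i a ord0 (lift ord0 i).
pose psi (p : measurableTypeR R * 'rV[R]_n) : measurableTypeR R * 'rV[R]_n :=
  ((p.1 : R) + a ord0 ord0, p.2 + a').
have mpsi : measurable_fun setT psi.
  apply/measurable_fun_pairP; split.
    apply: measurable_funD; [exact: measurable_fst|exact: measurable_cst].
  apply: (measurableT_comp (measurable_translate a')); exact: measurable_snd.
have psiE p : rV_cons p + a = rV_cons (psi p).
  apply/rowP => i; rewrite mxE; case: (unliftP ord0 i) => [j ->|->].
    by rewrite !rV_consS !mxE.
  by rewrite !rV_cons0.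
pose phi : {mfun (measurableTypeR R * 'rV[R]_n)%type >-> (measurableTypeR R * 'rV[R]_n)%type} :=
  HB.pack psi (isMeasurableFun.Build _ _ _ _ _ mpsi).
pose m' := pushforward (lebesgue_measure \x mu n)%E psi.
have m'E (X : set (measurableTypeR R * 'rV[R]_n)) : measurable X ->
    (lebesgue_measure \x mu n)%E X = m' X.
  move=> mX; have := @product_measure_unique _ _ _ _ R lebesgue_measure (mu n)
    (pushforward (lebesgue_measure \x mu n)%E phi).
  apply => // B C mB mC.
  rewrite /= /pushforward/=.
  rewrite (_ : psi @^-1` _ =
    ((fun x : measurableTypeR R => (x : R) + a ord0 ord0 : measurableTypeR R) @^-1` B)
    `*` ((fun v => v + a') @^-1` C)); last by apply/seteqP; split=> -[].
  rewrite product_measure1E; last 2 first.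
  - rewrite -[X in measurable X]setTI.
    have mt : measurable_fun setT (fun x : measurableTypeR R => (x : R) + a ord0 ord0 : measurableTypeR R).
      by apply: measurable_funD.
    exact: mt.
  - by rewrite -[X in measurable X]setTI; exact: measurable_translate.
  have h1 := lebesgue_measure_translate (a ord0 ord0) mB.
  have h2 := IHn a' C mC.
  by congr (_ * _)%E; [exact: h1|exact: h2].
rewrite /= /lebesgue_step /pushforward.
transitivity (m' (@rV_cons R n @^-1` A)).
  rewrite /m' /= /pushforward; congr ((_ \x _)%E _).
  by apply/seteqP; split => p /=; rewrite psiE.
by rewrite -m'E// -[X in measurable X]setTI; exact: measurable_rV_cons.
Qed.

Lemma ge0_integral_translate n (a : 'rV[R]_n) (f : 'rV[R]_n -> \bar R) :
  measurable_fun setT f -> (forall v, (0 <= f v)%E) ->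
  (\int[mu n]_v f (v + a)%R = \int[mu n]_v f v)%E.
Proof.
move=> mf f0.
pose phi : {mfun 'rV[R]_n >-> 'rV[R]_n} :=
  HB.pack (fun v : 'rV[R]_n => v + a) (isMeasurableFun.Build _ _ _ _ _ (measurable_translate a)).
have := @ge0_integral_pushforward _ _ _ _ R phi (measurable_translate a) (mu n) setT f
  measurableT mf (fun v _ => f0 v).
rewrite preimage_setT => <-; apply: eq_measure_integral => A mA _.
exact: lebesgue_rV_translate.
Qed.

End translate_rV.

(** * Smooth functions and test functions *)

Section calculus.
Context {R : realType} {n : nat}.
Local Notation T := 'rV[R]_n.+1.
Local Notation e j := (delta_mx ord0 j : T).
Implicit Types (f g : T -> R) (x v : T) (j : 'I_n.+1).

Definition derivable_all f := forall x j, derivable f x (e j).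

Lemma partialD f g x j : derivable f x (e j) -> derivable g x (e j) ->
  partial j (fun y => f y + g y) x = partial j f x + partial j g x.
Proof. by move=> df dg; exact: (deriveD df dg). Qed.

Lemma partialZ f (a : R) x j : derivable f x (e j) ->
  partial j (fun y => a * f y) x = a * partial j f x.
Proof. by move=> df; exact: (deriveZ a df). Qed.

Lemma partial_lin (a : R) f g x j : derivable f x (e j) -> derivable g x (e j) ->
  partial j (fun y => a * f y + g y) x = a * partial j f x + partial j g x.
Proof.
move=> df dg; have da := derivableM (derivable_cst a x (e j)) df.
by rewrite (partialD da dg); congr (_ + _); exact: partialZ.
Qed.

Lemma partialM f g x j : derivable f x (e j) -> derivable g x (e j) ->
  partial j (fun y => f y * g y) x = f x * partial j g x + g x * partial j f x.
Proof. by move=> df dg; rewrite /partial -[RHS](deriveM df dg). Qed.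

Lemma partialV f x j : f x != 0 -> derivable f x (e j) ->
  partial j (fun y => (f y)^-1) x = - (f x) ^- 2 * partial j f x.
Proof. exact: deriveV. Qed.

Lemma derivable_line f x v t : derivable f (x + t *: v) v ->
  is_derive t 1 (fun s : R => f (x + s *: v)) ('D_v f (x + t *: v)).
Proof.
have E : (fun h : R => h^-1 *: (((fun s : R => f (x + s *: v)) \o shift t) (h *: 1) - f (x + t *: v)))
  = (fun h : R => h^-1 *: ((f \o shift (x + t *: v)) (h *: v) - f (x + t *: v))).
  apply/funext => h /=; congr (_ *: (f _ - _)).
  by rewrite [h *: 1]mulr1 scalerDl addrCA.
by move=> df; split; rewrite /derivable /derive E.
Qed.

(** The mean value theorem along the line through [x] directed by [v]. *)
Lemma line_lipschitz f v M : (forall x, derivable f x v) ->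
  (forall x, `|'D_v f x| <= M) -> forall x (h : R), `|f (x + h *: v) - f x| <= M * `|h|.
Proof.
move=> df hM.
have pos x (h : R) : 0 <= h -> `|f (x + h *: v) - f x| <= M * h.
  move=> h0.
  have D (t : R) : is_derive t 1 (fun s : R => f (x + s *: v)) ('D_v f (x + t *: v)).
    exact: derivable_line.
  have [|c _] := @MVT_segment R (fun s => f (x + s *: v)) (fun t => 'D_v f (x + t *: v)) 0 h h0 (fun t _ => D t).
    apply: continuous_subspaceT => t.
    apply: differentiable_continuous; apply/derivable1_diffP.
    by have [] := D t.
  rewrite scale0r addr0 subr0 => ->; rewrite normrM (ger0_norm h0).
  exact: ler_wpM2r.
move=> x h; have [h0|h0] := leP 0 h; first by rewrite (ger0_norm h0) pos.
rewrite distrC (ltr0_norm h0).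
have := pos (x + h *: v) (- h); rewrite -addrA -scalerDl subrr scale0r addr0.
by apply; lra.
Qed.

Lemma derivable_coord i x v : derivable (fun y : T => y ord0 i) x v.
Proof. by apply: diff_derivable; exact: differentiable_coord. Qed.

Lemma partial_coord i j x : partial j (fun y : T => y ord0 i) x = (i == j)%:R.
Proof.
rewrite /partial /derive.
apply: cvg_lim => //.
apply: (@cvg_trans _ ((fun=> (i == j)%:R : R) @ (0 : R)^')); last exact: cvg_cst.
apply: near_eq_cvg; near=> h.
have h0 : h != 0 by near: h; exact: nbhs_dnbhs_neq.
rewrite /= !mxE eqxx/= addrK; case: (i == j); rewrite ?mulr1 ?mulr0 ?scaler0//.
by rewrite [_ *: _]mulVf.
Unshelve. all: by end_near. Qed.

Lemma continuous_coord i : continuous (fun y : T => y ord0 i).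
Proof. by move=> x; exact: coord_continuous. Qed.

(** A coinduction principle: a class of functions stable under partial
    derivatives, whose members are continuous and have partial derivatives,
    consists of smooth functions. *)
Lemma smooth_coind (S : set (T -> R)) :
  (forall f, S f -> [/\ continuous f, derivable_all f & forall j, S (partial j f)]) ->
  forall f, S f -> smooth f.
Proof.
move=> hS f Sf s.
elim/last_ind: s f Sf => [|s j IH] f Sf /=.
  by have [h1 h2 _] := hS f Sf.
rewrite foldr_rcons; apply: IH.
by have [_ _] := hS f Sf.
Qed.

Lemma smooth_continuous f : smooth f -> continuous f.
Proof. by move=> /(_ [::])[]. Qed.

Lemma smooth_derivable f : smooth f -> derivable_all f.
Proof. by move=> /(_ [::])[]. Qed.

Lemma smooth_partial f j : smooth f -> smooth (partial j f).
Proof. by move=> sf s; have := sf (rcons s j); rewrite foldr_rcons. Qed.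

Lemma partial_cst (a : R) j : partial j (fun _ : T => a) = fun=> 0.
Proof. by apply/funext => x; exact: derive_cst. Qed.

Lemma smooth_cst (a : R) : smooth (fun _ : T => a).
Proof.
apply: (@smooth_coind [set f | exists c, f = fun=> c]); last by exists a.
move=> _ [c ->]; split.
- exact: cst_continuous.
- by move=> x j; exact: derivable_cst.
- by move=> j; exists 0; exact: partial_cst.
Qed.

Lemma smooth_coord i : smooth (fun y : T => y ord0 i).
Proof.
apply: (@smooth_coind [set f | smooth f \/ f = fun y => y ord0 i]); last by right.
move=> f0 [sf|->]; split.
- exact: smooth_continuous.
- exact: smooth_derivable.
- by move=> j; left; exact: smooth_partial.
- exact: continuous_coord.
- by move=> x j; exact: derivable_coord.
- move=> j; left; rewrite (_ : partial j _ = fun=> (i == j)%:R); first exact: smooth_cst.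
  by apply/funext => x; exact: partial_coord.
Qed.

(** Closing the smooth functions under sums and products produces a class stable
    under partial derivatives, to which [smooth_coind] applies. *)
Inductive smooth_algebra : (T -> R) -> Prop :=
| smooth_algebra_base f : smooth f -> smooth_algebra f
| smooth_algebraD f g : smooth_algebra f -> smooth_algebra g ->
    smooth_algebra (fun x => f x + g x)
| smooth_algebraM f g : smooth_algebra f -> smooth_algebra g ->
    smooth_algebra (fun x => f x * g x).

Lemma smooth_algebra_smooth f : smooth_algebra f -> smooth f.
Proof.
move: f; apply: (@smooth_coind smooth_algebra) => f; elim.
- move=> {}f sf; split; [exact: smooth_continuous|exact: smooth_derivable|].
  by move=> j; apply: smooth_algebra_base; exact: smooth_partial.
- move=> {}f g _ [cf df pf] _ [cg dg pg]; split.
  + by move=> x; apply: continuousD; [exact: cf|exact: cg].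
  + by move=> x j; exact: (derivableD (df x j) (dg x j)).
  + move=> j; rewrite (_ : partial j _ = fun x => partial j f x + partial j g x).
      exact: smooth_algebraD.
    by apply/funext => x; rewrite partialD.
- move=> {}f g sf [cf df pf] sg [cg dg pg]; split.
  + by move=> x; apply: continuousM; [exact: cf|exact: cg].
  + by move=> x j; exact: (derivableM (df x j) (dg x j)).
  + move=> j; rewrite (_ : partial j _ =
       fun x => f x * partial j g x + g x * partial j f x).
      by apply: smooth_algebraD; exact: smooth_algebraM.
    by apply/funext => x; rewrite partialM.
Qed.

Lemma smoothD f g : smooth f -> smooth g -> smooth (fun x => f x + g x).
Proof.
by move=> sf sg; apply: smooth_algebra_smooth; apply: smooth_algebraD;
  exact: smooth_algebra_base.
Qed.

Lemma smoothM f g : smooth f -> smooth g -> smooth (fun x => f x * g x).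
Proof.
by move=> sf sg; apply: smooth_algebra_smooth; apply: smooth_algebraM;
  exact: smooth_algebra_base.
Qed.

Lemma smoothZ (a : R) f : smooth f -> smooth (fun x => a * f x).
Proof. exact: smoothM (smooth_cst a). Qed.

Lemma smooth_height : smooth (@height R n).
Proof. exact: smooth_coord. Qed.

Lemma closed_tsupport f : closed (tsupport f).
Proof. exact: closed_closure. Qed.

Lemma tsupport_near0 f x : ~ tsupport f x -> \forall y \near x, f y = 0.
Proof.
move=> nx.
have : open_nbhs x (~` tsupport f).
  by split => //; exact/closed_openC/closed_tsupport.
move=> /open_nbhs_nbhs; apply: filterS => y ny.
by apply: contrapT => /eqP fy; apply: ny; exact: subset_closure.
Qed.

Lemma tsupport0 f x : ~ tsupport f x -> f x = 0.
Proof. by move=> /tsupport_near0 /nbhs_singleton. Qed.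

Lemma partial_near f g x j : (\forall y \near x, f y = g y) ->
  partial j f x = partial j g x.
Proof. exact: near_eq_derive. Qed.

Lemma partial_out f x j : ~ tsupport f x -> partial j f x = 0.
Proof.
move=> /tsupport_near0 h; rewrite (@partial_near f (fun=> 0))//.
by rewrite partial_cst.
Qed.

Lemma tsupport_sub f g : (forall x, f x != 0 -> tsupport g x) ->
  tsupport f `<=` tsupport g.
Proof.
move=> h; rewrite {2}/tsupport; move: (@closed_tsupport g) => /closure_id.
rewrite /tsupport => ->; exact: closure_subset.
Qed.

Lemma tsupport_partial f j : tsupport (partial j f) `<=` tsupport f.
Proof.
apply: tsupport_sub => x; apply: contraPP => /partial_out -> //.
by rewrite eqxx.
Qed.

Lemma tsupportM f g : tsupport (fun x => g x * f x) `<=` tsupport f.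
Proof.
apply: tsupport_sub => x; apply: contraPP => /tsupport0 ->.
by rewrite mulr0 eqxx.
Qed.

Lemma tsupportD f g : tsupport (fun x => f x + g x) `<=` tsupport f `|` tsupport g.
Proof.
rewrite /tsupport -closureU; apply: closure_subset => x /=.
by apply: contraPP => /not_orP[/negP/negPn/eqP -> /negP/negPn/eqP ->]; rewrite addr0 eqxx.
Qed.

(** The inverse of the height is not smooth on the whole space, only its products
    with functions supported in the half space are.  Their partial derivatives
    are again sums of such products, whence a class stable under derivation. *)
Inductive height_algebra : (T -> R) -> Prop :=
| height_algebra_base f : smooth f -> tsupport f `<=` upper_half_space ->
    height_algebra f
| height_algebraD (a : R) f g : height_algebra f -> height_algebra g ->
    height_algebra (fun x => a * f x + g x)
| height_algebraV f : height_algebra f ->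
    height_algebra (fun x => (height x)^-1 * f x).

Lemma height_algebra_supp f : height_algebra f -> tsupport f `<=` upper_half_space.
Proof.
elim=> {f}//.
- move=> a f g _ hf _ hg x /tsupportD[/tsupportM|]; [exact: hf|exact: hg].
- by move=> f _ hf x /tsupportM; exact: hf.
Qed.

Lemma height_algebra_smooth f : height_algebra f -> smooth f.
Proof.
move: f; apply: (@smooth_coind height_algebra) => f; elim.
- move=> {}f sf tf; split; [exact: smooth_continuous|exact: smooth_derivable|].
  move=> j; apply: height_algebra_base; first exact: smooth_partial.
  by move=> x /tsupport_partial; exact: tf.
- move=> a {}f g _ [cf df pf] _ [cg dg pg].
  have daf x j : derivable (fun x => a * f x) x (e j) by exact: (derivableM (derivable_cst a x (e j)) (df x j)).
  split.
  + move=> x; apply: (@continuousD _ _ _ (fun x => a * f x) g); last exact: cg.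
    by apply: (@continuousM _ _ (fun=> a) f); [exact: cst_continuous|exact: cf].
  + by move=> x j; exact: (derivableD (daf x j) (dg x j)).
  + move=> j; rewrite (_ : partial j _ = fun x => a * partial j f x + partial j g x).
      exact: height_algebraD.
    by apply/funext => x; rewrite partialD// partialZ.
- move=> {}f hf [cf df pf].
  have near0 x : ~ 0 < height x -> \forall y \near x, (height y)^-1 * f y = 0.
    move=> hx; have : ~ tsupport f x by move=> /(height_algebra_supp hf).
    move=> /tsupport_near0; apply: filterS => y ->; exact: mulr0.
  have dV x j : 0 < height x -> derivable (fun y : T => (height y)^-1) x (e j).
    by move=> hx; apply: derivableV; [rewrite gt_eqF|exact: derivable_coord].
  have zero_near x : ~ 0 < height x -> \forall y \near x, (fun=> 0) y = (height y)^-1 * f y.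
    by move=> /near0; apply: filterS => y ->.
  split.
  + move=> x; have [hx|/negP nh] := boolP (0 < height x).
      apply: (@continuousM _ _ (fun y => (height y)^-1) f); last exact: cf.
      apply: continuousV; first by rewrite gt_eqF.
      exact: continuous_coord.
    have E0 : (height x)^-1 * f x = 0 by exact: (nbhs_singleton (near0 x nh)).
    rewrite /continuous_at E0.
    apply: (cvg_trans (near_eq_cvg (zero_near x nh))).
    exact: cvg_cst.
  + move=> x j; have [hx|/negP/zero_near hx] := boolP (0 < height x).
      exact: (derivableM (dV x j hx) (df x j)).
    exact: (near_eq_derivable hx (derivable_cst _ _ _)).
  + move=> j; rewrite (_ : partial j _ = fun x =>
      - (ord_max == j)%:R * ((height x)^-1 * ((height x)^-1 * f x)) +
      (height x)^-1 * partial j f x).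
      by apply: height_algebraD; do ?apply: height_algebraV.
    apply/funext => x; have [hx|hx] := boolP (0 < height x).
      have hn : height x != 0 by rewrite gt_eqF.
      rewrite partialM//; last exact: dV.
      rewrite partialV//; last exact: derivable_coord.
      by rewrite partial_coord; field.
    have nx : ~ tsupport f x by move=> /(height_algebra_supp hf); exact/negP.
    rewrite (@partial_near _ (fun=> 0)); last by apply: near0; exact/negP.
    by rewrite partial_cst (tsupport0 nx) (partial_out _ nx) !mulr0 addr0.
Qed.

Section test.
Variable Omega : set T.
Hypothesis Oup : Omega `<=` upper_half_space.

Lemma test_sub f g : smooth f -> tsupport f `<=` tsupport g ->
  test_function Omega g -> test_function Omega f.
Proof.
move=> sf fg [_ cg gO]; split => //; last by move=> x /fg /gO.
exact: subclosed_compact (@closed_tsupport f) cg fg.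
Qed.

Lemma test_partial f j : test_function Omega f -> test_function Omega (partial j f).
Proof.
move=> tf; apply: test_sub (tf); last exact: tsupport_partial.
by apply: smooth_partial; case: tf.
Qed.

Lemma testM g f : smooth g -> test_function Omega f ->
  test_function Omega (fun x => g x * f x).
Proof.
move=> sg tf; apply: test_sub (tf); last exact: tsupportM.
by have [sf _ _] := tf; exact: (smoothM sg sf).
Qed.

Lemma testZ (a : R) f : test_function Omega f ->
  test_function Omega (fun x => a * f x).
Proof. exact/testM/smooth_cst. Qed.

Lemma testD f g : test_function Omega f -> test_function Omega g ->
  test_function Omega (fun x => f x + g x).
Proof.
move=> [sf cf fO] [sg cg gO]; split; first exact: smoothD.
- apply: subclosed_compact (@closed_tsupport _) (compactU cf cg) _.
  exact: tsupportD.
- by move=> x /tsupportD[/fO|/gO].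
Qed.

Lemma test0 : test_function Omega (fun=> 0).
Proof.
have E : tsupport (fun _ : T => 0 : R) = set0.
  rewrite /tsupport (_ : [set _ | _] = set0) ?closure0//.
  by apply/seteqP; split => x //=; rewrite eqxx.
split; [exact: smooth_cst|rewrite E; exact: compact0|by rewrite E].
Qed.

Lemma testV f : test_function Omega f ->
  test_function Omega (fun x => (height x)^-1 * f x).
Proof.
move=> tf; apply: test_sub (tf); last exact: tsupportM.
apply: height_algebra_smooth; apply: height_algebraV.
by case: tf => sf _ fO; apply: height_algebra_base => // x /fO/Oup.
Qed.

Lemma testVn m f : test_function Omega f ->
  test_function Omega (fun x => height x ^- m * f x).
Proof.
elim: m f => [|m IH] f tf.
  by rewrite (_ : (fun _ => _) = f)//; apply/funext => x; rewrite expr0 invr1 mul1r.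
rewrite (_ : (fun _ => _) = fun x => height x ^- m * ((height x)^-1 * f x)).
  by apply: IH; exact: testV.
by apply/funext => x; rewrite exprSr invfM mulrA [_^-1 * _^-1]mulrC.
Qed.

Lemma test_sum (I : Type) (r : seq I) (F : I -> T -> R) :
  (forall i, test_function Omega (F i)) ->
  test_function Omega (fun x => \sum_(i <- r) F i x).
Proof.
move=> sF; elim: r => [|i r IH].
  rewrite (_ : (fun _ => _) = fun=> 0); first exact: test0.
  by apply/funext => x; rewrite big_nil.
rewrite (_ : (fun _ => _) = fun x => F i x + \sum_(i <- r) F i x).
  exact: testD.
by apply/funext => x; rewrite big_cons.
Qed.

End test.
End calculus.

(** * Integrals of functions with bounded support *)

Section integrals.
Context {R : realType} {n : nat}.
Local Notation T := 'rV[R]_n.+1.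
Local Notation mu := (lebesgue_rV (R := R) n.+1).
Local Notation e j := (delta_mx ord0 j : T).
Implicit Types (f g : T -> R) (x v a : T) (j : 'I_n.+1).

Definition box (B : R) : set T := [set x | forall i, `|x ord0 i| <= B].

Lemma boxE B : box B = [set x : T | forall i, `[- B, B]%classic (x ord0 i)].
Proof.
by apply/seteqP; split => x h i; have := h i; rewrite /= in_itv/= ler_norml.
Qed.

Lemma measurable_box_cube B : measurable (box B).
Proof.
rewrite boxE; apply: (@measurable_box _ _ (fun=> `[- B, B]%classic)) => i.
exact: measurable_itv.
Qed.

Lemma box_measure B : 0 <= B -> mu (box B) = ((B *+ 2) ^+ n.+1)%:E.
Proof.
move=> B0; rewrite boxE (lebesgue_rV_box (A := fun=> `[- B, B]%classic))//.
under eq_bigr do rewrite lebesgue_measure_itv/= lte_fin.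
have -> : (if - B < B then (B%:E - (- B)%:E)%E else 0%E) = (B *+ 2)%:E.
  case: ltP => h; first by rewrite -EFinB opprK mulr2n.
  have -> : B = 0 by lra.
  by rewrite mul0rn.
by rewrite prodEFin prodr_const card_ord.
Qed.

Lemma box_fin B : (mu (box B) < +oo)%E.
Proof.
have [B0|B0] := leP 0 B; first by rewrite box_measure// ltry.
rewrite (_ : box B = set0) ?measure0 ?ltry//.
apply/seteqP; split => x //= /(_ ord0) h.
by have := normr_ge0 (x ord0 ord0); lra.
Qed.

Lemma compact_box (K : set T) : compact K -> exists2 B, 0 < B & K `<=` box B.
Proof.
move=> /compact_bounded [M [_ /(_ (`|M| + 1))]].
rewrite (le_lt_trans (ler_norm M)) ?ltrDl// => /(_ isT) h.
exists (`|M| + 1); first by rewrite ltr_wpDl.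
move=> x /h/= hx i; apply: le_trans hx.
have /mapP[j Hj ->] : `|x ord0 i| \in [seq `|x k.1 k.2| | k : 'I_1 * 'I_n.+1].
  by apply/mapP; exists (ord0, i) => //=; rewrite mem_enum.
by rewrite [leRHS]/Num.norm /= mx_normrE; apply/bigmax_geP; right => /=; exists j.
Qed.

Definition supported_in f B := forall x, f x != 0 -> box B x.

Lemma csupp_bounded f : continuous f -> compact (tsupport f) ->
  exists2 M, 0 <= M & forall x, `|f x| <= M.
Proof.
move=> cf cK.
have : compact (f @` tsupport f).
  by apply: continuous_compact => //; exact: continuous_subspaceT.
move=> /compact_bounded [M [_ /(_ (`|M| + 1))]].
rewrite (le_lt_trans (ler_norm M)) ?ltrDl// => /(_ isT) h.
exists (`|M| + 1); first by rewrite addr_ge0.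
move=> x; have [tx|/tsupport0 ->] := pselect (tsupport f x).
  by apply: h; exists x.
by rewrite normr0 addr_ge0.
Qed.

Lemma csupp_box f : compact (tsupport f) -> exists2 B, 0 < B & supported_in f B.
Proof.
move=> /compact_box[B B0 hB]; exists B => // x fx; apply: hB.
exact: subset_closure.
Qed.

Lemma bounded_box_integrable f B M : measurable_fun setT (f : T -> measurableTypeR R) ->
  (forall x, `|f x| <= M) -> supported_in f B -> mu.-integrable setT (EFin \o f).
Proof.
move=> mf fM fB.
have -> : EFin \o f = (EFin \o f) \_ (box B).
  apply/funext => x; rewrite patchE; case: ifPn => // /negP xB /=.
  apply/congr1; apply/eqP; apply: contraT => fx; exfalso; apply: xB.
  by rewrite inE; exact: fB.
apply/(integrable_mkcond _ (measurable_box_cube B)).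
apply: measurable_bounded_integrable => //.
- exact: measurable_box_cube.
- exact: box_fin.
- exact: measurable_funTS.
- exists M; split; first exact: num_real.
  by move=> N MN x _; apply: (le_trans (fM x)); exact: ltW.
Qed.

Lemma csupp_integrable f : continuous f -> compact (tsupport f) ->
  mu.-integrable setT (EFin \o f).
Proof.
move=> cf cK; have [M _ fM] := csupp_bounded cf cK.
have [B _ fB] := csupp_box cK.
by apply: bounded_box_integrable fM fB; exact: continuous_measurable_rV.
Qed.

Lemma integral_translate a f : measurable_fun setT (f : T -> measurableTypeR R) ->
  (\int[mu]_x (f (x + a))%:E = \int[mu]_x (f x)%:E)%E.
Proof.
move=> mf; rewrite integralE [RHS]integralE.
have mE : measurable_fun setT (EFin \o f) by exact/measurable_EFinP.
congr (_ - _)%E.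
  have := ge0_integral_translate a (measurable_funepos mE) (funepos_ge0 _).
  by move=> <-; apply: eq_integral => x _; rewrite !funeposE.
have := ge0_integral_translate a (measurable_funeneg mE) (funeneg_ge0 _).
by move=> <-; apply: eq_integral => x _; rewrite !funenegE.
Qed.

Lemma diff_quotient_cvg f x v : derivable f x v ->
  forall r : R^nat, (forall m, r m != 0) -> r @ \oo --> 0 ->
  (r m)^-1 * (f (x + r m *: v) - f x) @[m --> \oo] --> 'D_v f x.
Proof.
move=> df r r0 rcv.
have h : (r @ \oo) --> (0 : R)^'.
  move=> A; rewrite /dnbhs /within/= => hA.
  change (\forall m \near \oo, A (r m)).
  have : \forall m \near \oo, (r m != 0 -> A (r m)) by exact: (rcv _ hA).
  by apply: filterS => m; apply; exact: r0.
have := cvg_comp r (fun h : R => h^-1 *: ((f \o shift x) (h *: v) - f x)) h df.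
rewrite (_ : _ \o r = (fun m => (r m)^-1 * (f (x + r m *: v) - f x)))//.
by apply/funext => m /=; rewrite [X in f X - _]addrC.
Qed.

End integrals.

(** * Translations and partial derivatives *)

Section estimates.
Context {R : realType} {n : nat}.
Local Notation T := 'rV[R]_n.+1.
Local Notation mu := (lebesgue_rV (R := R) n.+1).
Local Notation e j := (delta_mx ord0 j : T).
Implicit Types (f g : T -> R) (x v a : T) (j : 'I_n.+1).

Lemma EFin_Rint d (S : measurableType d) (m : {measure set S -> \bar R})
    (D : set S) (f : S -> R) : measurable D -> m.-integrable D (EFin \o f) ->
  (\int[m]_(x in D) (f x)%:E = (\int[m]_(x in D) f x)%:E)%E.
Proof. by move=> mD fi; rewrite /Rintegral fineK//; exact: integrable_fin_num. Qed.

Lemma shift_supported f B (h : R) j : `|h| <= 1 -> supported_in f B ->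
  supported_in (fun x => f (x + h *: e j)) (B + 1).
Proof.
move=> h1 fB x /fB hx i; have := hx i; rewrite !mxE eqxx/= => h2.
have -> : x ord0 i = (x ord0 i + h * (i == j)%:R) - h * (i == j)%:R by ring.
apply: (le_trans (ler_normB _ _)); apply: lerD => //.
rewrite normrM; case: (i == j); rewrite ?normr1 ?normr0 ?mulr1 ?mulr0 //.
Qed.

Lemma supported_le f B B' : B <= B' -> supported_in f B -> supported_in f B'.
Proof. by move=> BB fB x /fB hx i; exact: le_trans (hx i) BB. Qed.

Lemma measurable_shift f a : measurable_fun setT (f : T -> measurableTypeR R) ->
  measurable_fun setT (fun x => f (x + a) : measurableTypeR R).
Proof. by move=> mf; exact: (measurableT_comp mf (measurable_translate a)). Qed.

(** Dominated convergence, a multiple of the indicator function of the box being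
    the dominating function. *)
Lemma box_dominated_cvg (F : nat -> T -> R) g B M :
  (forall m, measurable_fun setT (F m : T -> measurableTypeR R)) ->
  (forall x, F m x @[m --> \oo] --> g x) ->
  (forall m x, `|F m x| <= M) -> (forall m, supported_in (F m) B) ->
  (\int[mu]_x (F m x)%:E)%E @[m --> \oo] --> (\int[mu]_x (g x)%:E)%E.
Proof.
move=> mF Fg FM FB.
have M0 : 0 <= M by apply: le_trans (FM 0%N 0).
have mg : measurable_fun setT (fun x : T => M * \1_(box B) x : measurableTypeR R).
  apply: measurable_funM; first exact: measurable_cst.
  by apply: measurable_indic; exact: measurable_box_cube.
have intg : mu.-integrable setT (EFin \o (fun x : T => M * \1_(box B) x)).
  apply: (@bounded_box_integrable _ _ _ B M) => //.
    move=> x; rewrite normrM (ger0_norm M0) indicE.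
    by case: (_ \in _); rewrite ?normr1 ?normr0 ?mulr1 ?mulr0.
  move=> x; rewrite indicE; have [|_] := boolP (x \in box B); first by rewrite inE.
  by rewrite mulr0 eqxx.
apply: (@dominated_cvg _ _ _ mu setT measurableT (fun m => EFin \o F m) (EFin \o g)
  (EFin \o (fun x : T => M * \1_(box B) x))) => //.
- by move=> m; apply/measurable_EFinP; exact: mF.
- by move=> x _; apply: cvg_EFin; [exact: nearW|exact: Fg].
- move=> m x _; rewrite /= lee_fin indicE; have [_|/negP xB] := boolP (x \in box B).
    by rewrite mulr1.
  rewrite mulr0 normr_le0; apply: contraT => hx; exfalso; apply: xB.
  by rewrite inE; exact: (FB m).
Qed.

Lemma lee_lim_cst (u : nat -> \bar R) (a l : \bar R) :
  u @ \oo --> l -> (forall m, (a <= u m)%E) -> (a <= l)%E.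
Proof.
move=> ul h; rewrite -(cvg_lim _ ul)//; apply: lime_ge; first exact: cvgP ul.
exact: nearW.
Qed.

(** Steps [h / 2 ^ m] tending to zero, which are compared with the step [h] by
    iterated halving. *)
Definition half_pow (h : R) (m : nat) : R := h * 2^-1 ^+ m.

Lemma half_pow_cvg h : half_pow h @ \oo --> 0.
Proof.
rewrite -[0](mulr0 h); apply: cvgM; first exact: cvg_cst.
apply: cvg_expr; rewrite ger0_norm ?invr_ge0//; lra.
Qed.

Lemma half_pow_neq0 h m : h != 0 -> half_pow h m != 0.
Proof. by move=> h0; rewrite mulf_neq0// expf_neq0// invr_neq0. Qed.

Lemma half_pow_le1 h m : `|h| <= 1 -> `|half_pow h m| <= 1.
Proof.
move=> h1; rewrite normrM mulr_ile1// normrX ger0_norm ?invr_ge0//.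
by apply: exprn_ile1; [rewrite invr_ge0|lra].
Qed.

Definition dquot f j (h : R) x := h^-1 * (f (x + h *: e j) - f x).

Definition translation_defect f a : \bar R :=
  (\int[mu]_x ((f (x + a) - f x) ^+ 2)%:E)%E.

Section translation_defect.
Variable f : T -> R.
Hypothesis mf : measurable_fun setT (f : T -> measurableTypeR R).
Let D := translation_defect f.

Lemma measurable_defect a :
  measurable_fun setT (fun x => (f (x + a) - f x) ^+ 2 : measurableTypeR R).
Proof.
apply: measurable_funX.
by apply: measurable_funB => //; exact: measurable_shift.
Qed.

Lemma translation_defectD a b : (D (a + b) <= 2%:E * D a + 2%:E * D b)%E.
Proof.
have <- : (\int[mu]_x ((f ((x + a) + b) - f (x + a)) ^+ 2)%:E = D b)%E.
  by have := integral_translate a (measurable_defect b).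
have md : measurable_fun setT (fun x => (f ((x + a) + b) - f (x + a)) ^+ 2 : measurableTypeR R).
  exact: (measurable_shift a (measurable_defect b)).
rewrite -!ge0_integralZl_EFin//; try by move=> x _; rewrite lee_fin sqr_ge0.
- rewrite -ge0_integralD//.
  + apply: ge0_le_integral => //.
    * by move=> x _; rewrite lee_fin sqr_ge0.
    * apply/measurable_EFinP; exact: measurable_defect.
    * apply/measurable_EFinP; apply: measurable_funD;
      (apply: measurable_funM; first exact: measurable_cst) => //; exact: measurable_defect.
    * move=> x _; rewrite -EFinD lee_fin addrA.
      have := sqr_ge0 (f (x + a + b) - f (x + a) - (f (x + a) - f x)).
      nra.
  + by move=> x _; rewrite lee_fin mulr_ge0 ?sqr_ge0.
  + apply/measurable_EFinP; apply: measurable_funM; first exact: measurable_cst.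
    exact: measurable_defect.
  + by move=> x _; rewrite lee_fin mulr_ge0 ?sqr_ge0.
  + by apply/measurable_EFinP; apply: measurable_funM; first exact: measurable_cst.
- by apply/measurable_EFinP.
- by apply/measurable_EFinP; exact: measurable_defect.
Qed.

(** Halving the step multiplies the defect by at least [1 / 4], by the
    translation invariance of the measure. *)
Lemma translation_defect_half h j m :
  (D (h *: e j) <= (4 ^+ m)%:E * D (half_pow h m *: e j))%E.
Proof.
elim: m => [|m IH]; first by rewrite /half_pow !expr0 mulr1 mul1e.
apply: (le_trans IH); rewrite exprSr EFinM -muleA.
apply: lee_wpmul2l; first by rewrite lee_fin exprn_ge0.
have -> : half_pow h m *: e j = half_pow h m.+1 *: e j + half_pow h m.+1 *: e j.
  by rewrite -scalerDl; congr (_ *: _); rewrite /half_pow exprSr; field.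
apply: (le_trans (translation_defectD _ _)).
rewrite -ge0_muleDl ?lee_fin//.
by rewrite (_ : 2%:E + 2%:E = 4%:E)%E// -EFinD; congr EFin; lra.
Qed.

End translation_defect.

Section dquot.
Variables (f : T -> R) (j : 'I_n.+1).
Hypotheses (sf : smooth f) (cf : compact (tsupport f)).

Let contf := smooth_continuous sf.
Let mf := continuous_measurable_rV contf.

Lemma measurable_dquot h : measurable_fun setT (dquot f j h : T -> measurableTypeR R).
Proof.
apply: measurable_funM; first exact: measurable_cst.
by apply: measurable_funB => //; exact: measurable_shift.
Qed.

Let cpf : compact (tsupport (partial j f)).
Proof.
exact: (subclosed_compact (@closed_tsupport _ _ _) cf (@tsupport_partial _ _ f j)).
Qed.

Let cont_pf : continuous (partial j f).
Proof. exact/smooth_continuous/smooth_partial. Qed.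

Lemma dquot_bounded : exists2 M, 0 <= M &
  (forall x, `|partial j f x| <= M) /\ forall h x, h != 0 -> `|dquot f j h x| <= M.
Proof.
have [M M0 hM] := csupp_bounded cont_pf cpf.
exists M => //; split=> // h x h0; rewrite /dquot normrM normfV.
rewrite ler_pdivrMl ?normr_gt0// mulrC.
by apply: line_lipschitz => // y; exact: smooth_derivable.
Qed.

Lemma dquot_supported : exists2 B, 0 < B & supported_in (partial j f) B /\
  forall h, `|h| <= 1 -> supported_in (dquot f j h) B.
Proof.
have [B B0 hB] := compact_box cf.
have fB : supported_in f B by move=> x fx; apply: hB; exact: subset_closure.
exists (B + 1); first by lra.
split.
  apply: (@supported_le _ B); first lra.
  by move=> x px; apply: hB; apply: (@tsupport_partial _ _ f j); exact: subset_closure.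
move=> h h1 x; rewrite /dquot; have [fx|fx] := eqVneq (f x) 0; last first.
  by move=> _; apply: (@supported_le f B) fx => //; lra.
rewrite fx subr0 mulf_eq0 negb_or => /andP[_]; exact: shift_supported.
Qed.

Lemma dquot_cvg h : h != 0 -> forall x,
  dquot f j (half_pow h m) x @[m --> \oo] --> partial j f x.
Proof.
move=> h0 x; apply: diff_quotient_cvg; first exact: smooth_derivable.
  by move=> m; exact: half_pow_neq0.
exact: half_pow_cvg.
Qed.

(** By translation invariance each difference quotient has integral zero, and the
    quotients converge boundedly on a fixed box. *)
Lemma integral_partial0 : \int[mu]_x partial j f x = 0.
Proof.
have [M M0 [pM qM]] := dquot_bounded.
have [B B0 [pB qB]] := dquot_supported.
have h1 : `|1 : R| <= 1 by rewrite normr1.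
have := box_dominated_cvg (fun m => @measurable_dquot (half_pow 1 m))
  (@dquot_cvg 1 (oner_neq0 _)) (fun m x => qM (half_pow 1 m) x (half_pow_neq0 m (oner_neq0 _)))
  (fun m => qB (half_pow 1 m) (half_pow_le1 m h1)).
have E m : (\int[mu]_x (dquot f j (half_pow 1 m) x)%:E = 0)%E.
  have i1 : mu.-integrable setT (EFin \o f) by exact: csupp_integrable.
  have i2 : mu.-integrable setT (EFin \o (fun x => f (x + half_pow 1 m *: e j))).
    have [M' _ fM] := csupp_bounded contf cf.
    have [B' _ fB] := csupp_box cf.
    apply: (@bounded_box_integrable _ _ _ (B' + 1) M') => //.
      exact: measurable_shift.
    by apply: shift_supported => //; apply: half_pow_le1; rewrite normr1.
  have iq : mu.-integrable setT (EFin \o dquot f j (half_pow 1 m)).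
    apply: (@bounded_box_integrable _ _ _ B M); first exact: measurable_dquot.
      by move=> x; apply: qM; exact: half_pow_neq0.
    by apply: qB; exact: half_pow_le1.
  have i3 : mu.-integrable setT (EFin \o (fun x => f (x + half_pow 1 m *: e j) - f x)).
    exact: (integrableB measurableT i2 i1).
  rewrite EFin_Rint// /dquot RintegralZl// RintegralB//.
  by rewrite {1}/Rintegral (integral_translate (half_pow 1 m *: e j) mf) subrr mulr0.
move=> h; have {}h : (fun _ : nat => 0%E) @ \oo --> (\int[mu]_x (partial j f x)%:E)%E.
  rewrite (_ : (fun _ : nat => 0%E) = (fun m => (\int[mu]_x (dquot f j (half_pow 1 m) x)%:E)%E))//.
  by apply/funext => m; rewrite E.
by rewrite /Rintegral -(cvg_lim _ h)// lim_cst.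
Qed.

Let D := translation_defect f.

(** The defect for the step [h] is at most [4 ^ m] times the defect for the step
    [h / 2 ^ m], that is, [h ^+ 2] times the square norm of a difference
    quotient; let [m] tend to infinity. *)
Lemma translation_defect_dir h : `|h| <= 1 ->
  (D (h *: e j) <= (h ^+ 2)%:E * \int[mu]_x (partial j f x ^+ 2)%:E)%E.
Proof.
move=> h1; have [->|h0] := eqVneq h 0.
  rewrite scale0r expr0n mul0e /D /translation_defect integral0_eq// => x _.
  by rewrite addr0 subrr expr0n.
have [M M0 [_ qM]] := dquot_bounded.
have [B B0 [_ qB]] := dquot_supported.
have -> : ((h ^+ 2)%:E * \int[mu]_x (partial j f x ^+ 2)%:E =
    \int[mu]_x (h ^+ 2 * partial j f x ^+ 2)%:E)%E.
  rewrite -ge0_integralZl_EFin ?sqr_ge0//.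
  - by move=> x _; rewrite lee_fin sqr_ge0.
  - apply/measurable_EFinP; apply: measurable_funX.
    exact: (continuous_measurable_rV cont_pf).
have cv : (\int[mu]_x (h ^+ 2 * dquot f j (half_pow h m) x ^+ 2)%:E)%E @[m --> \oo] -->
  (\int[mu]_x (h ^+ 2 * partial j f x ^+ 2)%:E)%E.
  apply: (@box_dominated_cvg _ _ B (h ^+ 2 * M ^+ 2)).
  - move=> m; apply: measurable_funM; first exact: measurable_cst.
    by apply: measurable_funX; exact: measurable_dquot.
  - move=> x; apply: cvgM; first exact: cvg_cst.
    by apply: cvgM; exact: dquot_cvg.
  - move=> m x; rewrite normrM [X in X * _]ger0_norm ?sqr_ge0// normrX.
    apply: ler_wpM2l; first exact: sqr_ge0.
    by rewrite ler_sqr ?nnegrE//; apply: qM; exact: half_pow_neq0.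
  - move=> m x; rewrite mulf_eq0 negb_or !sqrf_eq0 => /andP[_].
    by apply: (qB (half_pow h m)); exact: half_pow_le1.
apply: (lee_lim_cst cv) => m.
apply: (le_trans (translation_defect_half mf h j m)).
rewrite /D /translation_defect -ge0_integralZl_EFin ?exprn_ge0//; last 2 first.
- by move=> x _; rewrite lee_fin sqr_ge0.
- by apply/measurable_EFinP; exact: measurable_defect.
apply: ge0_le_integral => //.
- by move=> x _; rewrite lee_fin mulr_ge0 ?sqr_ge0 ?exprn_ge0.
- apply/measurable_EFinP; apply: measurable_funM; first exact: measurable_cst.
  apply: measurable_funX.
  by apply: measurable_funB => //; exact: measurable_shift.
- apply/measurable_EFinP; apply: measurable_funM; first exact: measurable_cst.
  by apply: measurable_funX; exact: measurable_dquot.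
- move=> x _; rewrite lee_fin /dquot.
  set Dd := f _ - f x; rewrite /half_pow exprVn.
  have -> : (4 ^+ m : R) = 2 ^+ m * 2 ^+ m by rewrite -exprMn; congr (_ ^+ _); lra.
  have : 2 ^+ m != 0 :> R by rewrite expf_neq0.
  move: (2 ^+ m) => p p0; rewrite le_eqVlt; apply/orP; left; apply/eqP; field.
  by rewrite p0 h0.
Qed.

End dquot.
End estimates.

(** * The Friedrichs inequality on a grid *)

Section friedrichs.
Context {R : realType} {n : nat}.
Local Notation T := 'rV[R]_n.+1.
Local Notation mu := (lebesgue_rV (R := R) n.+1).
Local Notation e j := (delta_mx ord0 j : T).
Implicit Types (f g : T -> R) (x v a z : T) (j : 'I_n.+1).

Definition grad_energy f : \bar R :=
  (\sum_j \int[mu]_x (partial j f x ^+ 2)%:E)%E.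

Lemma grad_energy_ge0 f : (0 <= grad_energy f)%E.
Proof.
apply: sume_ge0 => j _; apply: integral_ge0 => x _.
by rewrite lee_fin sqr_ge0.
Qed.

(** The translation by [z] is decomposed into translations along the axes, each
    addition costing a factor [2]. *)
Lemma translation_defect_le f r z : smooth f -> compact (tsupport f) ->
  0 <= r <= 1 -> box r z ->
  (translation_defect f z <= (2 ^+ n.+2 * r ^+ 2)%:E * grad_energy f)%E.
Proof.
move=> sf cf /andP[r0 r1] zr.
have mf : measurable_fun setT (f : T -> measurableTypeR R).
  by apply: continuous_measurable_rV; exact: smooth_continuous.
have G0 j : (0 <= \int[mu]_x (partial j f x ^+ 2)%:E)%E.
  by apply: integral_ge0 => x _; rewrite lee_fin sqr_ge0.
have dir j : (translation_defect f (z ord0 j *: e j) <=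
    (r ^+ 2)%:E * \int[mu]_x (partial j f x ^+ 2)%:E)%E.
  apply: (le_trans (translation_defect_dir j sf cf (le_trans (zr j) r1))).
  apply: lee_wpmul2r => //; rewrite lee_fin -[leLHS]real_normK ?num_real//.
  by rewrite ler_sqr ?nnegrE// zr.
have seqs (s : seq 'I_n.+1) :
    (translation_defect f (\sum_(j <- s) z ord0 j *: e j)%R <=
    (2 ^+ (size s).+1 * r ^+ 2)%:E * \sum_(j <- s) \int[mu]_x (partial j f x ^+ 2)%:E)%E.
  elim: s => [|j s IH].
    rewrite !big_nil mule0 /translation_defect integral0_eq// => x _.
    by rewrite addr0 subrr expr0n.
  rewrite !big_cons; apply: (le_trans (translation_defectD mf _ _)).
  have S0 : (0 <= \sum_(j <- s) \int[mu]_x (partial j f x ^+ 2)%:E)%E by exact: sume_ge0.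
  rewrite [leRHS](ge0_muleDr _ (G0 j) S0); apply: leeD.
    apply: (@le_trans _ _ ((2 * r ^+ 2)%:E * \int[mu]_x (partial j f x ^+ 2)%:E)%E).
      by rewrite EFinM -muleA; apply: lee_wpmul2l.
    apply: lee_wpmul2r => //; rewrite lee_fin; apply: ler_wpM2r; first exact: sqr_ge0.
    by rewrite /= exprS ler_peMr// exprn_ege1// ler1n.
  rewrite /= exprS -mulrA EFinM -muleA; apply: lee_wpmul2l => //.
have := seqs (index_enum 'I_n.+1).
rewrite -row_sum_delta => /le_trans; apply.
have -> : size (index_enum 'I_n.+1) = n.+1.
  by rewrite /index_enum -enumT size_enum_ord.
exact: lexx.
Qed.

Section cell.
Variables (f : T -> R) (q : set T) (v M : R).
Hypotheses (mq : measurable q) (vq : mu q = v%:E).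
Hypothesis mf : measurable_fun setT (f : T -> measurableTypeR R).
Hypothesis fM : forall x, `|f x| <= M.

Let I := \int[mu]_(x in q) f x.
Let S := \int[mu]_(x in q) f x ^+ 2.

Let qfin : (mu q < +oo)%E. Proof. by rewrite vq ltry. Qed.

Let int_bounded (g : T -> R) K : measurable_fun setT (g : T -> measurableTypeR R) ->
  (forall x, `|g x| <= K) -> mu.-integrable q (EFin \o g).
Proof.
move=> mg gK; apply: measurable_bounded_integrable => //.
- exact: measurable_funTS.
- exists K; split; first exact: num_real.
  by move=> N KN x _; apply: (le_trans (gK x)); exact: ltW.
Qed.

Let M0 : 0 <= M. Proof. by apply: le_trans (fM 0). Qed.

Let if1 : mu.-integrable q (EFin \o f). Proof. exact: int_bounded fM. Qed.

Let if2 : mu.-integrable q (EFin \o (fun x => f x ^+ 2)).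
Proof.
apply: (@int_bounded _ (M ^+ 2)); first exact: measurable_funX.
by move=> x; rewrite normrX ler_sqr ?nnegrE.
Qed.

Lemma cell_quadratic (al be ga : R) :
  (\int[mu]_(x in q) (al + be * f x + ga * f x ^+ 2)%:E =
   (al * v + be * I + ga * S)%:E)%E.
Proof.
have i0 : mu.-integrable q (EFin \o (fun=> al)).
  by apply: (@int_bounded _ `|al|).
have i1 : mu.-integrable q (EFin \o (fun x => be * f x)).
  apply: (@int_bounded _ (`|be| * M)).
    by apply: measurable_funM; first exact: measurable_cst.
  by move=> x; rewrite normrM ler_wpM2l.
have i2 : mu.-integrable q (EFin \o (fun x => ga * f x ^+ 2)).
  apply: (@int_bounded _ (`|ga| * M ^+ 2)).
    apply: measurable_funM; first exact: measurable_cst.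
    exact: measurable_funX.
  by move=> x; rewrite normrM ler_wpM2l// normrX ler_sqr ?nnegrE.
have i01 : mu.-integrable q (EFin \o (fun x => al + be * f x)).
  exact: (integrableD mq i0 i1).
have i012 : mu.-integrable q (EFin \o (fun x => al + be * f x + ga * f x ^+ 2)).
  exact: (integrableD mq i01 i2).
rewrite EFin_Rint// RintegralD// RintegralD// !RintegralZl//.
have E : fine (mu q) = v by rewrite vq.
by rewrite Rintegral_cst// -[in RHS]E.
Qed.

Lemma cell_inner x :
  (\int[mu]_(y in q) ((f y - f x) ^+ 2)%:E =
   (S + (- 2 * I) * f x + v * f x ^+ 2)%:E)%E.
Proof.
transitivity (\int[mu]_(y in q) (f x ^+ 2 + (- 2 * f x) * f y + 1 * f y ^+ 2)%:E)%E.
  by apply: eq_integral => y _; congr EFin; ring.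
by rewrite cell_quadratic; congr EFin; ring.
Qed.

(** Variance as a double integral: expand the square and integrate twice. *)
Lemma cell_variance :
  (\int[mu]_(x in q) \int[mu]_(y in q) ((f y - f x) ^+ 2)%:E =
   (2 * (v * S - I ^+ 2))%:E)%E.
Proof.
transitivity (\int[mu]_(x in q) (S + (- 2 * I) * f x + v * f x ^+ 2)%:E)%E.
  by apply: eq_integral => x _; exact: cell_inner.
by rewrite cell_quadratic; congr EFin; ring.
Qed.

Lemma cell_sq : (\int[mu]_(x in q) (f x ^+ 2)%:E = S%:E)%E.
Proof. by rewrite EFin_Rint. Qed.

End cell.
End friedrichs.

Section grid.
Context {R : realType} {n : nat}.
Local Notation T := 'rV[R]_n.+1.
Local Notation mu := (lebesgue_rV (R := R) n.+1).
Local Notation e j := (delta_mx ord0 j : T).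
Variables (L : R) (m : nat).
Hypotheses (L0 : 0 < L).
Implicit Types (f g : T -> R) (x y v a z : T) (j : 'I_n.+1).

Let h := L *+ 2 / m.+1%:R.

(** Half-open cells, so that a grid of them is a partition of a cube. *)
Definition cell (c : {ffun 'I_n.+1 -> 'I_m.+1}) : set T :=
  [set x | forall i, `[- L + (c i)%:R * h, - L + (c i).+1%:R * h[%classic (x ord0 i)].

Let h0 : 0 < h. Proof. by rewrite divr_gt0// pmulrn_lgt0. Qed.

Lemma measurable_cell c : measurable (cell c).
Proof.
apply: (@measurable_box _ _ (fun i => `[- L + (c i)%:R * h, - L + (c i).+1%:R * h[%classic)) => i.
exact: measurable_itv.
Qed.

Lemma cell_measure c : mu (cell c) = (h ^+ n.+1)%:E.
Proof.
rewrite (lebesgue_rV_box (A := fun i => `[- L + (c i)%:R * h, - L + (c i).+1%:R * h[%classic))//.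
under eq_bigr.
  move=> i _; rewrite lebesgue_measure_itv/= lte_fin ltrD2l ltr_pM2r// ltr_nat ltnSn.
  rewrite -EFinB (_ : _ - _ = h); last by rewrite -natr1; ring.
  over.
by rewrite prodEFin prodr_const card_ord.
Qed.

Lemma cell_close c x y : cell c x -> cell c y -> box h (y - x).
Proof.
move=> cx cy i; have := cx i; have := cy i; rewrite /= !in_itv/= !mxE.
move=> /andP[y1 y2] /andP[x1 x2]; rewrite ler_norml.
rewrite -natr1 in x2 y2.
move: (_%:R) x1 x2 y1 y2 => k x1 x2 y1 y2.
by apply/andP; split; lra.
Qed.

Lemma cell_inj c d x : cell c x -> cell d x -> c = d.
Proof.
move=> cx dx; apply/ffunP => i; apply/val_inj/eqP => /=.
have := cx i; have := dx i; rewrite /= !in_itv/= => /andP[d1 d2] /andP[c1 c2].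
have lt1 : (c i)%:R * h < (d i).+1%:R * h by lra.
have lt2 : (d i)%:R * h < (c i).+1%:R * h by lra.
rewrite eqn_leq; apply/andP; split.
  by move: lt1; rewrite ltr_pM2r// ltr_nat ltnS.
by move: lt2; rewrite ltr_pM2r// ltr_nat ltnS.
Qed.

Lemma cell_cover B x : B < L -> box B x -> exists c, cell c x.
Proof.
move=> BL xB.
have pos i : 0 <= (x ord0 i + L) / h.
  by apply: divr_ge0 (ltW h0); have := xB i; rewrite ler_norml => /andP[]; lra.
have lt i : (Num.truncn ((x ord0 i + L) / h) < m.+1)%N.
  rewrite truncn_lt_nat// ltr_pdivrMr// /h mulrC divfK ?pnatr_eq0//.
  by have := xB i; rewrite ler_norml mulr2n => /andP[]; lra.
exists [ffun i => Ordinal (lt i)] => i /=; rewrite in_itv/= ffunE /=.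
have /andP[] := truncn_itv (pos i).
by rewrite ler_pdivlMr// ltr_pdivrMr// => a b; apply/andP; split; lra.
Qed.

Section friedrichs.
Variables (f : T -> R) (B : R).
Hypotheses (sf : smooth f) (cf : compact (tsupport f)) (fB : supported_in f B).
Hypotheses (BL : B < L) (h1 : h <= 1).

Let contf := smooth_continuous sf.
Let mf : measurable_fun setT (f : T -> measurableTypeR R).
Proof. exact: continuous_measurable_rV. Qed.

Let I c := \int[mu]_(x in cell c) f x.
Let S c := \int[mu]_(x in cell c) f x ^+ 2.

Let k (p : T * T) : R := \1_(box h) p.2 * (f (p.1 + p.2) - f p.1) ^+ 2.

Let k0 p : 0 <= k p.
Proof. by rewrite mulr_ge0 ?sqr_ge0// indicE. Qed.

Let mk : measurable_fun setT (k : T * T -> measurableTypeR R).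
Proof.
apply: measurable_funM.
  have mi : measurable_fun setT (\1_(box h) : T -> measurableTypeR R).
    by apply: measurable_indic; exact: measurable_box_cube.
  exact: (measurableT_comp mi measurable_snd).
apply: measurable_funX; apply: measurable_funB.
  apply: (measurableT_comp mf); apply: measurable_fun_coordP => i.
  rewrite (_ : (fun t => _) = (fun t : T * T => (t.1 ord0 i : R) + t.2 ord0 i)).
    apply: measurable_funD.
      exact: (measurableT_comp (measurable_coord i) measurable_fst).
    exact: (measurableT_comp (measurable_coord i) measurable_snd).
  by apply/funext => t; rewrite mxE.
exact: (measurableT_comp mf measurable_fst).
Qed.

Let mkE : measurable_fun setT (EFin \o k).
Proof. exact/measurable_EFinP. Qed.

(** Integral over all small translations of the square differences at [x]; it
    dominates the inner integral of the variance over the cell of [x]. *)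
Let H x : \bar R := (\int[mu]_z (k (x, z))%:E)%E.

Let mH : measurable_fun setT H.
Proof.
exact: (measurable_fun_fubini_tonelli_F (m2 := mu) (EFin \o k) mkE (fun p => k0 p)).
Qed.

Let H0 x : (0 <= H x)%E.
Proof. by apply: integral_ge0 => z _; rewrite lee_fin. Qed.

(** Two points of a cell differ by a vector of [box h], so that the variance
    within the cell only involves small translations. *)
Let inner_le c x : cell c x ->
  (\int[mu]_(y in cell c) ((f y - f x) ^+ 2)%:E <= H x)%E.
Proof.
move=> cx; rewrite integral_mkcond.
pose g (y : T) : R := \1_(cell c) y * (f y - f x) ^+ 2.
have mg : measurable_fun setT (g : T -> measurableTypeR R).
  apply: measurable_funM.
    by apply: measurable_indic; exact: measurable_cell.
  by apply: measurable_funX; apply: measurable_funB.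
have g0 y : 0 <= g y by rewrite mulr_ge0 ?sqr_ge0// indicE.
rewrite (_ : (_ \_ _) = EFin \o g); last first.
  apply/funext => y; rewrite patchE /g/= indicE; case: ifPn => _.
    by rewrite mul1r.
  by rewrite mul0r.
rewrite -(integral_translate x mg).
apply: ge0_le_integral => //.
- by move=> z _; rewrite lee_fin.
- by apply/measurable_EFinP; exact: measurable_shift.
- by apply/measurable_EFinP; exact: (measurableT_comp mk (measurable_pair1 x)).
- move=> z _; rewrite lee_fin /g /k/= [z + x]addrC; apply: ler_wpM2r; first exact: sqr_ge0.
  rewrite !indicE ler_nat; have [zc|//] := boolP (x + z \in cell c).
  rewrite (_ : z \in box h)//; rewrite !inE in zc *.
  by have := cell_close cx zc; rewrite addrC addKr.
Qed.

Let fM : exists2 M, 0 <= M & forall x, `|f x| <= M.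
Proof. exact: csupp_bounded. Qed.

Let trivIset_cell (D : set {ffun 'I_n.+1 -> 'I_m.+1}) : trivIset D cell.
Proof. by move=> c d _ _ [x [cx dx]]; exact: cell_inj cx dx. Qed.

Let U := \big[setU/set0]_(c <- index_enum {ffun 'I_n.+1 -> 'I_m.+1}) cell c.

Let fU x : ~ U x -> f x = 0.
Proof.
move=> Ux; apply: contrapT => /eqP/fB/(cell_cover BL)[c cx]; apply: Ux.
by rewrite /U -bigcup_seq; exists c => //=; rewrite mem_index_enum.
Qed.

Let mU : measurable U.
Proof. by apply: bigsetU_measurable => c _; exact: measurable_cell. Qed.

Let v0 : 0 < h ^+ n.+1. Proof. by rewrite exprn_gt0. Qed.

Let sum_variance : ((\sum_c (2 * (h ^+ n.+1 * S c - I c ^+ 2)))%:E <=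
  \int[mu]_x H x)%E.
Proof.
have [M M0 fle] := fM.
rewrite -sumEFin.
apply: (@le_trans _ _ (\sum_c \int[mu]_(x in cell c) H x)%E).
  apply: lee_sum => c _.
  rewrite -(cell_variance (measurable_cell c) (cell_measure c) mf fle).
  apply: ge0_le_integral => //.
  - exact: measurable_cell.
  - by move=> x _; apply: integral_ge0 => y _; rewrite lee_fin sqr_ge0.
  - rewrite (_ : (fun x => _) = (fun x : T => (S c + (- 2 * I c) * f x + (h ^+ n.+1) * f x ^+ 2)%:E)).
      apply/measurable_EFinP; apply: measurable_funTS; apply: measurable_funD; last first.
        by apply: measurable_funM; [exact: measurable_cst|exact: measurable_funX].
      by apply: measurable_funD; first exact: measurable_cst; apply: measurable_funM; first exact: measurable_cst.
    apply/funext => x; exact: (cell_inner (measurable_cell c) (cell_measure c) mf fle).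
  - exact: measurable_funTS.
  - by move=> x cx; exact: inner_le.
rewrite -ge0_integral_bigsetU//.
- apply: ge0_subset_integral => //.
- exact: measurable_cell.
- exact: index_enum_uniq.
- exact: measurable_funTS.
Qed.

Let sum_sq : (\int[mu]_x (f x ^+ 2)%:E = (\sum_c S c)%:E)%E.
Proof.
have [M M0 fle] := fM.
have -> : (\int[mu]_x (f x ^+ 2)%:E = \int[mu]_(x in U) (f x ^+ 2)%:E)%E.
  rewrite [RHS]integral_mkcond; apply: eq_integral => x _; rewrite patchE.
  case: ifPn => // /negP; rewrite inE => /fU ->.
  by rewrite expr0n.
have m2 : measurable_fun setT (fun x => (f x ^+ 2)%:E).
  by apply/measurable_EFinP; exact: measurable_funX.
rewrite ge0_integral_bigsetU//.
- rewrite -sumEFin; apply: eq_bigr => c _.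
  exact: (cell_sq (measurable_cell c) (cell_measure c) mf fle).
- exact: measurable_cell.
- exact: index_enum_uniq.
- exact: measurable_funTS.
- by move=> x _; rewrite lee_fin sqr_ge0.
Qed.

(** Exchanging the integrals, the translation defects of [f] appear, and they are
    bounded by the gradient. *)
Let int_H (g : R) : grad_energy f = g%:E ->
  (\int[mu]_x H x <= (2 ^+ n.+2 * h ^+ 2 * g * (h *+ 2) ^+ n.+1)%:E)%E.
Proof.
move=> gE; rewrite /H.
have -> : (\int[mu]_x \int[mu]_z (k (x, z))%:E = \int[mu]_z \int[mu]_x (k (x, z))%:E)%E.
  exact: (fubini_tonelli (m1 := mu) (m2 := mu) (EFin \o k) mkE (fun p => k0 p)).
have g0 : 0 <= g by rewrite -lee_fin -gE grad_energy_ge0.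
have C0 : 0 <= 2 ^+ n.+2 * h ^+ 2 * g by rewrite mulr_ge0// mulr_ge0 ?sqr_ge0 ?exprn_ge0.
apply: (@le_trans _ _ (\int[mu]_z ((2 ^+ n.+2 * h ^+ 2 * g) * \1_(box h) z)%:E)%E).
  apply: ge0_le_integral => //.
  - by move=> z _; apply: integral_ge0 => x _; rewrite lee_fin.
  - exact: (measurable_fun_fubini_tonelli_G (m1 := mu) (EFin \o k) mkE (fun p => k0 p)).
  - apply/measurable_EFinP; apply: measurable_funM; first exact: measurable_cst.
    by apply: measurable_indic; exact: measurable_box_cube.
  - move=> z _; rewrite /k/= indicE; have [zh|_] := boolP (z \in box h); last first.
      rewrite mulr0 integral0_eq// => x _; by rewrite mul0r.
    rewrite mulr1; under eq_integral do rewrite mul1r.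
    rewrite EFinM -gE; apply: translation_defect_le => //; first by rewrite ltW.
    by rewrite inE in zh.
under eq_integral do rewrite EFinM.
rewrite ge0_integralZl_EFin//.
- rewrite integral_indic//; last exact: measurable_box_cube.
  by rewrite setIT [leRHS]EFinM -(box_measure (n := n) (ltW h0)).
- by apply/measurable_EFinP; apply: measurable_indic; exact: measurable_box_cube.
Qed.

(** On each cell the integral of [f ^+ 2] splits into a multiple of the square of
    the mean of [f] and a variance; the sum of the variances is small with the
    mesh, at fixed gradient energy. *)
Lemma grid_friedrichs (g : R) : grad_energy f = g%:E ->
  (\int[mu]_x (f x ^+ 2)%:E <=
   (\sum_c ((Num.sqrt (h ^+ n.+1))^-1 * I c) ^+ 2 + 4 ^+ n.+1 * h ^+ 2 * g)%:E)%E.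
Proof.
move=> gE; rewrite sum_sq lee_fin.
have := le_trans sum_variance (int_H gE); rewrite lee_fin.
rewrite -mulr_sumr sumrB -mulr_sumr.
have -> : \sum_c ((Num.sqrt (h ^+ n.+1))^-1 * I c) ^+ 2 = (h ^+ n.+1)^-1 * \sum_c I c ^+ 2.
  rewrite mulr_sumr; apply: eq_bigr => c _.
  by rewrite exprMn exprVn sqr_sqrtr// ltW.
rewrite -[h *+ 2]mulr_natr (exprMn n.+1 h 2).
have -> : (4 ^+ n.+1 : R) = 2 ^+ n.+1 * 2 ^+ n.+1 by rewrite -exprMn; congr (_ ^+ _); lra.
rewrite [2 ^+ n.+2]exprS.
have h2 : 0 <= h ^+ 2 by exact: sqr_ge0.
move: (\sum_c S c) (\sum_c I c ^+ 2) v0 (2 ^+ n.+1 : R) (h ^+ 2) h2 => SS II.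
move: (h ^+ n.+1) => v v1 p s s0 le.
rewrite -(ler_pM2l v1) mulrDr (mulrA v v^-1) divff ?gt_eqF// mul1r.
have -> : v * (p * p * s * g) = v * p * p * s * g by ring.
nra.
Qed.

End friedrichs.
End grid.

(** * Bounded domains of the half space *)

Section geometry.
Context {R : realType} {n : nat}.
Local Notation T := 'rV[R]_n.+1.
Implicit Types (x y p : T) (Omega : set T).

Lemma acosh_le (s r : R) : 0 <= s -> acosh (1 + s) <= r -> 1 + s <= expR r.
Proof.
move=> s0 h.
have p1 : 1 + s <= 1 + s + Num.sqrt ((1 + s) ^+ 2 - 1) by rewrite lerDl sqrtr_ge0.
apply: (le_trans p1); rewrite -(lnK (_ : 1 + s + Num.sqrt ((1 + s) ^+ 2 - 1) \is Num.pos)).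
  by rewrite ler_expR.
by rewrite posrE; apply: lt_le_trans p1; lra.
Qed.

Lemma dist_sum_ge (x p : T) i :
  (x ord0 i - p ord0 i) ^+ 2 <= \sum_(j < n.+1) (p ord0 j - x ord0 j) ^+ 2.
Proof.
rewrite (bigD1 i)//= -[x ord0 i - _]opprB sqrrN lerDl.
by apply: sumr_ge0 => j _; exact: sqr_ge0.
Qed.

(** The formula for the distance to the centre [p] bounds the Euclidean distance
    to [p] by a multiple of the height; for the height coordinate this is a
    quadratic inequality, which confines the height to a compact interval of
    positive numbers. *)
Lemma hyp_bounded_height Omega : Omega `<=` upper_half_space -> hyp_bounded Omega ->
  exists c C B : R, [/\ 0 < c, 0 < C, 0 < B,
    forall x, Omega x -> c <= height x <= C & Omega `<=` box B].
Proof.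
move=> Oup [p hp [r hr]].
pose K := expR r.
have K0 : 0 < K by exact: expR_gt0.
have key x : Omega x ->
    \sum_(j < n.+1) (p ord0 j - x ord0 j) ^+ 2 <= 2 * height p * height x * (K - 1).
  move=> Ox; have hx : 0 < height x by exact: Oup.
  have d0 : 0 < 2 * height p * height x by rewrite !mulr_gt0.
  have S0 : 0 <= \sum_(j < n.+1) (p ord0 j - x ord0 j) ^+ 2.
    by apply: sumr_ge0 => j _; exact: sqr_ge0.
  have := acosh_le (divr_ge0 S0 (ltW d0)) (hr x Ox).
  by rewrite -/K -lerBrDl ler_pdivrMr// mulrC.
pose P := height p; have P0 : 0 < P by exact: hp.
pose C := 2 * P * K; have C0 : 0 < C by rewrite !mulr_gt0.
have height_bound x : Omega x -> P / (2 * K) <= height x <= C.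
  move=> Ox; have hx : 0 < height x by exact: Oup.
  have := le_trans (dist_sum_ge x p ord_max) (key x Ox).
  rewrite -/(height x) -/(height p) -/P => h.
  have h' : height x * height x + P * P <= 2 * P * height x * K by nra.
  have h1 : height x * height x <= C * height x by rewrite /C; nra.
  have h2 : P * P <= P * (2 * height x * K) by nra.
  rewrite ler_pM2r// in h1; rewrite ler_pM2l// in h2.
  rewrite h1 andbT ler_pdivrMr ?mulr_gt0//; lra.
pose B := \sum_i `|p ord0 i| + (2 * P * C * K + 1).
have Q0 : 0 < 2 * P * C * K by rewrite !mulr_gt0.
have S0 : 0 <= \sum_i `|p ord0 i| by exact: sumr_ge0.
exists (P / (2 * K)), C, B; split => //.
- by rewrite divr_gt0// mulr_gt0.
- by rewrite /B; lra.
move=> x Ox i; have hx : 0 < height x by exact: Oup.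
have h := le_trans (dist_sum_ge x p i) (key x Ox).
have /andP[_ hC] := height_bound x Ox.
have h1 : (x ord0 i - p ord0 i) ^+ 2 <= 2 * P * C * K.
  have h0 : height x * (K - 1) <= C * K.
    by have := ler_wpM2r (ltW K0) hC; lra.
  by apply: (le_trans h); have := ler_wpM2l (ltW P0) h0; rewrite -/P; lra.
have h2 : `|x ord0 i - p ord0 i| <= 2 * P * C * K + 1.
  rewrite -ler_sqr ?nnegrE//; last by lra.
  rewrite real_normK ?num_real//; apply: (le_trans h1); nra.
have h3 : `|p ord0 i| <= \sum_i `|p ord0 i|.
  by rewrite (bigD1 i)//= lerDl sumr_ge0.
have -> : x ord0 i = (x ord0 i - p ord0 i) + p ord0 i by ring.
by apply: (le_trans (ler_normD _ _)); rewrite /B; lra.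
Qed.

Section rho.
Variables (Omega : set T) (c C : R).
Hypotheses (c0 : 0 < c) (hO : forall x, Omega x -> c <= height x <= C).
Hypothesis O0 : Omega !=set0.

Lemma closure_height x : hyp_closure Omega x -> c <= height x <= C.
Proof.
move=> [cx _].
have ch : continuous (@height R n) by exact: continuous_coord.
have cl : closed [set y : T | c <= height y <= C].
  rewrite (_ : [set _ | _] = @height R n @^-1` `[c, C]%classic); last first.
    by apply/seteqP; split => y /=; rewrite in_itv.
  by move/continuous_closedP : ch; apply; exact: itv_closed.
have /closure_subset : Omega `<=` [set y : T | c <= height y <= C] by [].
by move/(_ x cx); rewrite -(proj1 (closure_id _) cl).
Qed.

Lemma rho_bounds x : hyp_closure Omega x -> C ^- 2 <= rho x <= c ^- 2.
Proof.
move=> /closure_height/andP[h1 h2]; rewrite /rho.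
have hx : 0 < height x by exact: lt_le_trans c0 h1.
have C0 : 0 < C by exact: lt_le_trans hx h2.
have c1 := ltW c0; have hx1 := ltW hx; have C1 := ltW C0.
by apply/andP; split; rewrite lef_pV2 ?posrE ?exprn_gt0// ler_sqr ?nnegrE.
Qed.

Hypothesis Oup : Omega `<=` upper_half_space.

Lemma sub_hyp_closure x : Omega x -> hyp_closure Omega x.
Proof. by move=> Ox; split; [exact: subset_closure|exact: Oup]. Qed.

Lemma rho_le_max x : Omega x -> rho x <= rho_max Omega.
Proof.
move=> Ox; apply: ub_le_sup; last by exists x => //; exact: sub_hyp_closure.
by exists (c ^- 2) => _ [y cy <-]; have /andP[] := rho_bounds cy.
Qed.

Lemma rho_min_le x : Omega x -> rho_min Omega <= rho x.
Proof.
move=> Ox; apply: ge_inf; last by exists x => //; exact: sub_hyp_closure.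
by exists (C ^- 2) => _ [y cy <-]; have /andP[] := rho_bounds cy.
Qed.

Lemma rho_min_gt0 : 0 < rho_min Omega.
Proof.
have [x Ox] := O0.
have C0 : 0 < C by have /andP[] := hO Ox; move: c0; lra.
apply: (@lt_le_trans _ _ (C ^- 2)); first by rewrite invr_gt0 exprn_gt0.
apply: lb_le_inf; first by exists (rho x), x => //; exact: sub_hyp_closure.
by move=> _ [y cy <-]; have /andP[] := rho_bounds cy.
Qed.

Lemma rho_max_gt0 : 0 < rho_max Omega.
Proof.
have [x Ox] := O0; apply: lt_le_trans (rho_le_max Ox).
by apply: (lt_le_trans rho_min_gt0); exact: rho_min_le.
Qed.

End rho.
End geometry.

(** * The Laplacian and its commutators with the coordinates *)

Section operators.
Context {R : realType} {n : nat}.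
Local Notation T := 'rV[R]_n.+1.
Local Notation mu := (lebesgue_rV (R := R) n.+1).
Local Notation e j := (delta_mx ord0 j : T).
Local Notation N := n.+1.
Variable Omega : set T.
Hypotheses (Oup : Omega `<=` upper_half_space) (Oop : open Omega).
Implicit Types (f g chi phi psi : T -> R) (x y : T) (j : 'I_n.+1).
Local Notation test := (test_function Omega).

Lemma measurable_Omega : measurable Omega.
Proof. exact: open_measurable_rV. Qed.

Lemma test_smooth chi : test chi -> smooth chi. Proof. by case. Qed.

Lemma test_cont chi : test chi -> continuous chi.
Proof. by move=> /test_smooth/smooth_continuous. Qed.

Lemma test_derivable chi : test chi -> derivable_all chi.
Proof. by move=> /test_smooth/smooth_derivable. Qed.

Lemma test_out chi x : test chi -> ~ Omega x -> chi x = 0.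
Proof. by move=> [_ _ tO] Ox; apply: tsupport0 => /tO. Qed.

Lemma integrable_test chi : test chi -> mu.-integrable Omega (EFin \o chi).
Proof.
move=> [sf cf _]; apply: (integrableS measurableT) => //.
  exact: measurable_Omega.
by apply: csupp_integrable => //; exact: smooth_continuous.
Qed.

Lemma int_test_setT chi : test chi ->
  \int[mu]_(x in Omega) chi x = \int[mu]_x chi x.
Proof.
move=> tc; rewrite Rintegral_mkcond; apply: eq_Rintegral => x _.
rewrite patchE; case: ifPn => // /negP; rewrite inE => Ox.
by rewrite (test_out tc Ox).
Qed.

Lemma int_partial0 chi j : test chi -> \int[mu]_(x in Omega) partial j chi x = 0.
Proof.
move=> tc; rewrite int_test_setT; last exact: test_partial.
by apply: integral_partial0; case: tc.
Qed.

Lemma test_weight chi : test chi -> test (fun x => chi x * height x ^- N).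
Proof.
move=> tc; rewrite (_ : (fun _ => _) = fun x => height x ^- N * chi x).
  exact: testVn.
by apply/funext => x; rewrite mulrC.
Qed.

Lemma hyp_int_lin (a : R) chi1 chi2 : test chi1 -> test chi2 ->
  hyp_int Omega (fun x => a * chi1 x + chi2 x) =
  a * hyp_int Omega chi1 + hyp_int Omega chi2.
Proof.
move=> t1 t2; rewrite /hyp_int.
under eq_Rintegral do rewrite mulrDl -mulrA.
rewrite RintegralD ?RintegralZl//; do ?exact: measurable_Omega.
- by apply: integrable_test; exact: test_weight.
- by apply: (@integrable_test (fun x => a * (chi1 x * height x ^- N))); apply: testZ; exact: test_weight.
- by apply: integrable_test; exact: test_weight.
Qed.

Lemma hyp_int_le chi1 chi2 : test chi1 -> test chi2 ->
  (forall x, Omega x -> chi1 x <= chi2 x) -> hyp_int Omega chi1 <= hyp_int Omega chi2.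
Proof.
move=> t1 t2 h; apply: le_Rintegral.
- exact: measurable_Omega.
- by apply: integrable_test; exact: test_weight.
- by apply: integrable_test; exact: test_weight.
- move=> x Ox; apply: ler_wpM2r; last exact: h.
  by rewrite invr_ge0 exprn_ge0// ltW//; exact: Oup.
Qed.

Lemma eq_hyp_int f g : (forall x, Omega x -> f x = g x) ->
  hyp_int Omega f = hyp_int Omega g.
Proof.
move=> h; apply: eq_Rintegral => x; rewrite inE => Ox.
by rewrite h.
Qed.

Lemma hyp_int0 : hyp_int Omega (fun=> 0) = 0.
Proof.
have := hyp_int_lin 1 (test0 Omega) (test0 Omega).
rewrite (_ : (fun x : T => _) = fun=> 0); first by lra.
by apply/funext => x; rewrite mulr0 addr0.
Qed.

Lemma hyp_int_ge0 f : (forall x, Omega x -> 0 <= f x) -> 0 <= hyp_int Omega f.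
Proof.
move=> h; apply: Rintegral_ge0 => x Ox; rewrite mulr_ge0 ?h//.
by rewrite invr_ge0 exprn_ge0// ltW//; exact: Oup.
Qed.

Lemma hyp_int_partial0 chi j : test chi ->
  hyp_int Omega (fun x => height x ^+ N * partial j chi x) = 0.
Proof.
move=> tc; rewrite -(int_partial0 j tc); apply: eq_Rintegral => x.
rewrite inE => /Oup hx; rewrite mulrAC divff ?mul1r//.
by rewrite expf_neq0// gt_eqF.
Qed.

Definition l2_form phi psi : R := hyp_int Omega (phi \* psi).

Definition grad_dot phi psi x : R :=
  height x ^+ 2 * \sum_j partial j phi x * partial j psi x.

Definition energy_form phi psi : R := hyp_int Omega (grad_dot phi psi).

Definition lap phi x : R := - hyp_laplacian phi x.

(** The components of the gradient vector field times the volume density. *)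
Definition flux phi j x : R := height x ^- N * (height x ^+ 2 * partial j phi x).

Lemma smooth_heightX k : smooth (fun x : T => height x ^+ k).
Proof.
elim: k => [|k IH].
  by rewrite (_ : (fun _ => _) = fun=> 1); [exact: smooth_cst|apply/funext => x; rewrite expr0].
rewrite (_ : (fun _ => _) = fun x => height x * height x ^+ k).
  exact: (smoothM smooth_height IH).
by apply/funext => x; rewrite exprS.
Qed.

Lemma test_flux phi j : test phi -> test (flux phi j).
Proof.
move=> tp; apply: testVn => //; apply: testM; first exact: smooth_heightX.
exact: test_partial.
Qed.

Lemma lapE phi x : lap phi x = - (height x ^+ N * \sum_j partial j (flux phi j) x).
Proof.
rewrite /lap /hyp_laplacian /hyp_div; congr (- (_ * _)).
apply: eq_bigr => j _; congr (partial j _ x).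
by apply/funext => y; rewrite /hyp_grad mxE.
Qed.

Lemma lap_lin (a : R) phi psi x : test phi -> test psi ->
  lap (fun y => a * phi y + psi y) x = a * lap phi x + lap psi x.
Proof.
move=> tp tq; rewrite !lapE.
have S : \sum_j partial j (flux (fun y => a * phi y + psi y) j) x =
    a * (\sum_j partial j (flux phi j) x) + \sum_j partial j (flux psi j) x.
  rewrite mulr_sumr -big_split/=; apply: eq_bigr => j _.
  have dp : derivable (flux phi j) x (e j) by exact/test_derivable/test_flux.
  have dq : derivable (flux psi j) x (e j) by exact/test_derivable/test_flux.
  rewrite -(partial_lin a dp dq); congr (partial j _ x).
  apply/funext => y; rewrite /flux.
  have dpy : derivable phi y (e j) by exact: test_derivable.
  have dqy : derivable psi y (e j) by exact: test_derivable.
  by rewrite (partial_lin a dpy dqy); ring.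
by rewrite [X in - (_ * X) = _]S mulrDr opprD mulrCA mulrN.
Qed.

Lemma test_lap phi : test phi -> test (lap phi).
Proof.
move=> tp; rewrite (_ : lap phi = fun x => (- 1 * height x ^+ N) * \sum_j partial j (flux phi j) x).
  apply: testM; first by apply: smoothZ; exact: smooth_heightX.
  by apply: test_sum => j; apply: test_partial; exact: test_flux.
by apply/funext => x; rewrite lapE mulN1r mulNr.
Qed.

Lemma test_grad_dot phi psi : test phi -> test psi -> test (grad_dot phi psi).
Proof.
move=> tp tq; apply: testM; first exact: smooth_heightX.
apply: test_sum => j; apply: testM; last exact: test_partial.
by apply: smooth_partial; exact: test_smooth.
Qed.

Lemma test_mul phi psi : test phi -> test psi -> test (phi \* psi).
Proof. by move=> tp tq; apply: testM => //; exact: test_smooth. Qed.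

Lemma hyp_int_sum (F : 'I_n.+1 -> T -> R) : (forall j, test (F j)) ->
  hyp_int Omega (fun x => \sum_j F j x) = \sum_j hyp_int Omega (F j).
Proof.
move=> tF; elim: (index_enum _) => [|j s IH].
  rewrite big_nil -[RHS]hyp_int0; congr hyp_int.
  by apply/funext => x; rewrite big_nil.
rewrite big_cons -IH -[X in X + _]mul1r -hyp_int_lin//; last exact: test_sum.
by congr hyp_int; apply/funext => x; rewrite big_cons mul1r.
Qed.

(** Green's formula: the difference of the integrands is the divergence of
    [psi] times the gradient of [phi]. *)
Lemma energy_lap phi psi : test phi -> test psi ->
  energy_form phi psi = l2_form (lap phi) psi.
Proof.
move=> tp tq.
have tprod j : test (fun x => flux phi j x * psi x).
  by apply: testM => //; apply: test_smooth; exact: test_flux.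
have tdiv j : test (fun x => height x ^+ N * partial j (fun x => flux phi j x * psi x) x).
  by apply: testM; [exact: smooth_heightX|exact: test_partial].
have E : hyp_int Omega (fun x => \sum_j height x ^+ N *
    partial j (fun x => flux phi j x * psi x) x) = 0.
  by rewrite hyp_int_sum// big1// => j _; exact: hyp_int_partial0.
rewrite -[RHS]addr0 -E -[X in X + _]mul1r -hyp_int_lin; last 2 first.
- by apply: test_mul => //; exact: test_lap.
- exact: test_sum.
apply: eq_hyp_int => x Ox; have hx : height x != 0 by rewrite gt_eqF//; exact: Oup.
rewrite mul1r /= lapE.
have -> : \sum_j height x ^+ N * partial j (fun x => flux phi j x * psi x) x =
    grad_dot phi psi x + psi x * (height x ^+ N * \sum_j partial j (flux phi j) x).
  rewrite /grad_dot !mulr_sumr -big_split/=; apply: eq_bigr => j _.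
  rewrite partialM; [|exact/test_derivable/test_flux|exact: test_derivable].
  have hN : height x ^+ N != 0 by rewrite expf_neq0.
  by rewrite /flux; move: (height x ^+ N) hN => v v0; field.
by ring.
Qed.

Definition mul_coord j phi x : R := x ord0 j * phi x.

Definition comm_coord j phi x : R :=
  mul_coord j (lap phi) x - lap (mul_coord j phi) x.

Lemma test_mul_coord j phi : test phi -> test (mul_coord j phi).
Proof. by apply: testM; exact: smooth_coord. Qed.

Lemma test_comm_coord j phi : test phi -> test (comm_coord j phi).
Proof.
move=> tp; rewrite (_ : comm_coord j phi = fun x =>
    mul_coord j (lap phi) x + (- 1) * lap (mul_coord j phi) x); last first.
  by apply/funext => x; rewrite mulN1r.
apply: testD; first exact/test_mul_coord/test_lap.
exact/testZ/test_lap/test_mul_coord.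
Qed.

(** The zeroth order coefficient which arises when a coordinate is differentiated
    inside [flux]. *)
Definition flux_coef phi x : R := height x ^- N * (height x ^+ 2 * phi x).

Lemma test_flux_coef phi : test phi -> test (flux_coef phi).
Proof. by move=> tp; apply: testVn => //; apply: testM => //; exact: smooth_heightX. Qed.

Lemma comm_coordE j phi x : test phi -> comm_coord j phi x =
  height x ^+ N * (flux phi j x + partial j (flux_coef phi) x).
Proof.
move=> tp; rewrite /comm_coord [X in _ - X]lapE {1}/mul_coord lapE.
have fE i : flux (mul_coord j phi) i =
    fun y => y ord0 j * flux phi i y + (j == i)%:R * flux_coef phi y.
  apply/funext => y; rewrite /flux /mul_coord partialM; last 2 first.
  - exact: derivable_coord.
  - exact: test_derivable.
  by rewrite partial_coord /flux_coef; ring.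
have E : \sum_i partial i (flux (mul_coord j phi) i) x =
   x ord0 j * \sum_i partial i (flux phi i) x + (flux phi j x + partial j (flux_coef phi) x).
  have -> : flux phi j x + partial j (flux_coef phi) x =
    \sum_i (j == i)%:R * (flux phi i x + partial i (flux_coef phi) x).
    rewrite (bigD1 j)//= eqxx mul1r big1 ?addr0// => i ij.
    by rewrite eq_sym (negbTE ij) mul0r.
  rewrite mulr_sumr -big_split/=; apply: eq_bigr => i _; rewrite fE.
  have dflux : derivable (flux phi i) x (e i) by exact/test_derivable/test_flux.
  have dconf : derivable (flux_coef phi) x (e i) by exact/test_derivable/test_flux_coef.
  rewrite partialD; last 2 first.
  - exact: (derivableM (@derivable_coord R n j x (e i)) dflux).
  - exact: (derivableM (derivable_cst ((j == i)%:R : R) x (e i)) dconf).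
  rewrite (partialM (@derivable_coord R n j x (e i)) dflux) (partialZ _ dconf) partial_coord.
  by ring.
rewrite [X in _ - - (_ * X)]E.
by move: (\sum_i _) (height x ^+ N) => S h; ring.
Qed.

(** Up to the divergence of [mul_coord j phi * flux_coef phi], tested against the
    coordinate the commutator leaves only [height ^+ 2] times the square. *)
Lemma comm_coord_mul_coord j phi : test phi ->
  - l2_form (comm_coord j phi) (mul_coord j phi) =
  hyp_int Omega (fun x => height x ^+ 2 * (phi x * phi x)).
Proof.
move=> tp.
pose chi x := mul_coord j phi x * flux_coef phi x.
have tchi : test chi.
  by apply: testM; [exact/test_smooth/test_mul_coord|exact: test_flux_coef].
have t1 : test (fun x => height x ^+ N * partial j chi x).
  by apply: testM; [exact: smooth_heightX|exact: test_partial].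
have t2 : test (comm_coord j phi \* mul_coord j phi).
  by apply: test_mul; [exact: test_comm_coord|exact: test_mul_coord].
have -> : - l2_form (comm_coord j phi) (mul_coord j phi) =
    (- 1) * hyp_int Omega (comm_coord j phi \* mul_coord j phi) +
    hyp_int Omega (fun x => height x ^+ N * partial j chi x).
  by rewrite hyp_int_partial0// mulN1r addr0.
rewrite -hyp_int_lin//; apply: eq_hyp_int => x Ox.
have hx : height x != 0 by rewrite gt_eqF//; exact: Oup.
have hN : height x ^+ N != 0 by rewrite expf_neq0.
rewrite /= comm_coordE// /chi.
have dp : derivable phi x (e j) by exact: test_derivable.
have dX : derivable (mul_coord j phi) x (e j) by exact/test_derivable/test_mul_coord.
have dconf : derivable (flux_coef phi) x (e j) by exact/test_derivable/test_flux_coef.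
rewrite (partialM dX dconf) {2}/mul_coord.
have -> : partial j (mul_coord j phi) x = x ord0 j * partial j phi x + phi x.
  rewrite (partialM (@derivable_coord R n j x (e j)) dp).
  by rewrite partial_coord eqxx mulr1.
rewrite /mul_coord /flux; move: (partial j (flux_coef phi) x) => P.
by rewrite /flux_coef; move: (height x ^+ N) hN => v v0; field.
Qed.

Lemma derivable_heightX j k x : derivable (fun y : T => height y ^+ k) x (e j).
Proof. exact/smooth_derivable/smooth_heightX. Qed.

Lemma partial_heightX j k x :
  partial j (fun y : T => height y ^+ k) x =
  k%:R * height x ^+ k.-1 * (ord_max == j)%:R.
Proof.
elim: k => [|k IH].
  rewrite (_ : (fun _ => _) = fun=> 1); last by apply/funext => y; rewrite expr0.
  by rewrite partial_cst !mul0r.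
rewrite (_ : (fun _ => _) = fun y => height y * height y ^+ k); last first.
  by apply/funext => y; rewrite exprS.
have dh : derivable (@height R n) x (e j) by exact: derivable_coord.
have dhk := @derivable_heightX j k x.
rewrite (partialM dh dhk) IH partial_coord /=.
case: k {IH dhk} => [|k] /=; first by rewrite expr0 -natr1; ring.
by rewrite [height x ^+ k.+1]exprS -[k.+2%:R]natr1; ring.
Qed.

Lemma partial_heightVn j k x : 0 < height x ->
  partial j (fun y : T => height y ^- k) x =
  - k%:R * height x ^- k.+1 * (ord_max == j)%:R.
Proof.
move=> hx; have hn : height x != 0 by rewrite gt_eqF.
have dh : derivable (@height R n) x (e j) by exact: derivable_coord.
have dhk := @derivable_heightX j k x.
rewrite partialV ?expf_neq0// partial_heightX.
case: k dhk => [|k] _; first by rewrite !mul0r oppr0 !mul0r mulr0.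
have hk : height x ^+ k != 0 by rewrite expf_neq0.
rewrite /= -[height x ^+ k.+2]/(_ ^+ _) !exprS.
by move: (height x ^+ k) hk (k.+1%:R : R) (_%:R : R) => a a0 b d; field; rewrite a0 hn.
Qed.

Lemma derivable_heightVn j k x : 0 < height x ->
  derivable (fun y : T => height y ^- k) x (e j).
Proof.
move=> hx; apply: derivableV; first by rewrite expf_neq0// gt_eqF.
exact: derivable_heightX.
Qed.

Lemma comm_coord_explicit j phi x : test phi -> Omega x ->
  comm_coord j phi x = height x *
    (2 * height x * partial j phi x + (2 - N%:R) * (ord_max == j)%:R * phi x).
Proof.
move=> tp Ox; have hx : 0 < height x by exact: Oup.
have hn : height x != 0 by rewrite gt_eqF.
have hN : height x ^+ N != 0 by rewrite expf_neq0.
rewrite comm_coordE// /flux_coef.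
have dh : derivable (@height R n) x (e j) by exact: derivable_coord.
have dh2 : derivable (fun y : T => height y ^+ 2) x (e j) by exact: derivable_heightX.
have dp : derivable phi x (e j) by exact: test_derivable.
rewrite (partialM (@derivable_heightVn j N x hx) (derivableM dh2 dp)).
rewrite (partialM dh2 dp) partial_heightVn//.
rewrite partial_heightX /= expr1.
rewrite /flux [height x ^+ N.+1]exprS -[(_ * phi) x]/(height x ^+ 2 * phi x).
by move: (height x ^+ N) hN (N%:R : R) ((ord_max == j)%:R : R) (partial j phi x) => a a0 b d p; field; rewrite a0 hn.
Qed.

(** The first order terms of the commutators add up to [4] times the energy
    density.  The cross term [4 (2 - N) h phi d phi], where [d] is the derivative
    in the height direction, is [2 (2 - N)] times a divergence minus
    [2 (2 - N) (1 - N) phi ^+ 2], which with the square [(2 - N) ^+ 2 phi ^+ 2]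
    makes [- N (N - 2) phi ^+ 2]. *)
Lemma sum_comm_coord_le (al : R) phi : test phi ->
  (forall x, Omega x -> height x ^+ 2 <= al) ->
  \sum_j l2_form (comm_coord j phi) (comm_coord j phi) <=
  al * (4 * energy_form phi phi - N%:R * (N%:R - 2) * l2_form phi phi).
Proof.
move=> tp hal.
pose a : R := 2 - N%:R.
pose chi x := height x ^- N * (height x * (phi x * phi x)).
have tpp := test_mul tp tp.
have tchi : test chi.
  by apply: testVn => //; apply: testM; [exact: smooth_height|exact: tpp].
have t1 : test (fun x => height x ^+ N * partial ord_max chi x).
  by apply: testM; [exact: smooth_heightX|exact: test_partial].
have tg := test_grad_dot tp tp.
(* the sum of the squares of the commutators, divided by [height ^+ 2] *)
pose Q x := 4 * grad_dot phi phi x + (- (N%:R * (N%:R - 2)) * (phi \* phi) x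
  + 2 * a * (height x ^+ N * partial ord_max chi x)).
have tQ : test Q.
  apply: testD; first exact: testZ.
  by apply: testD; exact: testZ.
have Qint : hyp_int Omega Q =
    4 * energy_form phi phi - N%:R * (N%:R - 2) * l2_form phi phi.
  rewrite /Q hyp_int_lin//; last by apply: testD; exact: testZ.
  rewrite hyp_int_lin//; last exact: testZ.
  rewrite (_ : (fun x => 2 * a * _) =
    (fun x => 2 * a * (height x ^+ N * partial ord_max chi x) + (fun=> 0) x)); last first.
    by apply/funext => x; rewrite addr0.
  rewrite hyp_int_lin//; last exact: test0.
  by rewrite hyp_int_partial0// hyp_int0 mulr0 addr0 addr0 mulNr.
have QE x : Omega x -> Q x =
    \sum_j (2 * height x * partial j phi x + a * (ord_max == j)%:R * phi x) ^+ 2.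
  move=> Ox; have hx : 0 < height x by exact: Oup.
  have hn : height x != 0 by rewrite gt_eqF.
  have hN : height x ^+ N != 0 by rewrite expf_neq0.
  have -> : \sum_j (2 * height x * partial j phi x + a * (ord_max == j)%:R * phi x) ^+ 2 =
    4 * grad_dot phi phi x + (4 * a * height x * phi x * partial ord_max phi x +
    a ^+ 2 * phi x ^+ 2).
    rewrite /grad_dot mulr_sumr mulr_sumr.
    have -> : 4 * a * height x * phi x * partial ord_max phi x + a ^+ 2 * phi x ^+ 2 =
      \sum_j (ord_max == j)%:R * (4 * a * height x * phi x * partial j phi x + a ^+ 2 * phi x ^+ 2).
      rewrite (bigD1 ord_max)//= eqxx mul1r big1 ?addr0// => i ij.
      by rewrite eq_sym (negbTE ij) mul0r.
    rewrite -big_split/=; apply: eq_bigr => j _.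
    by case: (ord_max == j); rewrite /=; ring.
  have dh : derivable (@height R n) x (e ord_max) by exact: derivable_coord.
  have dp : derivable phi x (e ord_max) by exact: test_derivable.
  have dpp : derivable (fun y => phi y * phi y) x (e ord_max) by exact: (derivableM dp dp).
  have dhpp : derivable (fun y => height y * (phi y * phi y)) x (e ord_max).
    exact: (derivableM dh dpp).
  rewrite /Q /chi (partialM (@derivable_heightVn ord_max N x hx) dhpp).
  rewrite (partialM dh dpp) (partialM dp dp) partial_heightVn// partial_coord eqxx.
  rewrite [height x ^+ N.+1]exprS /a /=; congr (_ + _).
  by move: (height x ^+ N) hN (N%:R : R) => p p0 b; field; rewrite p0 hn.
rewrite -Qint.
have -> : al * hyp_int Omega Q = al * hyp_int Omega Q + hyp_int Omega (fun=> 0).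
  by rewrite hyp_int0 addr0.
rewrite -hyp_int_lin//; last exact: test0.
rewrite -hyp_int_sum; last first.
  by move=> j; apply: test_mul; exact: test_comm_coord.
apply: hyp_int_le.
- by apply: test_sum => j; apply: test_mul; exact: test_comm_coord.
- by apply: testD; [exact: testZ|exact: test0].
move=> x Ox; rewrite addr0 QE//.
have -> : \sum_j (comm_coord j phi \* comm_coord j phi) x =
  height x ^+ 2 * \sum_j (2 * height x * partial j phi x + a * (ord_max == j)%:R * phi x) ^+ 2.
  rewrite mulr_sumr; apply: eq_bigr => j _.
  by rewrite /= comm_coord_explicit// -/a; ring.
by apply: ler_wpM2r; [apply: sumr_ge0 => j _; exact: sqr_ge0|exact: hal].
Qed.
End operators.

(** * The two forms on the space of test functions *)

Section test_space.
Context {R : realType} {n : nat}.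
Local Notation T := 'rV[R]_n.+1.
Local Notation mu := (lebesgue_rV (R := R) n.+1).
Local Notation N := n.+1.

(** Test functions are made a subtype of the functions to [R^o], so that they
    inherit a structure of vector space. *)
Definition test_pred (Omega : set T) : {pred T -> R^o} :=
  fun f => `[< test_function Omega f >].

Lemma test_submod Omega : submod_closed (test_pred Omega).
Proof.
split; first by apply/asboolP; exact: test0.
move=> a f g /asboolP tf /asboolP tg; apply/asboolP.
by apply: (@testD _ _ _ (fun x => a * f x) g) => //; exact: testZ.
Qed.

HB.instance Definition _ Omega :=
  GRing.isSubmodClosed.Build R (T -> R^o) (test_pred Omega) (test_submod Omega).

Record test_space (Omega : set T) := TestSpace {
  test_val : T -> R^o;
  test_valP : test_val \in test_pred Omega }.

HB.instance Definition _ Omega := [isSub for @test_val Omega].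
HB.instance Definition _ Omega := [Choice of test_space Omega by <:].
HB.instance Definition _ Omega :=
  [SubChoice_isSubLmodule of test_space Omega by <:].

Section forms.
Variable Omega : set T.
Local Notation D := (test_space Omega).
Local Notation test := (test_function Omega).
Implicit Types u v w : D.

Lemma test_of u : test (test_val u).
Proof. exact/asboolP/test_valP. Qed.

Definition mk_test (f : T -> R) (tf : test f) : D :=
  @TestSpace Omega f (introT (asboolP _) tf).

Lemma test_valZD (a : R) u v x :
  test_val (a *: u + v) x = a * test_val u x + test_val v x.
Proof. by []. Qed.

Lemma partial_test_val (a : R) u v j x : partial j (test_val (a *: u + v)) x =
  a * partial j (test_val u) x + partial j (test_val v) x.
Proof.
have du : derivable (test_val u) x (delta_mx ord0 j) by exact/test_derivable/test_of.
have dv : derivable (test_val v) x (delta_mx ord0 j) by exact/test_derivable/test_of.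
exact: (partial_lin a du dv).
Qed.

Hypotheses (Oup : Omega `<=` upper_half_space) (Oop : open Omega).

Definition b_form u v : R := l2_form Omega (test_val u) (test_val v).
Definition E_form u v : R := energy_form Omega (test_val u) (test_val v).

Lemma b_form_semi_inner : semi_inner b_form.
Proof.
have sym u v : b_form u v = b_form v u.
  by apply: eq_hyp_int => x _ /=; rewrite mulrC.
have lin a u v w : b_form (a *: u + v) w = a * b_form u w + b_form v w.
  rewrite /b_form /l2_form -hyp_int_lin//; try by apply: test_mul => //; exact: test_of.
  apply: eq_hyp_int => x _; move: (test_valZD a u v x) => E.
  by rewrite -[LHS]/(test_val (a *: u + v) x * test_val w x) E /=; ring.
split; [|exact: sym|].
  by split=> a u v w; [exact: lin|rewrite sym lin (sym u) (sym v)].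
by move=> u; apply: hyp_int_ge0 => // x _; rewrite /= -expr2 sqr_ge0.
Qed.

Lemma E_form_semi_inner : semi_inner E_form.
Proof.
have sym u v : E_form u v = E_form v u.
  apply: eq_hyp_int => x _; rewrite /grad_dot; congr (_ * _).
  by apply: eq_bigr => j _; rewrite mulrC.
have lin a u v w : E_form (a *: u + v) w = a * E_form u w + E_form v w.
  rewrite /E_form /energy_form -hyp_int_lin//; try by apply: test_grad_dot => //; exact: test_of.
  apply: eq_hyp_int => x _; rewrite /grad_dot !mulr_sumr -big_split/=.
  apply: eq_bigr => j _.
  by rewrite partial_test_val; ring.
split; [|exact: sym|].
  by split=> a u v w; [exact: lin|rewrite sym lin (sym u) (sym v)].
move=> u; apply: hyp_int_ge0 => // x _; rewrite /grad_dot mulr_ge0 ?sqr_ge0//.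
by apply: sumr_ge0 => j _; rewrite -expr2 sqr_ge0.
Qed.

Definition lap_op u : D := mk_test (test_lap Oup (test_of u)).
Definition X_op j u : D := mk_test (test_mul_coord j (test_of u)).
Definition C_op j u : D := X_op j (lap_op u) - lap_op (X_op j u).

Lemma E_lap u v : E_form u v = b_form (lap_op u) v.
Proof. exact: energy_lap (test_of u) (test_of v). Qed.

Lemma test_val_inj : injective (@test_val Omega).
Proof. exact: val_inj. Qed.

Lemma X_linear j : linear_op (X_op j).
Proof.
move=> a u v; apply: test_val_inj; apply/funext => x.
rewrite test_valZD -[LHS]/(x ord0 j * test_val (a *: u + v) x) test_valZD.
by rewrite /= /mul_coord; ring.
Qed.

Lemma lap_linear : linear_op lap_op.
Proof.
move=> a u v; apply: test_val_inj; apply/funext => x.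
exact: (lap_lin Oup a x (test_of u) (test_of v)).
Qed.

Lemma C_linear j : linear_op (C_op j).
Proof.
move=> a u v; rewrite /C_op.
rewrite (lap_linear a u v) (X_linear j a (lap_op u)) (X_linear j a u) lap_linear.
by rewrite scalerBr opprD addrACA.
Qed.

Lemma X_sym j v w : b_form (X_op j v) w = b_form v (X_op j w).
Proof. by apply: eq_hyp_int => x _ /=; rewrite /mul_coord; ring. Qed.

Lemma E_X_comm j v w : E_form (X_op j v) w = E_form v (X_op j w) - b_form (C_op j v) w.
Proof.
have [bb _ _] := b_form_semi_inner.
by rewrite !E_lap /C_op (bformBl bb) X_sym opprB addrC subrK.
Qed.

Section bounds.
Variables (c C B : R).
Hypotheses (c0 : 0 < c) (C0 : 0 < C) (B0 : 0 < B).
Hypotheses (hO : forall x, Omega x -> c <= height x <= C) (OB : Omega `<=` box B).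

Let bP u : 0 <= b_form u u. Proof. by case: b_form_semi_inner. Qed.
Let EP u : 0 <= E_form u u. Proof. by case: E_form_semi_inner. Qed.

Lemma X_bounded_b j u : b_form (X_op j u) (X_op j u) <= B ^+ 2 * b_form u u.
Proof.
have tu := test_of u; have tuu := test_mul tu tu.
rewrite -[leRHS]addr0 -(hyp_int0 Oup Oop) -hyp_int_lin//; last exact: test0.
apply: (hyp_int_le Oup Oop).
- by apply: test_mul; exact: test_of.
- by apply: testD; [exact: testZ|exact: test0].
move=> x Ox; rewrite addr0 /= /mul_coord.
have h : x ord0 j ^+ 2 <= B ^+ 2.
  have := OB Ox j; rewrite -[x ord0 j ^+ 2]real_normK ?num_real//.
  by rewrite -ler_sqr ?nnegrE ?(ltW B0).
rewrite -expr2 exprMn -[test_val u x * _]expr2.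
by apply: ler_wpM2r => //; exact: sqr_ge0.
Qed.

Lemma X_bounded_E j u : E_form (X_op j u) (X_op j u) <=
  2 * B ^+ 2 * E_form u u + 2 * C ^+ 2 * b_form u u.
Proof.
have tu := test_of u; have tuu := test_mul tu tu.
have tg := test_grad_dot tu tu.
rewrite -[2 * C ^+ 2 * _]addr0 -(hyp_int0 Oup Oop) -hyp_int_lin//; last exact: test0.
have t1 : test (fun x => 2 * C ^+ 2 * (test_val u \* test_val u) x + (fun=> 0) x).
  by apply: testD; [exact: testZ|exact: test0].
rewrite -hyp_int_lin//.
apply: (hyp_int_le Oup Oop).
- by apply: test_grad_dot; exact: test_of.
- by apply: testD => //; exact: testZ.
move=> x Ox; rewrite addr0 /grad_dot /=.
have /andP[h1 h2] := hO Ox.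
have h : x ord0 j ^+ 2 <= B ^+ 2.
  have := OB Ox j; rewrite -[x ord0 j ^+ 2]real_normK ?num_real//.
  by rewrite -ler_sqr ?nnegrE ?(ltW B0).
set p := test_val u.
have step : \sum_i partial i (mul_coord j p) x * partial i (mul_coord j p) x <=
    2 * B ^+ 2 * (\sum_i partial i p x * partial i p x) + 2 * (p x * p x).
  have -> : 2 * (p x * p x) = \sum_i (j == i)%:R * (2 * (p x * p x)).
    rewrite (bigD1 j)//= eqxx mul1r big1 ?addr0// => i ij.
    by rewrite eq_sym (negbTE ij) mul0r.
  rewrite mulr_sumr -big_split/=; apply: ler_sum => i _.
  have dp : derivable p x (delta_mx ord0 i) by exact: (test_derivable tu).
  rewrite (partialM (@derivable_coord R n j x (delta_mx ord0 i)) dp) partial_coord.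
  have := sqr_ge0 (x ord0 j * partial i p x - p x).
  have := ler_wpM2r (sqr_ge0 (partial i p x)) h.
  have := sqr_ge0 (p x).
  move: (x ord0 j) (partial i p x) (p x) h => xj dd pp h.
  by case: (j == i); rewrite /= ?mulr1 ?mulr0 ?addr0 ?mul1r ?mul0r; nra.
have C1 : height x ^+ 2 <= C ^+ 2.
  have c1 := ltW c0; have C1 := ltW C0.
  by rewrite ler_sqr ?nnegrE//; apply: le_trans h1.
have := ler_wpM2l (sqr_ge0 (height x)) step.
have p2 : 0 <= p x * p x by rewrite -expr2 sqr_ge0.
have := ler_wpM2r p2 C1.
move: (height x ^+ 2) (\sum_i partial i p x * _) (\sum_i _ * _) (p x * p x) => H S1 S2 P.
nra.
Qed.

End bounds.
End forms.
End test_space.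

(** * Compactness for the hyperbolic forms *)

Section test_friedrichs.
Context {R : realType} {n : nat}.
Local Notation T := 'rV[R]_n.+1.
Local Notation mu := (lebesgue_rV (R := R) n.+1).
Local Notation N := n.+1.
Variable Omega : set T.
Hypotheses (Oup : Omega `<=` upper_half_space) (Oop : open Omega).
Variables (c C B : R).
Hypotheses (c0 : 0 < c) (C0 : 0 < C) (B0 : 0 < B).
Hypotheses (hO : forall x, Omega x -> c <= height x <= C) (OB : Omega `<=` box B).
Local Notation D := (test_space Omega).
Implicit Types (u v : D).

Let sq u : R := \int[mu]_x test_val u x ^+ 2.
Let G u : R := \sum_j \int[mu]_x partial j (test_val u) x ^+ 2.

(** On a domain of bounded height the hyperbolic integrals are comparable with
    the Euclidean ones, for which the inequality on a grid is known. *)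
Lemma int_hyp_int (chi : T -> R) : test_function Omega chi ->
  \int[mu]_x chi x = hyp_int Omega (fun x => height x ^+ N * chi x).
Proof.
move=> tc; rewrite -(int_test_setT tc); apply: eq_Rintegral => x.
rewrite inE => /Oup hx; rewrite mulrAC divff ?mul1r//.
by rewrite expf_neq0// gt_eqF.
Qed.

Let tsq u : test_function Omega (fun x => test_val u x ^+ 2).
Proof. exact: (test_mul (test_of u) (test_of u)). Qed.

Let tpsq j u : test_function Omega (fun x => partial j (test_val u) x ^+ 2).
Proof. by apply: test_mul; apply: test_partial; exact: test_of. Qed.

Let heightN x k : Omega x -> c ^+ k <= height x ^+ k <= C ^+ k.
Proof.
move=> Ox; have /andP[h1 h2] := hO Ox.
have hx : 0 < height x by exact: lt_le_trans c0 h1.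
by apply/andP; split; rewrite lerXn2r ?nnegrE// ltW.
Qed.

Let test_hN chi : test_function Omega chi ->
  test_function Omega (fun x => height x ^+ N * chi x).
Proof. by apply: testM; exact: smooth_heightX. Qed.

Lemma b_le_sq u : b_form u u <= c ^- N * sq u.
Proof.
rewrite /sq (int_hyp_int (tsq u)) -[leRHS]addr0 -(hyp_int0 Oup Oop).
rewrite -(hyp_int_lin Oup Oop _ (test_hN (tsq u)) (test0 Omega)).
apply: (hyp_int_le Oup Oop).
- by apply: test_mul; exact: test_of.
- by apply: testD; [apply: testZ; exact: test_hN|exact: test0].
move=> x Ox; rewrite addr0 /= -expr2 mulrA ler_peMl ?sqr_ge0//.
by rewrite ler_pdivlMl ?exprn_gt0// mulr1; have /andP[] := heightN N Ox.
Qed.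

Lemma sq_le_b u : sq u <= C ^+ N * b_form u u.
Proof.
rewrite /sq (int_hyp_int (tsq u)) -[leRHS]addr0 -(hyp_int0 Oup Oop).
rewrite -(hyp_int_lin Oup Oop _ (test_mul (test_of u) (test_of u)) (test0 Omega)).
apply: (hyp_int_le Oup Oop).
- exact/test_hN/tsq.
- by apply: testD; [apply: testZ; apply: test_mul; exact: test_of|exact: test0].
move=> x Ox; rewrite addr0 /= -expr2; apply: ler_wpM2r; first exact: sqr_ge0.
by have /andP[] := heightN N Ox.
Qed.

Lemma G_le_E u : G u <= c ^- 2 * C ^+ N * E_form u u.
Proof.
rewrite /G (eq_bigr _ (fun j _ => int_hyp_int (tpsq j u))).
rewrite -(hyp_int_sum Oup Oop (fun j => test_hN (tpsq j u))).
have tg := test_grad_dot (test_of u) (test_of u).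
rewrite -[leRHS]addr0 -[X in _ <= _ + X](hyp_int0 Oup Oop).
rewrite -(hyp_int_lin Oup Oop _ tg (test0 Omega)).
apply: (hyp_int_le Oup Oop).
- exact: (test_sum _ (fun j => test_hN (tpsq j u))).
- by apply: testD; [exact: testZ|exact: test0].
move=> x Ox; rewrite addr0 /grad_dot -mulr_sumr.
have S0 : 0 <= \sum_j partial j (test_val u) x ^+ 2.
  by apply: sumr_ge0 => j _; exact: sqr_ge0.
rewrite mulrA; apply: ler_pM => //.
  by rewrite exprn_ge0// ltW//; exact: Oup.
have /andP[_ h1] := heightN N Ox; have /andP[h2 _] := heightN 2 Ox.
rewrite -mulrA mulrC -mulrA; apply: (le_trans h1).
rewrite ler_peMr ?exprn_ge0 ?(ltW C0)//.
by rewrite mulrC ler_pdivlMl ?exprn_gt0// mulr1.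
Qed.

(** The positivity of the variance is the Cauchy-Schwarz inequality on the
    cell. *)
Lemma cell_variance_ge0 (q : set T) (v : R) u : measurable q -> mu q = v%:E ->
  (\int[mu]_(x in q) test_val u x) ^+ 2 <= v * sq u.
Proof.
move=> mq vq; have tu := test_of u.
have mf : measurable_fun setT (test_val u : T -> measurableTypeR R).
  by apply: continuous_measurable_rV; exact: (test_cont tu).
have [M _ fM] := csupp_bounded (test_cont tu) (let: And3 _ h _ := tu in h).
have v0 : 0 <= v by rewrite -lee_fin -vq measure_ge0.
have h : \int[mu]_(x in q) test_val u x ^+ 2 <= sq u.
  rewrite -lee_fin -(cell_sq mq vq mf fM) /sq -EFin_Rint//; last first.
    by apply: csupp_integrable; [exact: (test_cont (tsq u))|case: (tsq u)].
  apply: ge0_subset_integral => //.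
    by apply/measurable_EFinP; exact: measurable_funX.
  by move=> x _; rewrite lee_fin sqr_ge0.
have := cell_variance mq vq mf fM => E.
have : (0 <= (2 * (v * \int[mu]_(x in q) test_val u x ^+ 2 -
   (\int[mu]_(x in q) test_val u x) ^+ 2))%:E)%E.
  rewrite -E; apply: integral_ge0 => x _; apply: integral_ge0 => y _.
  by rewrite lee_fin sqr_ge0.
rewrite lee_fin pmulr_rge0// subr_ge0 => h2; exact: le_trans h2 (ler_wpM2l v0 h).
Qed.

(** The constants of the comparison between Euclidean and hyperbolic integrals
    are absorbed by refining the grid. *)
Lemma test_friedrichs : finite_rank_friedrichs (b_form (Omega := Omega)) (E_form (Omega := Omega)).
Proof.
move=> e e0; pose L := B + 1.
have L0 : 0 < L by rewrite /L ltr_wpDl// ltW.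
pose A := c ^- N * (4 ^+ N * (c ^- 2 * C ^+ N)).
have A0 : 0 <= A by rewrite !mulr_ge0 ?invr_ge0 ?exprn_ge0 ?(ltW c0) ?(ltW C0).
(* [A] is the product of the comparison constants; [d] bounds the mesh *)
pose d := Num.min 1 (e / (A + 1)).
have d0 : 0 < d by rewrite lt_min ltr01 divr_gt0// ltr_wpDl.
have dL : 0 < d / (L *+ 2) by rewrite divr_gt0// pmulrn_lgt0.
have [m _ hm] := near_infty_natSinv_lt (PosNum dL).
have {}hm : L *+ 2 / m.+1%:R <= d.
  have := ltW (hm m (leqnn m)); rewrite /= ler_pdivlMr ?pmulrn_lgt0//.
  by rewrite mulrC.
set h := L *+ 2 / m.+1%:R in hm.
have h0 : 0 < h by rewrite divr_gt0// pmulrn_lgt0.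
have /andP[hd1 hd2] : (h <= 1) && (h <= e / (A + 1)) by rewrite -le_min.
have hA : A * h ^+ 2 <= e.
  have hh : h ^+ 2 <= h by rewrite expr2 ler_piMr// ltW.
  have : h * (A + 1) <= e by rewrite -ler_pdivlMr// ltr_wpDl.
  by nra.
pose v := h ^+ N; have v0 : 0 < v by rewrite exprn_gt0.
pose l (q : 'I_#|{ffun 'I_N -> 'I_m.+1}|) u : R :=
  Num.sqrt (c ^- N) * ((Num.sqrt v)^-1 *
    \int[mu]_(x in cell L (m := m) (enum_val q)) test_val u x).
exists #|{ffun 'I_N -> 'I_m.+1}|, l, (c ^- N * C ^+ N); split.
- move=> q a u w; rewrite /l.
  have mc : measurable (cell L (m := m) (enum_val q)) by exact: measurable_cell.
  have ic (z : D) : mu.-integrable (cell L (m := m) (enum_val q)) (EFin \o test_val z).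
    apply: (integrableS measurableT) => //.
    by have [] := test_of z => sz cz _; apply: csupp_integrable => //; exact: smooth_continuous.
  have -> : \int[mu]_(x in cell L (m := m) (enum_val q)) test_val (a *: u + w) x =
    a * (\int[mu]_(x in cell L (m := m) (enum_val q)) test_val u x) +
    \int[mu]_(x in cell L (m := m) (enum_val q)) test_val w x.
    rewrite -(RintegralZl a mc (ic u)) -RintegralD//.
    exact: (integrableZl mc a (ic u)).
  by ring.
- move=> q u.
  have := cell_variance_ge0 u (@measurable_cell R n L m (enum_val q)) (cell_measure L0 (enum_val q)).
  rewrite -/h -/v => V.
  rewrite /l exprMn exprMn exprVn !sqr_sqrtr ?invr_ge0 ?exprn_ge0 ?(ltW c0) ?(ltW h0)//.
  rewrite -mulrA; apply: ler_wpM2l; first by rewrite invr_ge0 exprn_ge0 ?(ltW c0).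
  apply: le_trans (sq_le_b u).
  by rewrite ler_pdivrMl.
- move=> u; apply: (le_trans (b_le_sq u)).
  have tu := test_of u; have [su cu uO] := tu.
  have fB : supported_in (test_val u) B.
    by move=> x fx; apply: OB; apply: uO; exact: subset_closure.
  have BL : B < L by rewrite /L ltrDl.
  have gE : grad_energy (test_val u) = (G u)%:E.
    rewrite /grad_energy /G -sumEFin; apply: eq_bigr => j _; rewrite EFin_Rint//.
    by apply: csupp_integrable; [exact: (test_cont (tpsq j u))|case: (tpsq j u)].
  have := grid_friedrichs L0 su cu fB BL hd1 gE.
  rewrite EFin_Rint//; last first.
    by apply: csupp_integrable; [exact: (test_cont (tsq u))|case: (tsq u)].
  rewrite lee_fin -/h -/v -/(sq u) => F.
  have -> : \sum_q l q u ^+ 2 = c ^- N * \sum_(k : {ffun 'I_N -> 'I_m.+1})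
      ((Num.sqrt v)^-1 * \int[mu]_(x in cell L k) test_val u x) ^+ 2.
    rewrite mulr_sumr [RHS](reindex (enum_val (A := {ffun 'I_N -> 'I_m.+1})))/=; last first.
      exact/onW_bij/enum_val_bij.
    apply: eq_bigr => q _; rewrite /l exprMn sqr_sqrtr// invr_ge0 exprn_ge0 ?(ltW c0)//.
  have cN : 0 <= c ^- N by rewrite invr_ge0 exprn_ge0 ?(ltW c0).
  apply: (le_trans (ler_wpM2l cN F)); rewrite mulrDr lerD2l.
  have GE := G_le_E u.
  have [_ _ /(_ u) EP] := E_form_semi_inner Oup Oop.
  apply: (@le_trans _ _ (A * h ^+ 2 * E_form u u)); last exact: ler_wpM2r.
  have k0 : 0 <= c ^- N * (4 ^+ N * h ^+ 2).
    by rewrite mulr_ge0// mulr_ge0 ?sqr_ge0 ?exprn_ge0.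
  have := ler_wpM2l k0 GE; rewrite /A; move: (c ^- N) (4 ^+ N : R) (h ^+ 2) (c ^- 2) (C ^+ N) (E_form u u) => *.
  lra.
Qed.

End test_friedrichs.

(** * Completeness of the space of square integrable functions *)

Lemma cvgn_geometric_step {R : realType} (a : R^nat) (K : R) :
  (forall i, `|a i.+1 - a i| <= K * 2^-1 ^+ i) -> cvgn a.
Proof.
move=> h.
have c1 : cvgn (series (telescope a)).
  apply: normed_cvg; apply: (@series_le_cvg _ _ (geometric K 2^-1)).
  - by move=> i /=; exact: normr_ge0.
  - by move=> i /=; exact: (le_trans (normr_ge0 (a i.+1 - a i)) (h i)).
  - by move=> i /=; exact: h.
  - by apply: is_cvg_geometric_series; rewrite ger0_norm ?invr_ge0//; lra.
have -> : a = (fun i => a 0%N + series (telescope a) i).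
  by apply/funext => i; rewrite {1}(eq_sum_telescope a).
by apply: is_cvgD => //; exact: is_cvg_cst.
Qed.

Lemma limn_einf_le {R : realType} (u : (\bar R)^nat) (a : \bar R) M :
  (forall i, (M <= i)%N -> (u i <= a)%E) -> (limn_einf u <= a)%E.
Proof.
move=> h; rewrite limn_einf_lim; apply: lime_le; first exact: is_cvg_einfs.
apply: nearW => i; apply: (@le_trans _ _ (u (maxn M i))); last first.
  by apply: h; exact: leq_maxl.
by apply: ereal_inf_lbound; exists (maxn M i) => //=; exact: leq_maxr.
Qed.

Section riesz_fischer.
Context d (S : measurableType d) (R : realType).
Variables (mu : {measure set S -> \bar R}) (D : set S) (w : S -> R) (f : nat -> S -> R).
Hypotheses (mD : measurable D) (mw : measurable_fun D w).
Hypothesis w0 : forall x, D x -> 0 < w x.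
Hypothesis mf : forall i, measurable_fun D (f i).

Let dist2 (g h : S -> R) : \bar R := (\int[mu]_(x in D) ((g x - h x) ^+ 2 * w x)%:E)%E.

Let m2 (g h : S -> R) : measurable_fun D g -> measurable_fun D h ->
  measurable_fun D (fun x => ((g x - h x) ^+ 2 * w x)%:E).
Proof.
move=> mg mh; apply/measurable_EFinP; apply: measurable_funM => //.
by apply: measurable_funX; exact: measurable_funB.
Qed.

Let pos2 (g h : S -> R) x : D x -> (0 <= ((g x - h x) ^+ 2 * w x)%:E)%E.
Proof. by move=> Dx; rewrite lee_fin mulr_ge0 ?sqr_ge0// ltW// w0. Qed.

Hypothesis cauchy_f : forall e : R, 0 < e -> exists M, forall m l,
  (M <= m)%N -> (M <= l)%N -> (dist2 (f m) (f l) <= e%:E)%E.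

(** Along a rapidly converging subsequence the differences of successive terms,
    weighted by [4 ^+ i], have a finite sum almost everywhere, and then the
    differences decrease geometrically. *)
Lemma cauchy_cvg_ae : exists k : nat -> nat, (forall i, (i <= k i)%N) /\
  exists N, [/\ measurable N, mu N = 0 & forall x, (D `\` N) x -> cvgn (fun i => f (k i) x)].
Proof.
(* the weights [4 ^+ i] then leave a convergent series *)
have e0 i : 0 < (2 ^ i.+1)%:R^-1 / 4 ^+ i :> R.
  by rewrite divr_gt0 ?exprn_gt0// invr_gt0 ltr0n expn_gt0.
have /choice[M hM] i := cauchy_f (e0 i).
pose k i := (\sum_(j < i.+1) M j + i)%N.
have kM i : (M i <= k i)%N.
  by rewrite /k big_ord_recr/= addnAC; apply: leq_addl.
have kS i : (k i <= k i.+1)%N.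
  rewrite /k (big_ord_recr i.+1)/= -addnA leq_add2l.
  by rewrite (leq_trans (leqnSn i))// leq_addl.
exists k; split; first by move=> i; exact: leq_addl.
pose h i x := (4 ^+ i * ((f (k i.+1) x - f (k i) x) ^+ 2 * w x))%:E.
have h0 i x : D x -> (0 <= h i x)%E.
  by move=> Dx; rewrite lee_fin mulr_ge0 ?exprn_ge0// -lee_fin pos2.
have mh i : measurable_fun D (h i).
  apply/measurable_EFinP; apply: measurable_funM; first exact: measurable_cst.
  exact/measurable_EFinP/m2.
pose G x := (\sum_(i <oo) h i x)%E.
have G0 x : D x -> (0 <= G x)%E by move=> Dx; apply: nneseries_ge0 => i _ _; exact: h0.
have mG : measurable_fun D G.
  rewrite (_ : G = fun x => (\sum_(i <oo | i \in xpredT) h i x)%E)//.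
  by apply: ge0_emeasurable_sum => // i x Dx _; exact: h0.
have intG : mu.-integrable D G.
  apply/integrableP; split => //.
  rewrite (eq_integral G); last first.
    by move=> x; rewrite inE => Dx; rewrite gee0_abs// G0.
  rewrite integral_nneseries//.
  apply: (@le_lt_trans _ _ (\sum_(i <oo) (1 / (2 ^ i.+1)%:R)%:E)%E); last first.
    by apply: (le_lt_trans (epsilon_trick0 _ ler01)); rewrite ltry.
  apply: lee_nneseries => [i _ _|i _]; first by apply: integral_ge0 => x Dx; exact: h0.
  rewrite /h; under eq_integral do rewrite EFinM.
  rewrite (@ge0_integralZl_EFin _ _ _ mu _ mD); last 3 first.
  - by move=> x Dx; exact: pos2.
  - exact: m2.
  - by rewrite exprn_ge0.
  apply: (@le_trans _ _ ((4 ^+ i)%:E * ((2 ^ i.+1)%:R^-1 / 4 ^+ i)%:E)%E).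
    apply: lee_wpmul2l; first by rewrite lee_fin exprn_ge0.
    by apply: hM; [exact: leq_trans (kM i) (kS i)|exact: kM].
  by rewrite -EFinM lee_fin mulrC divfK ?expf_neq0// mul1r.
have [N [mN N0 hN]] := integrable_ae mD intG.
exists N; split => // x [Dx Nx].
have Gfin : G x \is a fin_num.
  by apply: contrapT => Gx; apply: Nx; apply: hN => /(_ Dx).
pose g := fine (G x).
have gE : G x = g%:E by rewrite fineK.
have g0 : 0 <= g by rewrite -lee_fin -gE G0.
apply: (@cvgn_geometric_step _ _ (Num.sqrt (g / w x))) => i.
have wx := w0 Dx.
have : (h i x <= g%:E)%E.
  rewrite -gE; have := @nneseries_lim_ge R (h^~ x) xpredT 0%N i.+1 (fun i _ _ => h0 i x Dx).
  apply: le_trans; rewrite big_nat_recr//= leeDr//.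
  by apply: sume_ge0 => j _; exact: h0.
rewrite lee_fin => hi.
have s0 : 0 <= Num.sqrt (g / w x) * 2^-1 ^+ i by rewrite mulr_ge0 ?sqrtr_ge0 ?exprn_ge0.
rewrite -ler_sqr ?nnegrE// real_normK ?num_real// exprMn sqr_sqrtr; last first.
  by rewrite divr_ge0// ltW.
have -> : ((2^-1 : R) ^+ i) ^+ 2 = (4 ^+ i)^-1.
  by rewrite exprAC -exprVn; congr (_ ^+ _); rewrite expr2; lra.
rewrite ler_pdivlMr ?exprn_gt0// ler_pdivlMr//; apply: le_trans hi.
by rewrite le_eqVlt; apply/orP; left; apply/eqP; ring.
Qed.

(** The almost everywhere limit of a subsequence is the limit in the mean, by
    Fatou's lemma. *)
Lemma riesz_fischer : exists2 u, measurable_fun D u &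
  forall e : R, 0 < e -> exists M, forall m, (M <= m)%N -> (dist2 (f m) u <= e%:E)%E.
Proof.
have [k [ki [N [mN N0 cvN]]]] := cauchy_cvg_ae.
pose u x := lim ((fun i => f (k i) x * \1_(~` N) x) @ \oo).
have cv x : D x -> (fun i => f (k i) x * \1_(~` N) x) @ \oo --> u x.
  move=> Dx; rewrite /u; have [Nx|Nx] := pselect (N x).
    have -> : (fun i => f (k i) x * \1_(~` N) x) = cst 0.
      apply/funext => i; rewrite indicE (_ : (x \in ~` N) = false) ?mulr0//.
      by apply/negP; rewrite inE.
    exact: is_cvg_cst.
  have -> : (fun i => f (k i) x * \1_(~` N) x) = (fun i => f (k i) x).
    by apply/funext => i; rewrite indicE mem_set// mulr1.
  exact: cvN.
have mu_ : measurable_fun D u.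
  apply: (@measurable_fun_cvg _ _ _ D (fun i x => f (k i) x * \1_(~` N) x)) => // i.
  apply: measurable_funM => //; apply: measurable_indic; exact: measurableC.
exists u => // e e0; have [M hM] := cauchy_f e0.
exists M => m Mm; rewrite /dist2.
have mDN : measurable (D `\` N) by exact: measurableD.
have sDN : D `\` N `<=` D by exact: subDsetl.
rewrite (ge0_negligible_integral mN mD (m2 (mf m) mu_) (fun x => @pos2 _ _ x) N0).
rewrite (eq_integral (fun x => limn_einf (fun i => ((f m x - f (k i) x) ^+ 2 * w x)%:E))); last first.
  move=> x; rewrite inE => -[Dx Nx]; apply/esym.
  have cx : (fun i => f (k i) x) @ \oo --> u x.
    have := cv x Dx; rewrite (_ : (fun i => f (k i) x * \1_(~` N) x) = (fun i => f (k i) x))//.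
    by apply/funext => i; rewrite indicE mem_set// mulr1.
  have c2 : (((f m x - f (k i) x) ^+ 2 * w x)%:E) @[i --> \oo] --> (((f m x - u x) ^+ 2 * w x)%:E).
    apply: cvg_EFin; first exact: nearW.
    apply: cvgM; last exact: cvg_cst.
    by apply: cvgM; (apply: cvgB; first exact: cvg_cst).
  by have [-> _] := cvg_limn_einf_sup c2.
apply: (le_trans (fatou mu mDN (f := fun i x => ((f m x - f (k i) x) ^+ 2 * w x)%:E) _ _)).
- by move=> i; apply: measurable_funS (m2 _ _).
- by move=> i x [Dx _]; exact: pos2.
apply: (@limn_einf_le _ _ _ M) => i Mi.
apply: (@le_trans _ _ (dist2 (f m) (f (k i)))).
  exact: (ge0_subset_integral _ mDN mD (m2 (mf m) (mf (k i))) (fun x => @pos2 _ _ x) sDN).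
by apply: hM => //; exact: leq_trans (ki i).
Qed.

End riesz_fischer.

(** * Square integrable functions and test functions *)

Section square_norm.
Context {R : realType} {n : nat}.
Local Notation T := 'rV[R]_n.+1.
Local Notation mu := (lebesgue_rV (R := R) n.+1).
Local Notation N := n.+1.
Variable Omega : set T.
Hypotheses (Oup : Omega `<=` upper_half_space) (Oop : open Omega).
Local Notation test := (test_function Omega).
Local Notation meas f := (measurable_fun Omega (f : T -> measurableTypeR R)).
Local Notation w x := (height x ^- N).
Implicit Types (f g h u : T -> R) (phi psi : T -> R) (x : T).

Let mO : measurable Omega := measurable_Omega Oop.

Lemma weight_gt0 x : Omega x -> 0 < w x.
Proof. by move=> /Oup hx; rewrite invr_gt0 exprn_gt0. Qed.

Lemma measurable_weight : meas (fun x => w x).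
Proof.
apply: (@eq_measurable_fun _ _ _ _ _ (fun x => height x `^ (- N%:R))).
  move=> x; rewrite inE => /Oup hx.
  by rewrite powRN powR_mulrn// ltW.
apply: measurable_funTS; apply: (measurableT_comp (measurable_powR _)).
exact: measurable_coord.
Qed.

Lemma measurable_test phi : test phi -> meas phi.
Proof.
move=> tp; apply: measurable_funTS; apply: continuous_measurable_rV.
exact: test_cont tp.
Qed.

Lemma measurable_sq f : meas f -> measurable_fun Omega (fun x => (f x ^+ 2 * w x)%:E).
Proof.
move=> mf; apply/measurable_EFinP; apply: measurable_funM; last exact: measurable_weight.
exact: measurable_funX.
Qed.

Lemma sq_weight_ge0 f x : Omega x -> (0 <= (f x ^+ 2 * w x)%:E)%E.
Proof. by move=> Ox; rewrite lee_fin mulr_ge0 ?sqr_ge0// ltW// weight_gt0. Qed.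

Lemma sqnorm_ge0 f : (0 <= sqnorm Omega f)%E.
Proof. by apply: integral_ge0 => x; exact: sq_weight_ge0. Qed.

Lemma eq_sqnorm f g : (forall x, Omega x -> f x ^+ 2 = g x ^+ 2) -> sqnorm Omega f = sqnorm Omega g.
Proof. by move=> h; apply: eq_integral => x; rewrite inE => Ox; rewrite h. Qed.

Lemma sqnorm_lin (a : R) f g : meas f -> meas g ->
  (sqnorm Omega (fun x => a * f x + g x)%R <=
   (2 * a ^+ 2)%:E * sqnorm Omega f + 2%:E * sqnorm Omega g)%E.
Proof.
move=> mf mg; have mf2 := measurable_sq mf; have mg2 := measurable_sq mg.
have a0 : 0 <= 2 * a ^+ 2 by rewrite mulr_ge0 ?sqr_ge0.
rewrite -(ge0_integralZl_EFin mu mO (@sq_weight_ge0 f) mf2 a0).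
rewrite -(ge0_integralZl_EFin mu mO (@sq_weight_ge0 g) mg2 (ler0n R 2)).
rewrite -ge0_integralD//; first last.
- by apply: measurable_funeM.
- by move=> x Ox; rewrite mule_ge0// sq_weight_ge0.
- by apply: measurable_funeM.
- by move=> x Ox; rewrite mule_ge0 ?lee_fin// -?lee_fin sq_weight_ge0.
apply: ge0_le_integral => //.
- by move=> x; exact: (@sq_weight_ge0 (fun x => a * f x + g x)).
- by apply: measurable_sq; apply: measurable_funD => //; apply: measurable_funM.
- by apply: emeasurable_funD; apply: measurable_funeM.
move=> x Ox; rewrite -!EFinM -EFinD lee_fin.
rewrite !mulrA -mulrDl; apply: ler_wpM2r; first by rewrite ltW// weight_gt0.
by have := sqr_ge0 (a * f x - g x); nra.
Qed.

Lemma sqnormB_le f g h : meas f -> meas g -> meas h ->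
  (sqnorm Omega (f \- h)%R <= 2%:E * sqnorm Omega (f \- g)%R + 2%:E * sqnorm Omega (h \- g)%R)%E.
Proof.
move=> mf mg mh.
have := sqnorm_lin (-1) (measurable_funB mh mg) (measurable_funB mf mg).
rewrite sqrrN expr1n mulr1 addeC => H; apply: le_trans H.
by rewrite le_eqVlt; apply/orP; left; apply/eqP; apply: eq_sqnorm => x _ /=; ring.
Qed.

Lemma sq_integrable f : meas f -> (sqnorm Omega f < +oo)%E ->
  mu.-integrable Omega (EFin \o (fun x => f x ^+ 2 * w x)).
Proof.
move=> mf ff; apply/integrableP; split; first exact: measurable_sq.
rewrite (_ : \int[mu]_(x in Omega) _ = sqnorm Omega f)%E//.
by apply: eq_integral => x; rewrite inE => Ox; rewrite gee0_abs// sq_weight_ge0.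
Qed.

Lemma sqnorm_test phi : test phi -> sqnorm Omega phi = (l2_form Omega phi phi)%:E.
Proof.
move=> tp; rewrite -EFin_Rint//; last first.
  exact: (integrable_test Oop (test_weight Oup (test_mul tp tp))).
Qed.

Lemma sqnorm_grad_test phi : test phi -> sqnorm_grad Omega phi = (energy_form Omega phi phi)%:E.
Proof.
move=> tp; rewrite -EFin_Rint//; last first.
  exact: (integrable_test Oop (test_weight Oup (test_grad_dot tp tp))).
apply: eq_integral => x; rewrite inE => /Oup hx; congr (_ * _)%:E.
rewrite /hyp_dot /grad_dot !mulr_sumr; apply: eq_bigr => j _.
rewrite /hyp_grad mxE.
have h0 : height x != 0 by rewrite gt_eqF.
by field.
Qed.

Lemma pair_integrable f psi : meas f -> (sqnorm Omega f < +oo)%E -> test psi ->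
  mu.-integrable Omega (EFin \o (fun x => f x * psi x * w x)).
Proof.
move=> mf ff tp.
have i1 := sq_integrable mf ff.
have i2 := sq_integrable (measurable_test tp).
rewrite sqnorm_test// ltry in i2; have {}i2 := i2 isT.
have i12 : mu.-integrable Omega (EFin \o (fun x => f x ^+ 2 * w x + psi x ^+ 2 * w x)).
  exact: (integrableD mO i1 i2).
apply: (le_integrable mO _ _ i12).
  apply/measurable_EFinP; apply: measurable_funM; last exact: measurable_weight.
  by apply: measurable_funM => //; exact: measurable_test.
move=> x Ox /=; have wx := weight_gt0 Ox; rewrite lee_fin.
rewrite [leRHS]ger0_norm; last by rewrite -mulrDl mulr_ge0 ?addr_ge0 ?sqr_ge0 ?ltW.
rewrite normrM (gtr0_norm wx) -mulrDl; apply: ler_wpM2r; first exact: ltW.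
rewrite ler_norml; have := sqr_ge0 (f x - psi x); have := sqr_ge0 (f x + psi x).
by move: (f x) (psi x) => p q; rewrite sqrrD sqrrB => *; apply/andP; split; nra.
Qed.

Lemma pair_lin (a : R) f g psi : meas f -> (sqnorm Omega f < +oo)%E ->
  meas g -> (sqnorm Omega g < +oo)%E -> test psi ->
  hyp_int Omega (fun x => (a * f x + g x) * psi x) =
  a * hyp_int Omega (f \* psi) + hyp_int Omega (g \* psi).
Proof.
move=> mf ff mg fg tp.
have i1 := pair_integrable mf ff tp; have i2 := pair_integrable mg fg tp.
rewrite /hyp_int -RintegralZl// -RintegralD//; last exact: (integrableZl mO a i1).
by apply: eq_Rintegral => x _ /=; ring.
Qed.

(** The arithmetic-geometric mean inequality stands in for Cauchy-Schwarz; the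
    parameter [d] is chosen afterwards. *)
Lemma pair_le f psi (r d : R) : meas f -> (sqnorm Omega f <= r%:E)%E -> test psi -> 0 < d ->
  `|hyp_int Omega (f \* psi)| <= r / d + d * l2_form Omega psi psi.
Proof.
move=> mf fr tp d0; have ff : (sqnorm Omega f < +oo)%E by apply: le_lt_trans fr (ltry _).
have i1 := sq_integrable mf ff.
have i2 := sq_integrable (measurable_test tp).
rewrite sqnorm_test// ltry in i2; have {}i2 := i2 isT.
have i3 := pair_integrable mf ff tp.
have i1' : mu.-integrable Omega (EFin \o (fun x => d^-1 * (f x ^+ 2 * w x))) := integrableZl mO d^-1 i1.
have i2' : mu.-integrable Omega (EFin \o (fun x => d * (psi x ^+ 2 * w x))) := integrableZl mO d i2.
have i12 : mu.-integrable Omega (EFin \o (fun x => d^-1 * (f x ^+ 2 * w x) + d * (psi x ^+ 2 * w x))).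
  exact: (integrableD mO i1' i2').
apply: (le_trans (le_normr_Rintegral mO i3)).
apply: (@le_trans _ _ (\int[mu]_(x in Omega) (d^-1 * (f x ^+ 2 * w x) + d * (psi x ^+ 2 * w x)))).
  apply: le_Rintegral => //; first exact: (integrable_norm i3).
  move=> x Ox; have wx := weight_gt0 Ox.
  rewrite normrM (gtr0_norm wx) (mulrA d^-1) (mulrA d) -mulrDl; apply: ler_wpM2r; first exact: ltW.
  have e0 : 0 < d^-1 by rewrite invr_gt0.
  have de : d^-1 * d = 1 by rewrite mulVf// gt_eqF.
  have -> : d^-1 * f x ^+ 2 + d * psi x ^+ 2 = d^-1 * (f x ^+ 2 + (d * psi x) ^+ 2).
    rewrite exprMn mulrDr mulrA [d ^+ 2]expr2 !mulrA de mul1r//.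
  rewrite -[leLHS]mul1r -de -mulrA; apply: ler_wpM2l; first exact: ltW.
  rewrite -{1}(gtr0_norm d0) -normrM mulrCA ler_norml.
  have := sqr_ge0 (f x - d * psi x); have := sqr_ge0 (f x + d * psi x).
  by move: (f x) (d * psi x) => p q; rewrite sqrrD sqrrB => *; apply/andP; split; nra.
rewrite RintegralD// RintegralZl// RintegralZl// mulrC; apply: lerD.
  apply: ler_wpM2r; first by rewrite invr_ge0 ltW.
  by rewrite -lee_fin -EFin_Rint.
rewrite le_eqVlt; apply/orP; left; apply/eqP; congr (_ * _).
Qed.

Lemma sqnorm_eq0 f : meas f -> sqnorm Omega f = 0%E <-> f = cst 0 %[ae mu in Omega].
Proof.
move=> mf.
have -> : (sqnorm Omega f = 0 <-> (\int[mu]_(x in Omega) `|(f x ^+ 2 * w x)%:E| = 0)%E)%E.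
  rewrite (eq_integral (fun x => (f x ^+ 2 * w x)%:E))//.
  by move=> x; rewrite inE => Ox; rewrite gee0_abs// sq_weight_ge0.
rewrite (ae_eq_integral_abs mu mO (measurable_sq mf)); split; apply: filterS => x h Ox.
  have := h Ox => -[] /eqP; rewrite mulf_eq0 (gt_eqF (weight_gt0 Ox)) orbF sqrf_eq0.
  by move/eqP.
by have -> : f x = 0 := h Ox; rewrite expr2 !mul0r.
Qed.

End square_norm.

(** * Functions represented by the completion *)

Lemma cvgr_eps {R : realType} (a : R^nat) (l : R) :
  (forall e : R, 0 < e -> exists M, forall m, (M <= m)%N -> `|a m - l| <= e) ->
  a @ \oo --> l.
Proof.
move=> h; apply/cvgrPdist_le => e e0; have [M hM] := h e e0.
by exists M => // m Mm; rewrite distrC; exact: hM.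
Qed.

Lemma cvge0_eps {R : realType} (a : (\bar R)^nat) : (forall m, (0 <= a m)%E) ->
  (a @ \oo --> 0%E) <->
  (forall e : R, 0 < e -> exists M, forall m, (M <= m)%N -> (a m <= e%:E)%E).
Proof.
move=> a0; split=> [/fine_cvgP[[M1 _ h1] /cvgrPdist_le h2] e e0|h].
  have [M2 _ h2'] := h2 e e0.
  exists (maxn M1 M2) => m; rewrite geq_max => /andP[m1 m2].
  have := h1 m m1 => /= af; rewrite -(fineK af) lee_fin.
  by have := h2' m m2; rewrite /= sub0r normrN; apply: le_trans; exact: ler_norm.
have fin e : 0 < e -> exists M, forall m, (M <= m)%N -> a m \is a fin_num /\ fine (a m) <= e.
  move=> e0; have [M hM] := h e e0; exists M => m Mm.
  have af : a m \is a fin_num by rewrite ge0_fin_numE// (le_lt_trans (hM m Mm))// ltry.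
  by split=> //; rewrite -lee_fin fineK// hM.
apply/fine_cvgP; split.
  by have [M hM] := fin 1 ltr01; exists M => // m /= Mm; case: (hM m Mm).
apply: cvgr_eps => e e0; have [M hM] := fin e e0; exists M => m Mm.
by rewrite subr0 /= ger0_norm ?fine_ge0//; case: (hM m Mm).
Qed.

Section representation.
Context {R : realType} {n : nat}.
Local Notation T := 'rV[R]_n.+1.
Local Notation mu := (lebesgue_rV (R := R) n.+1).
Local Notation N := n.+1.
Variable Omega : set T.
Hypotheses (Oup : Omega `<=` upper_half_space) (Oop : open Omega).
Local Notation test := (test_function Omega).
Local Notation meas f := (measurable_fun Omega (f : T -> measurableTypeR R)).
Local Notation D := (test_space Omega).
Local Notation b := (@b_form R n Omega).
Local Notation E := (@E_form R n Omega).

Let hb : semi_inner b := b_form_semi_inner Oup Oop.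
Let hE : semi_inner E := E_form_semi_inner Oup Oop.
Let hs := semi_inner_energy hb hE.
Let bb := bounded_form_energy_b hb hE.
Let bE := bounded_form_energy_E hb hE.
Local Notation H := (completion hs).
Local Notation b' := (ext (hs := hs) b).
Local Notation E' := (ext (hs := hs) E).
Implicit Types (x y z : H) (u v : T -> R).

Let mtest (f : D) : meas (test_val f) := measurable_test (test_of f).

Let ftest (f : D) : (sqnorm Omega (test_val f) < +oo)%E.
Proof. by rewrite (sqnorm_test Oup Oop (test_of f)) ltry. Qed.

Let sqnorm_b (f : D) : sqnorm Omega (test_val f) = (b f f)%:E.
Proof. exact: (sqnorm_test Oup Oop (test_of f)). Qed.

(** The approximants converge to [u] in the square norm: [u] is the image of [x]
    in the space of square integrable functions. *)
Definition represents x u := [/\ meas u, (sqnorm Omega u < +oo)%E &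
  forall e : R, 0 < e -> exists M, forall m, (M <= m)%N ->
    (sqnorm Omega (test_val (approximant x m) \- u)%R <= e%:E)%E].

(** The pairing with a fixed test function is continuous for the square norm. *)
Lemma represents_pairing x u (f : D) : represents x u ->
  b' x (emb hs f) = hyp_int Omega (u \* test_val f).
Proof.
move=> [mu_ fu cu]; apply: (extE bb); apply: cvgr_eps => e e0.
pose B := b f f + 1.
have B0 : 0 < B by rewrite ltr_wpDl//; case: hb.
pose d := e / 2 / B.
have d0 : 0 < d by rewrite !divr_gt0.
have [|M hM] := cu (e / 2 * d); first by rewrite mulr_gt0// divr_gt0.
exists M => m Mm.
have mm := measurable_funB (mtest (approximant x m)) mu_.
have := pair_le Oup Oop mm (hM m Mm) (test_of f) d0.
rewrite mulfK ?gt_eqF// => h.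
have -> : b (approximant x m) (approximant (emb hs f) m) - hyp_int Omega (u \* test_val f) =
    hyp_int Omega ((test_val (approximant x m) \- u) \* test_val f).
  have := pair_lin Oup Oop (-1) mu_ fu (mtest (approximant x m)) (ftest (approximant x m)) (test_of f).
  rewrite mulN1r addrC => <-; apply: eq_hyp_int => t _ /=; ring.
apply: (le_trans h).
have h1 : d * l2_form Omega (test_val f) (test_val f) <= e / 2.
  rewrite /d mulrAC ler_pdivrMr// ler_pM2l ?divr_gt0// /B lerDl; exact: ler01.
lra.
Qed.

Lemma represents_lin (a : R) x y u v : represents x u -> represents y v ->
  represents (a *: x + y) (fun t => a * u t + v t).
Proof.
move=> [mu_ fu cu] [mv fv cv]; split.
- by apply: measurable_funD => //; apply: measurable_funM.
- apply: (le_lt_trans (sqnorm_lin Oup Oop a mu_ mv)).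
  rewrite -(fineK (x := sqnorm Omega u)) ?ge0_fin_numE ?(sqnorm_ge0 Oup)//.
  rewrite -(fineK (x := sqnorm Omega v)) ?ge0_fin_numE ?(sqnorm_ge0 Oup)//.
  by rewrite -!EFinM -EFinD ltry.
move=> e e0.
have K0 : 0 < 4 * (a ^+ 2 + 1).
  by rewrite mulr_gt0// ltr_wpDl// sqr_ge0.
have [|M1 h1] := cu (e / (4 * (a ^+ 2 + 1))); first by rewrite divr_gt0.
have [|M2 h2] := cv (e / 4); first by rewrite divr_gt0.
exists (maxn M1 M2) => m; rewrite geq_max => /andP[m1 m2].
have := sqnorm_lin Oup Oop a (measurable_funB (mtest (approximant x m)) mu_)
  (measurable_funB (mtest (approximant y m)) mv).
rewrite (eq_sqnorm (g := test_val (approximant (a *: x + y) m) \-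
   (fun t => a * u t + v t))); last first.
  move=> t _.
  rewrite -[RHS]/((test_val (a *: approximant x m + approximant y m) t - (a * u t + v t)) ^+ 2).
  by rewrite test_valZD /=; ring.
move=> h; apply: (le_trans h).
apply: (@le_trans _ _ ((2 * a ^+ 2)%:E * (e / (4 * (a ^+ 2 + 1)))%:E + 2%:E * (e / 4)%:E)%E).
  apply: leeD; apply: lee_wpmul2l.
  - by rewrite lee_fin mulr_ge0 ?sqr_ge0.
  - exact: h1.
  - by rewrite lee_fin.
  - exact: h2.
rewrite -!EFinM -EFinD lee_fin.
have h3 : 2 * a ^+ 2 * (e / (4 * (a ^+ 2 + 1))) <= e / 2.
  rewrite mulrA ler_pdivrMr//.
  by have := sqr_ge0 a; move: (a ^+ 2) => q q0; nra.
lra.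
Qed.

Lemma represents0 : represents 0 (fun=> 0).
Proof.
have z : sqnorm Omega (fun=> 0) = 0%E.
  by rewrite /sqnorm (eq_integral (cst 0%E)) ?integral0// => t _; rewrite expr2 !mul0r.
split; rewrite ?z//.
move=> e e0; exists 0%N => m _.
rewrite (eq_sqnorm (g := fun=> 0)) ?z ?lee_fin ?ltW// => t _.
by rewrite /= subr0.
Qed.

Lemma represents_sum m (c : 'I_m -> R) (x : 'I_m -> H) (u : 'I_m -> T -> R) :
  (forall i, represents (x i) (u i)) ->
  represents (\sum_i c i *: x i) (fun t => \sum_i c i * u i t).
Proof.
move=> h; elim: (index_enum _) => [|i r IH].
  rewrite big_nil (_ : (fun t => _) = fun=> 0); first exact: represents0.
  by apply/funext => t; rewrite big_nil.
rewrite big_cons (_ : (fun t => _) = fun t => c i * u i t + \sum_(j <- r) c j * u j t).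
  exact: represents_lin.
by apply/funext => t; rewrite big_cons.
Qed.

(** Both [b' x x] and the square norm of [u] are limits of the square norms of the
    approximants; a comparison of each with the other suffices. *)
Lemma represents_null x u : represents x u -> b' x x = 0 <-> sqnorm Omega u = 0%E.
Proof.
move=> [mu_ fu cu]; have cb := ext_cvg (x := x) (y := x) bb.
have sf : sqnorm Omega u = (fine (sqnorm Omega u))%:E.
  by rewrite fineK// ge0_fin_numE// (sqnorm_ge0 Oup).
set q := fine _ in sf.
have q0 : 0 <= q by rewrite fine_ge0// (sqnorm_ge0 Oup).
have mx m := mtest (approximant x m).
have b0 : 0 <= b' x x by case: (ext_b_semi_inner hb hE).
have close e : 0 < e -> exists M, forall m, (M <= m)%N ->
    q <= 2 * e + 2 * b (approximant x m) (approximant x m) /\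
    b (approximant x m) (approximant x m) <= 2 * e + 2 * q.
  move=> e0; have [M hM] := cu e e0; exists M => m Mm.
  have e2 : ((2%:E : \bar R) * sqnorm Omega (test_val (approximant x m) \- u)%R <= (2 * e)%:E)%E.
    by rewrite EFinM; apply: lee_wpmul2l => //; exact: hM.
  split; rewrite -lee_fin.
    rewrite -sf EFinD (EFinM 2 (b _ _)) -sqnorm_b.
    have := sqnorm_lin Oup Oop (-1) (measurable_funB (mx m) mu_) (mx m).
    rewrite sqrrN expr1n mulr1 (eq_sqnorm (g := u)) => [h|t _ /=]; last by ring.
    by apply: (le_trans h); exact: leeD2r.
  rewrite -sqnorm_b EFinD (EFinM 2 q) -sf.
  have := sqnorm_lin Oup Oop 1 (measurable_funB (mx m) mu_) mu_.
  rewrite expr1n mulr1 (eq_sqnorm (g := test_val (approximant x m))) => [h|t _ /=]; last by ring.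
  by apply: (le_trans h); exact: leeD2r.
split=> [xx|s0].
  rewrite sf; congr EFin; apply/eqP; rewrite eq_le q0 andbT.
  apply/ler_addgt0Pr => e e0; rewrite add0r.
  have e4 : 0 < e / 4 by rewrite divr_gt0.
  have [M1 h1] := close _ e4.
  move: cb => /cvgrPdist_le/(_ _ e4)[M2 _ h2].
  have [h _] := h1 _ (leq_maxl M1 M2).
  have := h2 _ (leq_maxr M1 M2); rewrite /= xx sub0r normrN => h3.
  have := le_trans (ler_norm _) h3; lra.
have q00 : q = 0 by apply: EFin_inj; rewrite -sf.
apply/eqP; rewrite eq_le b0 andbT; apply/ler_addgt0Pr => e e0; rewrite add0r.
have e2 : 0 < e / 2 by rewrite divr_gt0.
have [M hM] := close _ e2.
apply: (limR_le cb (cvg_cst e) (M := M)) => m Mm.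
have [_] := hM m Mm; rewrite q00; lra.
Qed.

Lemma test_valB (f g : D) : test_val (f - g) = (test_val f \- test_val g).
Proof. by []. Qed.

Lemma approximant_cauchy_forms x (e : R) : 0 < e -> exists M, forall m l,
  (M <= m)%N -> (M <= l)%N ->
  b (approximant x m - approximant x l) (approximant x m - approximant x l) < e /\
  E (approximant x m - approximant x l) (approximant x m - approximant x l) < e.
Proof.
move=> e0; have [|M hM] := approximant_cauchy x (e := Num.sqrt e).
  by rewrite sqrtr_gt0.
exists M => m l Mm Ml; have := hM m l Mm Ml; set d := _ - _.
rewrite /nrm ltr_sqrt// /energy.
have : 0 <= b d d by case: hb.
have : 0 <= E d d by case: hE.
move=> p1 p2 p3; split; lra.
Qed.

Lemma represents_exists x : exists u, represents x u.
Proof.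
pose f m : T -> R := test_val (approximant x m).
have cf e : 0 < e -> exists M, forall m l, (M <= m)%N -> (M <= l)%N ->
    (\int[mu]_(t in Omega) ((f m t - f l t) ^+ 2 * height t ^- N)%:E <= e%:E)%E.
  move=> e0; have [M hM] := approximant_cauchy_forms x e0.
  exists M => m l Mm Ml; have [h _] := hM m l Mm Ml.
  have := sqnorm_b (approximant x m - approximant x l); rewrite test_valB => E1.
  by rewrite -[leLHS]/(sqnorm Omega (f m \- f l)%R) E1 lee_fin ltW.
have [u mu_ hu] := @riesz_fischer _ _ _ mu Omega (fun t => height t ^- N) f
  (measurable_Omega Oop) (measurable_weight Oup) (@weight_gt0 _ _ _ Oup)
  (fun m => mtest (approximant x m)) cf.
exists u; split => //.
have [M hM] := hu 1 ltr01; have {}hM := hM M (leqnn M).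
have mM := mtest (approximant x M).
have := sqnorm_lin Oup Oop (-1) (measurable_funB mM mu_) mM.
rewrite sqrrN expr1n mulr1 (eq_sqnorm (g := u)) => [h|t _ /=]; last by ring.
apply: (le_lt_trans h); rewrite sqnorm_b.
have h1 : ((2%:E : \bar R) * sqnorm Omega (test_val (approximant x M) \- u)%R <= 2%:E * 1%:E)%E.
  by apply: lee_wpmul2l => //; rewrite lee_fin.
apply: (le_lt_trans (leeD2r _ h1)); rewrite -!EFinM -EFinD; exact: ltry.
Qed.

Lemma represents_H10 x u : represents x u -> H10 Omega u.
Proof.
move=> [mu_ fu cu]; split=> //; exists (fun m => test_val (approximant x m)); split.
- by move=> m; exact: test_of.
- apply/cvge0_eps; first by move=> m; exact: sqnorm_ge0.
  exact: cu.
move=> e e0; have [M hM] := approximant_cauchy_forms x e0.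
exists M => m l Mm Ml; have [_ h] := hM m l Mm Ml.
rewrite -test_valB (sqnorm_grad_test Oup Oop (test_of _)) lte_fin.
exact: h.
Qed.

(** The sequence of test functions which defines membership in [H10] is Cauchy
    for the energy norm. *)
Lemma H10_represents u : H10 Omega u -> exists x, represents x u.
Proof.
move=> [mu_ fu [phi [tphi cphi gphi]]].
have {}cphi := (cvge0_eps (fun m => sqnorm_ge0 Oup (phi m \- u))).1 cphi.
pose f m : D := mk_test (tphi m).
have mphi m := measurable_test (tphi m).
have cf : cauchy_nrm (energy b E) f.
  move=> e e0; have e2 : 0 < e ^+ 2 / 8 by rewrite divr_gt0// exprn_gt0.
  have [M1 h1] := cphi _ e2; have [M2 h2] := gphi _ e2.
  exists (maxn M1 M2) => m l; rewrite !geq_max => /andP[m1 m2] /andP[l1 l2].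
  have := h2 m l m2 l2.
  rewrite -[(phi m \- phi l)%R]/(test_val (f m - f l)) (sqnorm_grad_test Oup Oop (test_of _)) lte_fin.
  rewrite -[energy_form _ _ _]/(E (f m - f l) (f m - f l)) => h3.
  have h4 : (sqnorm Omega (phi m \- phi l)%R <= 2%:E * (e ^+ 2 / 8)%:E + 2%:E * (e ^+ 2 / 8)%:E)%E.
    apply: (le_trans (sqnormB_le Oup Oop (mphi m) mu_ (mphi l))).
    by apply: leeD; (apply: lee_wpmul2l => //); exact: h1.
  move: h4; rewrite -[(phi m \- phi l)%R]/(test_val (f m - f l)) sqnorm_b.
  rewrite -!EFinM -EFinD lee_fin => h4.
  rewrite /nrm -[ltRHS]gtr0_norm// -sqrtr_sqr ltr_sqrt ?exprn_gt0// /energy.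
  have : 0 < e ^+ 2 by rewrite exprn_gt0.
  move: h3 h4; move: (b _ _) (E _ _) (e ^+ 2) => p q r; lra.
by exists (mk_completion hs cf); split.
Qed.

End representation.

(** * Dirichlet eigenfunctions as eigenvectors *)

Section eigenfunctions.
Context {R : realType} {n : nat}.
Local Notation T := 'rV[R]_n.+1.
Local Notation mu := (lebesgue_rV (R := R) n.+1).
Local Notation N := n.+1.
Variable Omega : set T.
Hypotheses (Oup : Omega `<=` upper_half_space) (Oop : open Omega).
Local Notation test := (test_function Omega).
Local Notation D := (test_space Omega).
Local Notation b := (@b_form R n Omega).
Local Notation E := (@E_form R n Omega).

Let hb : semi_inner b := b_form_semi_inner Oup Oop.
Let hE : semi_inner E := E_form_semi_inner Oup Oop.
Let hs := semi_inner_energy hb hE.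
Let bb := bounded_form_energy_b hb hE.
Let bE := bounded_form_energy_E hb hE.
Local Notation H := (completion hs).
Local Notation b' := (ext (hs := hs) b).
Local Notation E' := (ext (hs := hs) E).
Implicit Types (x y z : H) (u v : T -> R).

(** Green's formula for the approximants, in the limit. *)
Lemma represents_energy x u (f : D) : represents x u ->
  E' x (emb hs f) = - hyp_int Omega (u \* hyp_laplacian (test_val f)).
Proof.
move=> xu.
have -> : E' x (emb hs f) = b' x (emb hs (lap_op Oup f)).
  apply: (extE bE); apply: (ext_lim bb) => m /=.
  have [_ symb _] := hb; have [_ symE _] := hE.
  by rewrite [LHS]symb [RHS]symE (E_lap Oup Oop).
rewrite (represents_pairing _ xu).
have [mu_ fu _] := xu.
have il := pair_integrable Oup Oop mu_ fu (test_of (lap_op Oup f)).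
rewrite -mulN1r /hyp_int.
rewrite [in RHS](_ : (fun p => _) = fun p => -1 * (u p * test_val (lap_op Oup f) p * height p ^- N)).
  by rewrite (RintegralZl (-1) (measurable_Omega Oop) il) mulrA mulrNN !mul1r.
apply/funext => y; rewrite /= /lap; ring.
Qed.

(** The test functions are dense in the completion. *)
Lemma eigenvector_emb x t : (forall f : D, E' x (emb hs f) = t * b' x (emb hs f)) ->
  is_eigenvector b' E' t x.
Proof.
move=> h v.
have db := bounded_form_energy_b (ext_b_semi_inner hb hE) (ext_E_semi_inner hb hE).
have dE := bounded_form_energy_E (ext_b_semi_inner hb hE) (ext_E_semi_inner hb hE).
have cx : nrm (energy b' E') (x - x) @[_ --> \oo] --> (0 : R).
  rewrite subrr (nrm0 (semi_inner_energy (ext_b_semi_inner hb hE) (ext_E_semi_inner hb hE))).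
  exact: cvg_cst.
have cv : nrm (energy b' E') (emb hs (approximant v m) - v) @[m --> \oo] --> (0 : R).
  by rewrite ext_energy; exact: emb_dense.
have c1 := bounded_form_cvg (x := fun=> x) dE cx cv.
have c2 := bounded_form_cvg (x := fun=> x) db cx cv.
apply: (limR_unique c1).
under eq_fun do rewrite h.
by apply: cvgM => //; exact: cvg_cst.
Qed.

Lemma eigenvector_solution t x u : represents x u ->
  is_eigenvector b' E' t x <-> dirichlet_solution Omega t u.
Proof.
move=> xu; split=> [h|[_ h]].
  split; first exact: represents_H10 xu.
  move=> phi tphi; have := h (emb hs (mk_test tphi)).
  rewrite (represents_energy _ xu) (represents_pairing _ xu) => /eqP.
  by rewrite eqr_oppLR -mulNr => /eqP.
apply: eigenvector_emb => f.
rewrite (represents_energy _ xu) (represents_pairing _ xu) (h _ (test_of f)).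
by rewrite mulNr opprK.
Qed.

(** Equality almost everywhere is the vanishing of [b'], so that bases of
    solutions and of eigenvectors correspond to each other. *)
Lemma enumerates_dirichlet (lam : nat -> R) :
  dirichlet_eigenvalues Omega lam -> enumerates_eigenvalues b' E' lam.
Proof.
move=> [_ hlam] t; have [m [e [se freee spane]] card] := hlam t.
exists m; split => //.
have /choice[x hx] i : exists x, represents (Oup := Oup) (Oop := Oop) x (e i).
  by apply: H10_represents; case: (se i).
have sum_meas c := represents_sum c hx.
exists x; split.
- by move=> i; apply/(eigenvector_solution t (hx i)).
- move=> c /(represents_null (sum_meas c)).
  have [ms _ _] := sum_meas c.
  by move=> /(sqnorm_eq0 Oup Oop ms); exact: freee.
move=> z zt; have [u zu] := represents_exists z.
have [c uc] := spane u ((eigenvector_solution t zu).1 zt).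
exists c => v.
have zc := represents_lin (-1) (sum_meas c) zu.
have [mz _ _] := zc.
have /(sqnorm_eq0 Oup Oop mz)/(represents_null zc) : 
    (fun p => -1 * (\sum_i c i * e i p) + u p) = cst 0 %[ae mu in Omega].
  by apply: filterS uc => y h Oy; rewrite (h Oy) mulN1r addNr.
move=> /(semi_inner_null v (ext_b_semi_inner hb hE)).
have [bil _ _] := ext_b_semi_inner hb hE.
rewrite bil.1 (bform_suml bil) mulN1r addrC => /eqP; rewrite subr_eq0 => /eqP ->.
by apply: eq_bigr => i _; rewrite (bformZl bil).
Qed.

End eigenfunctions.

(** * The inequality for Dirichlet eigenvalues *)

Section weighted_inequality.
Context {R : realType} {n : nat}.
Local Notation T := 'rV[R]_n.+1.
Local Notation N := n.+1.
Variables (Omega : set T) (lam : nat -> R) (k : nat).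
Hypotheses (hOmega : hyp_bounded_domain Omega) (hlam : dirichlet_eigenvalues Omega lam).

(** The commutator inequality, with [1 / rho_max <= height ^+ 2 <= 1 / rho_min]
    on the domain. *)
Lemma dirichlet_yang :
  \sum_(1 <= i < k.+1) (lam k.+1 - lam i) ^+ 2 * (N%:R * (rho_max Omega)^-1) <=
  \sum_(1 <= i < k.+1) (lam k.+1 - lam i) *
    ((rho_min Omega)^-1 * (4 * lam i - N%:R * (N%:R - 2))).
Proof.
have [Oup Oop _ One Obd] := hOmega.
have [c [C [B [c0 C0 B0 hO OB]]]] := hyp_bounded_height Oup Obd.
have M0 := rho_max_gt0 c0 hO One Oup; have m0 := rho_min_gt0 c0 hO One Oup.
set al := (rho_min Omega)^-1; set ga := (rho_max Omega)^-1; set be := N%:R * (N%:R - 2).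
have al0 : 0 < al by rewrite invr_gt0.
have hal x : Omega x -> height x ^+ 2 <= al.
  move=> Ox; have hx : 0 < height x := Oup x Ox.
  rewrite -[leLHS]invrK lef_pV2 ?posrE ?invr_gt0 ?exprn_gt0//.
  exact: (rho_min_le c0 hO Oup Ox).
have hga x : Omega x -> ga <= height x ^+ 2.
  move=> Ox; have hx : 0 < height x := Oup x Ox.
  rewrite -[leRHS]invrK lef_pV2 ?posrE ?invr_gt0 ?exprn_gt0//.
  exact: (rho_le_max c0 hO Oup Ox).
pose hb := b_form_semi_inner Oup Oop; pose hE := E_form_semi_inner Oup Oop.
have b0 (v : test_space Omega) : 0 <= b_form v v by case: hb.
have E0 (v : test_space Omega) : 0 <= E_form v v by case: hE.
have sumC (v : test_space Omega) : \sum_j b_form (C_op Oup j v) (C_op Oup j v) <=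
    al * (4 * E_form v v - be * b_form v v).
  exact: (sum_comm_coord_le Oup Oop (test_of v) hal).
(* bounds both [X_op] and [C_op] in terms of the energy norm *)
pose K := 2 * B ^+ 2 + 2 * C ^+ 2 + al * (4 + `|be|).
have KB : 0 <= 2 * B ^+ 2 by rewrite mulr_ge0 ?sqr_ge0.
have KC : 0 <= 2 * C ^+ 2 by rewrite mulr_ge0 ?sqr_ge0.
have Ka : 0 <= al * (4 + `|be|) by rewrite mulr_ge0 ?addr_ge0 ?normr_ge0// ltW.
have K0 : 0 <= K by rewrite /K; lra.
suff : \sum_(1 <= i < k.+1) (lam k.+1 - lam i) ^+ 2 * (#|'I_N|%:R * ga) <=
    \sum_(1 <= i < k.+1) (lam k.+1 - lam i) * (al * (4 * lam i - be)).
  by rewrite card_ord.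
apply: (@yang_inequality R _ _ _ hb hE 'I_N (@X_op R n Omega) (C_op Oup) K al be ga lam k K0).
- exact: (test_friedrichs Oup Oop c0 C0 B0 hO OB).
- exact: X_linear.
- exact: C_linear.
- exact: X_sym.
- exact: (E_X_comm Oup Oop).
- move=> j v; rewrite /energy.
  have := X_bounded_b Oup Oop B0 OB j v.
  have := X_bounded_E Oup Oop c0 C0 B0 hO OB j v.
  have := mulr_ge0 KB (E0 v); have := mulr_ge0 KC (E0 v).
  have := mulr_ge0 Ka (E0 v); have := mulr_ge0 Ka (b0 v); have := mulr_ge0 KB (b0 v).
  rewrite /K; move: (b_form v v) (E_form v v) (b_form _ _) (E_form _ _) (al * _).
  by move=> *; lra.
- move=> j v; apply: (@le_trans _ _ (al * (4 * E_form v v - be * b_form v v))).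
    apply: le_trans (sumC v); rewrite (bigD1 j)//= lerDl.
    by apply: sumr_ge0 => i _; exact: b0.
  rewrite /energy /K [leRHS]mulrDl -[leLHS]add0r; apply: lerD.
    by apply: mulr_ge0; rewrite addr_ge0.
  rewrite -[leRHS]mulrA; apply: ler_wpM2l; first exact: ltW.
  have bound (p q t : R) : 0 <= p -> 0 <= q -> 4 * q - t * p <= (4 + `|t|) * (p + q).
    move=> p0 q0; have := ler_norm (- t); rewrite normrN => nt.
    have := ler_wpM2r p0 nt; have := mulr_ge0 (normr_ge0 t) q0.
    by move: (`|t|) => r *; nra.
  exact: bound (b0 v) (E0 v).
- exact: sumC.
- move=> j v.
  rewrite -[b_form (C_op Oup j v) _]/(l2_form Omega (comm_coord j (test_val v)) (mul_coord j (test_val v))).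
  rewrite (comm_coord_mul_coord Oup Oop j (test_of v)).
  have tv := test_mul (test_of v) (test_of v).
  rewrite -[leLHS]addr0 -(hyp_int0 Oup Oop) -(hyp_int_lin Oup Oop ga tv (test0 Omega)).
  apply: (hyp_int_le Oup Oop).
  + by apply: testD; [exact: testZ|exact: test0].
  + apply: (testM (smooth_heightX 2) tv).
  move=> x Ox; rewrite addr0; apply: ler_wpM2r; last exact: hga.
  by rewrite /= -expr2 sqr_ge0.
- exact: hlam.1.
- exact: (enumerates_dirichlet Oup Oop hlam).
Qed.

End weighted_inequality.

Theorem theorem1p6 (R : realType) (n : nat) (Omega : set 'rV[R]_n.+1)
    (lam : nat -> R) (k : nat)
    (hOmega : hyp_bounded_domain Omega)
    (hlam : dirichlet_eigenvalues Omega lam)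
    (hk : (1 <= k)%N) :
  \sum_(1 <= i < k.+1) (lam k.+1 - lam i) ^+ 2 <=
  rho_max Omega / rho_min Omega * (4 / n.+1%:R) *
  \sum_(1 <= i < k.+1) (lam k.+1 - lam i) *
    (lam i - (n.+1%:R ^+ 2 - 2 * n.+1%:R - 4) / 4).
Proof.
have [Oup _ _ One Obd] := hOmega.
have [c [C [B [c0 C0 B0 hO OB]]]] := hyp_bounded_height Oup Obd.
have M0 := rho_max_gt0 c0 hO One Oup; have m0 := rho_min_gt0 c0 hO One Oup.
have N0 : 0 < n.+1%:R :> R by rewrite ltr0n.
have := dirichlet_yang k hOmega hlam.
rewrite -mulr_suml -ler_pdivlMr ?divr_gt0// => h; apply: (le_trans h).
rewrite mulr_suml mulr_sumr; apply: ler_sum_nat => i /andP[i1 ik].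
have gap : 0 <= lam k.+1 - lam i.
  by rewrite subr_ge0; apply: hlam.1; rewrite i1 ltnW.
have qn : n.+1%:R != 0 :> R by rewrite pnatr_eq0.
have [Mn mn] : rho_max Omega != 0 /\ rho_min Omega != 0 by split; rewrite gt_eqF.
rewrite -subr_ge0.
rewrite (_ : _ - _ = 4 * (rho_max Omega / rho_min Omega / n.+1%:R) * (lam k.+1 - lam i)).
  apply: mulr_ge0 => //; apply: mulr_ge0 => //.
  by do 2?apply: divr_ge0; exact: ltW.
by field; rewrite nat1r qn Mn mn.
Qed.
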